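(* Let $f$ be an analytic function in $\mathbb{D}$ such that it admits a generalized proximate order $\lambda$, and either $1<\lambda_M(f)<\sigma_M(f)<\infty$ or $0\le\lambda_M(f)<\sigma_M(f)\le1$. Let $\eta\in(0,\sigma_M(f)-\lambda_M(f))$ and $1\le p<\infty$. Then $$\lambda_p(f)\le\lambda_M(f)\left(1-\frac1{\sigma_M(f)}\right)^++1,\qquad \lambda_M(f)\le\lambda_p(f)+\frac1p.$$
   Context: $\mathbb{D}=\{z\in\mathbb{C}:|z|<1\}$, $x^+=\max\{x,0\}$, $\log^+x=\max\{\log x,0\}$ (with $\log^+0=0$), and $M(r,f)=\max\{|f(z)|:|z|=r\}$. For $f$ analytic in $\mathbb{D}$, $$\sigma_M(f)=\limsup_{r\to1^-}\frac{\log^+\log^+M(r,f)}{\log\frac1{1-r}},\qquad \lambda_M(f)=\liminf_{r\to1^-}\frac{\log^+\log^+M(r,f)}{\log\frac1{1-r}},$$ $$m_p(r,\log|f|)=\left(\frac1{2\pi}\int_0^{2\pi}\bigl|\log|f(re^{i\theta})|\bigr|^p\,d\theta\right)^{1/p},\quad 0<r<1,\qquad \lambda_p(f)=\liminf_{r\to1^-}\frac{\log^+m_p(r,\log|f|)}{-\log(1-r)}.$$ Let $f$ be analytic in $\mathbb{D}$ with $0\le\lambda_M(f)<\sigma_M(f)<\infty$ and let $\kappa\in(0,\sigma_M(f)-\lambda_M(f))$. A function $\lambda:[0,1)\to(0,\infty)$ is called a quasi proximate order of $f$, related to $\kappa$, if there is an associated function $A^*$ on $[0,1)$ such that (1) $\lambda\in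 C^1[0,1)$; (2) $\limsup_{r\to1^-}\lambda(r)=\sigma_M(f)$; (3) $\liminf_{r\to1^-}\lambda(r)=\lambda_M(f)+\kappa$; (4) $\limsup_{r\to1^-}|\lambda'(r)|(1-r)\log\frac1{1-r}<\infty$; (5) $A^*(r)\le\frac1{(1-r)^{\lambda(r)}}\le(1+o(1))A^*(r)$ as $r\to1^-$; (6) $A^*$ is nondecreasing and there is a constant $C>0$ with $A^*\left(\frac{1+r}2\right)\le C A^*(r)$ for all $0\le r<1$; (7) $\log M(r,f)\le\frac1{(1-r)^{\lambda(r)}}$ for all $0\le r<1$. If, further, (4') $\limsup_{r\to1^-}|\lambda'(r)|(1-r)\log\frac1{1-r}=0$, then $\lambda$ is called a generalized proximate order of $f$. *)

(* Defs.v *)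
From HB Require Import structures.
From mathcomp Require Import all_boot all_order all_algebra.
From mathcomp Require Import complex.
From mathcomp Require Import all_classical all_reals all_analysis.

Set Implicit Arguments.
Unset Strict Implicit.
Unset Printing Implicit Defensive.

Import Order.TTheory GRing.Theory Num.Theory.
Import numFieldNormedType.Exports.

Local Open Scope classical_set_scope.
Local Open Scope ring_scope.

Section AnalyticFunctions.
Context {R : realType}.
Implicit Types (f : R[i] -> R[i]) (p r : R).

(* [`|z|] lives in [R[i]]; this is the modulus as an element of [R]. *)
Definition modulus (z : R[i]) : R := ComplexField.Normc.normc z.

(* Analyticity: near every point of the disc, f is the sum of a power series
   centred at that point.  Values of f outside the open disc are irrelevant. *)
Definition analytic_in_disc f :=
  forall c : R[i], modulus c < 1 ->
    exists a : nat -> R[i],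
      \forall z \near (c : R[i]^o),
        series (fun n => (a n * (z - c) ^+ n : R[i]^o)) @ \oo --> (f z : R[i]^o).

(* A supremum of real numbers; for f continuous on the circle |z| = r with
   0 <= r < 1 it is attained. *)
Definition maxmod f r : R :=
  sup [set modulus (f z) | z in [set z | modulus z = r]].

(* [lne] is -oo at 0, so [logp 0 = 0]; moreover [logp +oo = +oo]. *)
Definition logp (x : \bar R) : \bar R := (maxe 0 (lne x))%E.

Definition sigmaM f : \bar R :=
  limf_esup (fun r => logp (logp (maxmod f r)%:E) * ((ln (1 / (1 - r)))^-1)%:E)%E
    (1 : R)^'-.

Definition lambdaM f : \bar R :=
  limf_einf (fun r => logp (logp (maxmod f r)%:E) * ((ln (1 / (1 - r)))^-1)%:E)%E
    (1 : R)^'-.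

Definition circle_point r (theta : R) : R[i] :=
  ((r * cos theta) +i* (r * sin theta))%C.

(* A Lebesgue integral with values in [0, +oo]: at a zero of f on the circle
   log |f| = -oo and the integrand is +oo. *)
Definition mean_log p r f : \bar R :=
  (((1 / (2 * pi))%:E *
    \int[lebesgue_measure]_(theta in `[0%R, (2 * pi)%R])
      (`|lne (modulus (f (circle_point r theta)))%:E| `^ p)) `^ (1 / p))%E.

Definition lambda_mean p f : \bar R :=
  limf_einf (fun r => logp (mean_log p r f) * ((- ln (1 - r))^-1)%:E)%E
    (1 : R)^'-.

(* C^1 on D, derivatives being taken within D: at 0 in [0,1) the derivative is
   the right one. *)
Definition C1_on (D : set R) (g : R -> R) :=
  exists g' : R -> R,
    (forall r, D r ->
       (fun s => (g s - g r) / (s - r)) @ within D r^' --> g' r) /\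
    {within D, continuous g'}.

(* Values of lam outside [0,1) are irrelevant: [derive1 lam] is only used near
   1, in the interior of [0,1).  As [lne 0 = -oo], the last condition holds
   trivially at a radius where the maximum modulus vanishes. *)
Definition quasi_proximate_order f (kappa : R) (lam : R -> R) :=
  [/\ 0 < kappa, (kappa%:E < sigmaM f - lambdaM f)%E &
      forall r, 0 <= r < 1 -> 0 < lam r] /\
  exists A : R -> R,
  [/\ C1_on `[0, 1[ lam,
      limf_esup (fun r => (lam r)%:E) (1 : R)^'- = sigmaM f &
      limf_einf (fun r => (lam r)%:E) (1 : R)^'- = (lambdaM f + kappa%:E)%E] /\
  [/\ (limf_esup
         (fun r => (`|derive1 lam r| * (1 - r) * ln (1 / (1 - r)))%:E) (1 : R)^'-
         < +oo)%E,
      exists2 eps : R -> R, eps @ (1 : R)^'- --> (0 : R) &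
        \forall r \near (1 : R)^'-,
          A r <= 1 / (1 - r) `^ (lam r) <= (1 + eps r) * A r,
      {in `[0, 1[ &, {homo A : r s / r <= s}},
      exists2 C : R, 0 < C &
        forall r, 0 <= r < 1 -> A ((1 + r) / 2) <= C * A r &
      forall r, 0 <= r < 1 ->
        (lne (maxmod f r)%:E <= (1 / (1 - r) `^ (lam r))%:E)%E].

Definition generalized_proximate_order f (kappa : R) (lam : R -> R) :=
  quasi_proximate_order f kappa lam /\
  limf_esup
    (fun r => (`|derive1 lam r| * (1 - r) * ln (1 / (1 - r)))%:E) (1 : R)^'- = 0%E.

End AnalyticFunctions.

(* Main.v *)
Require Import Defs.
From HB Require Import structures.
From mathcomp Require Import all_boot all_order all_algebra.
From mathcomp Require Import complex ring lra.
From mathcomp Require Import all_classical all_reals all_analysis.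
From mathcomp Require Import measurable_realfun.

(** Both inequalities are potential theory for the subharmonic function
[ln |f|].  No zero of [f] is located or divided out: everything follows from
comparing [ln |f|], cut off from below, with sums of Green functions of discs.
Write [d = 1 - r] for the distance of a circle [|z| = r] to the unit circle.

Subharmonicity.  A power series gives [f] to second order at every point, so
where [f] does not vanish the values of [ln |f|] at [c + w], [c - w],
[c + i w], [c - i w] add up to [4 ln |f c| + O(|w|^3)] ([harm_ln_modulus]).
This four-point property passes to sums and to convex nondecreasing functions
([subharm_comp]), and perturbation by [eps |z|^2] turns it into a maximum
principle ([max_principle]).  The Green functions satisfy it with both signs,
hence [green_comparison].

The bound [lambda_M <= lambda_p + 1/p].  The function [v = (ln^+ |f|)^p] is
subharmonic.  On the circle [|z| = rho] it is dominated by a sum of Green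
functions with poles just outside that circle, weighted by the values of [v];
evaluating the sum at distance [d = 1 - rho] inside bounds [v] there by [C / d]
times its mean over the circle ([circle_mean_discrete]).  Hence
[ln^+ M(2 rho - 1) <= (C / d)^(1/p) m_p(rho)] ([mean_log_lower]), and the factor
[d^(-1/p)] is the loss of [1/p] in the exponent ([lambdaM_le_lambda_mean]).

The bound on [lambda_p].  On a circle where [ln M] is small the positive part of
[ln |f|] is small as well, so the negative part has to be estimated.  If
[|f| <= e^V] on [|z| = rho] and [|f| <= e^-t] near a set [E], then
[ln |f w| <= V - (t + V) g(w) / G], where [g] is the Green potential of [E] and
[G] its maximum near [E] ([two_constants]).  Read backwards, a lower bound for
[ln |f|] at one point limits how negative [ln |f|] can be on [E].

With [E] a disc of radius comparable to [d], this says that if every arc at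
distance [d'] has a nearby point where [ln |f| >= - A], then so does every arc
at distance [d < d'], with [A] replaced by [C (d' / d) (A + V)]
([good_points_step]).  For [s > max (1, sigma_M)] one has [V <= d^-s] up to a
constant; iterating along [d = N^-k], with [N] so large that [4 C N <= N^s],
keeps [A] of order [d^-s] ([good_points_chain]).

With [E] the part of a circle where [|f| <= e^-t], the potential is controlled by
the logarithm of the length of [E] ([green_sum_cells]), so this length is at most
[(C / d) e^(- t / A1)] with [A1] of order [(d' / d) (A + V)]
([bad_circle_measure]).  Such tails bound every [L^p] mean of [ln |f|] by [A1] up
to a logarithm ([layer_integral], [mean_log_upper]).  Choose [d] along a sequence
with [V = d^-lam], [lam > lambda_M], and [d'] close to [d^(lam / s)]: then [A]
and [V] are both of order [d^-lam] and [A1] is of order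
[d^-(1 + lam (1 - 1 / s))].  Letting [s] tend to [max (1, sigma_M)] and [lam] to
[lambda_M] gives the exponent [1 + lambda_M (1 - 1 / sigma_M)^+]
([lambda_mean_le]). *)

Set Implicit Arguments.
Unset Strict Implicit.
Unset Printing Implicit Defensive.
Import Order.TTheory GRing.Theory Num.Theory.
Import numFieldNormedType.Exports.
Local Open Scope classical_set_scope.
Local Open Scope ring_scope.

(** * The modulus and second-order Taylor expansions *)

Section Modulus.
Context {R : realType}.
Implicit Types (z w : R[i]) (x : R).

Lemma modulus_ge0 z : 0 <= modulus z.
Proof. by case: z => a b; rewrite /modulus /= sqrtr_ge0. Qed.

Lemma modulusM z w : modulus (z * w) = modulus z * modulus w.
Proof. exact: ComplexField.Normc.normcM. Qed.

Lemma modulusD z w : modulus (z + w) <= modulus z + modulus w.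
Proof. exact: le_normcD. Qed.

Lemma modulusN z : modulus (- z) = modulus z.
Proof. exact: normcN. Qed.

Lemma modulusB z w : modulus (z - w) <= modulus z + modulus w.
Proof. by rewrite -(modulusN w); exact: modulusD. Qed.

Lemma modulus_distC z w : modulus (z - w) = modulus (w - z).
Proof. by rewrite -modulusN opprB. Qed.

Lemma modulus0 : modulus (0 : R[i]) = 0.
Proof. by have := @ComplexField.Normc.normc0 R. Qed.

Lemma modulus1 : modulus (1 : R[i]) = 1.
Proof. exact: (@ComplexField.Normc.normc1 R). Qed.

Lemma modulus0_eq0 z : modulus z = 0 -> z = 0.
Proof. exact: ComplexField.Normc.eq0_normc. Qed.

Lemma modulus_gt0 z : (0 < modulus z) = (z != 0).
Proof.
rewrite lt_def modulus_ge0 andbT; congr (~~ _).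
by apply/eqP/eqP => [/modulus0_eq0//|->]; exact: modulus0.
Qed.

Lemma modulusX z n : modulus (z ^+ n) = modulus z ^+ n.
Proof.
elim: n => [|n IH]; first by rewrite !expr0 modulus1.
by rewrite !exprS modulusM IH.
Qed.

Lemma modulusV z : modulus z^-1 = (modulus z)^-1.
Proof. exact: ComplexField.Normc.normcV. Qed.

Lemma modulus_real x : modulus (x%:C)%C = `|x|.
Proof. by rewrite /modulus /= expr0n /= addr0 sqrtr_sqr. Qed.

Lemma modulus_i : modulus ('i%C : R[i]) = 1.
Proof. by rewrite /modulus /= expr0n /= add0r expr1n sqrtr1. Qed.

Lemma modulus_sqr z : modulus z ^+ 2 = complex.Re z ^+ 2 + complex.Im z ^+ 2.
Proof.
by case: z => a b; rewrite /modulus /= sqr_sqrtr // addr_ge0 // sqr_ge0.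
Qed.

Lemma modulus_Re z : `|complex.Re z| <= modulus z.
Proof.
rewrite -(@ler_pXn2r _ 2) ?nnegrE ?modulus_ge0 // modulus_sqr real_normK ?num_real //.
by rewrite lerDl sqr_ge0.
Qed.

Lemma modulus_Im z : `|complex.Im z| <= modulus z.
Proof.
rewrite -(@ler_pXn2r _ 2) ?nnegrE ?modulus_ge0 // modulus_sqr real_normK ?num_real //.
by rewrite lerDr sqr_ge0.
Qed.

Lemma modulus_le_ReIm z : modulus z <= `|complex.Re z| + `|complex.Im z|.
Proof.
rewrite -(@ler_pXn2r _ 2) ?nnegrE ?modulus_ge0 ?addr_ge0 // modulus_sqr.
rewrite sqrrD !real_normK ?num_real //.
by rewrite lerD2r lerDl mulrn_wge0 // mulr_ge0.
Qed.

Lemma modulus_distD z w y : modulus (z - w) <= modulus (z - y) + modulus (y - w).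
Proof. by have := modulusD (z - y) (y - w); rewrite addrA subrK. Qed.

Lemma modulus_sub_ge z w : modulus z - modulus w <= modulus (z - w).
Proof. by have := modulusD (z - w) w; rewrite subrK; lra. Qed.

Lemma modulus_dist z w : `|modulus z - modulus w| <= modulus (z - w).
Proof.
rewrite ler_norml; have := modulus_sub_ge z w; have := modulus_sub_ge w z.
by rewrite (modulus_distC w z); lra.
Qed.

Lemma modulus_sum (I : Type) (s : seq I) (P : pred I) (F : I -> R[i]) :
  modulus (\sum_(j <- s | P j) F j) <= \sum_(j <- s | P j) modulus (F j).
Proof.
elim/big_rec2: _ => [|j x z _ H]; first by rewrite modulus0.
by apply: le_trans (modulusD _ _) _; rewrite lerD2l.
Qed.

Lemma normr_modulus z : `|z| = (modulus z)%:C%C.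
Proof. by []. Qed.

(** The polarization identity behind the strict subharmonicity of [|z|^2]. *)
Lemma modulus_sqr4 c w :
  modulus (c + w) ^+ 2 + modulus (c - w) ^+ 2
    + modulus (c + 'i%C * w) ^+ 2 + modulus (c - 'i%C * w) ^+ 2
  = 4 * modulus c ^+ 2 + 4 * modulus w ^+ 2.
Proof.
case: c => a b; case: w => x y; rewrite !modulus_sqr /=; ring.
Qed.

End Modulus.

Section Taylor.
Context {R : realType}.

Lemma sum_geometric_le (x : R) m :
  0 <= x -> x <= 1 / 2 -> \sum_(k < m) x ^+ k + 2 * x ^+ m <= 2.
Proof.
move=> x0 x1; elim: m => [|m IH]; first by rewrite big_ord0 expr0; lra.
rewrite big_ord_recr /= exprS.
have : 0 <= x ^+ m by rewrite exprn_ge0.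
by move=> ?; nra.
Qed.

(** The norm of [R[i]] is complex-valued; here the convergence is expressed with
real radii and real moduli. *)
Lemma analytic_series (f : R[i] -> R[i]) (c : R[i]) :
  analytic_in_disc f -> modulus c < 1 ->
  exists a : nat -> R[i], exists2 eta : R, 0 < eta &
    forall w, modulus w < eta -> forall e : R, 0 < e -> exists M, forall n,
     (M <= n)%N -> modulus (f (c + w) - \sum_(k < n) a k * w ^+ k) < e.
Proof.
move=> fa c1; have [a /nbhs_ballP[r /= r0 Hr]] := fa c c1.
have [x Er] : exists x : R, r = (x%:C)%C.
  move: r0; case: (r) => x y /=; rewrite ltcE /= => /andP[/eqP -> _]; by exists x.
have x0 : 0 < x by move: r0; rewrite Er ltcR.
exists a, x => // w wx e e0.
have : ball (c : R[i]^o) r (c + w).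
  by rewrite -ball_normE /= opprD addNKr normrN normr_modulus Er ltcR.
move/Hr => /= /cvgrPdist_lt /(_ (e%:C)%C).
rewrite ltcR => /(_ e0) [M _ HM]; exists M => n Mn.
have := HM n Mn; rewrite /= normr_modulus ltcR.
rewrite /series /= big_mkord.
by have -> : c + w - c = w by rewrite addrAC subrr add0r.
Qed.

(** The terms of the series stay bounded at one radius, so the tail after the
quadratic term is dominated by a geometric series of ratio at most 1/2. *)
Lemma analytic_taylor2 (f : R[i] -> R[i]) (c : R[i]) :
  analytic_in_disc f -> modulus c < 1 ->
  exists a1 a2 : R[i], exists K eta : R, [/\ 0 <= K, 0 < eta &
    forall w, modulus w < eta ->
      modulus (f (c + w) - (f c + a1 * w + a2 * w ^+ 2)) <= K * modulus w ^+ 3].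
Proof.
move=> fa c1; have [a [eta eta0 Ha]] := analytic_series fa c1.
have fc : f c = a 0%N.
  apply/eqP; rewrite -subr_eq0 -[_ == _]negbK -modulus_gt0 -leNgt.
  apply/ler_addgt0Pr => e e0; rewrite add0r ltW//.
  have := Ha 0; rewrite modulus0 => /(_ eta0 e e0) [M HM].
  have := HM M.+1 (leqnSn _); rewrite addr0 big_ord_recl /= expr0 mulr1 big1 ?addr0//.
  by move=> i _; rewrite exprS mul0r mulr0.
pose x0 : R := eta / 2.
have x00 : 0 < x0 by rewrite divr_gt0.
have [B B0 HB] : exists2 B : R, 0 <= B & forall k, modulus (a k) * x0 ^+ k <= B.
  have : modulus (x0%:C)%C < eta.
    by rewrite modulus_real gtr0_norm // /x0; lra.
  move=> /Ha /(_ 1 ltr01)[M HM].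
  exists (\sum_(k < M) modulus (a k) * x0 ^+ k + 2).
    by rewrite addr_ge0 // sumr_ge0 // => i _; rewrite mulr_ge0 ?modulus_ge0 // exprn_ge0 // ltW.
  move=> k; have [kM|Mk] := ltnP k M.
    rewrite (bigD1 (Ordinal kM)) //= -addrA lerDl addr_ge0 // sumr_ge0 // => i _.
    by rewrite mulr_ge0 ?modulus_ge0 // exprn_ge0 // ltW.
  apply: (@le_trans _ _ 2); last first.
    by rewrite lerDr sumr_ge0 // => i _; rewrite mulr_ge0 ?modulus_ge0 // exprn_ge0 // ltW.
  have h1 := HM k Mk; have h2 := HM k.+1 (leqW Mk).
  set S := \sum_(_ < k) _ in h1; set F := f _ in h1 h2.
  move: h2; rewrite big_ord_recr /= -/S -/F => h2.
  have -> : modulus (a k) * x0 ^+ k = modulus (a k * (x0%:C)%C ^+ k).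
    by rewrite modulusM modulusX modulus_real gtr0_norm.
  set t := a k * _ in h2 *.
  have -> : t = (F - S) - (F - (S + t)) by ring.
  by have := modulusB (F - S) (F - (S + t)); lra.
exists (a 1%N), (a 2%N), (2 * B / x0 ^+ 3), (x0 / 2); split => //.
- apply: divr_ge0; [exact: mulr_ge0|exact/exprn_ge0/ltW].
- by rewrite divr_gt0.
move=> w wx; apply/ler_addgt0Pr => e e0.
have : modulus w < eta by move: wx; rewrite /x0; lra.
move=> /Ha /(_ e e0)[M HM].
have := HM (3 + M)%N (leq_addl _ _).
set S := \sum_(_ < _) _ => HS.
set T := f c + _ + _.
have ST : modulus (S - T) <= 2 * B / x0 ^+ 3 * modulus w ^+ 3.
  have -> : S - T = \sum_(k < M) a (3 + k)%N * w ^+ (3 + k).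
    rewrite /S /T big_split_ord /= !big_ord_recl big_ord0 /= fc.
    rewrite /bump /= expr0 expr1 mulr1; ring.
  apply: le_trans (modulus_sum _ _ _) _.
  pose q := modulus w / x0.
  have q0 : 0 <= q by rewrite divr_ge0 ?modulus_ge0 // ltW.
  have q1 : q <= 1 / 2 by rewrite /q ler_pdivrMr //; lra.
  have Hq k : modulus (a (3 + k)%N * w ^+ (3 + k)) <= B * q ^+ 3 * q ^+ k.
    rewrite -mulrA -exprD modulusM modulusX.
    have -> : modulus w = q * x0 by rewrite /q divfK // gt_eqF.
    rewrite exprMn mulrCA mulrC; apply: ler_wpM2r; first by rewrite exprn_ge0.
    exact: HB.
  apply: (@le_trans _ _ (\sum_(k < M) B * q ^+ 3 * q ^+ k)).
    by apply: ler_sum => k _; exact: Hq.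
  rewrite -mulr_sumr.
  have : \sum_(k < M) q ^+ k <= 2.
    have := sum_geometric_le M q0 q1; have : 0 <= q ^+ M by rewrite exprn_ge0.
    lra.
  have -> : 2 * B / x0 ^+ 3 * modulus w ^+ 3 = B * q ^+ 3 * 2.
    by rewrite /q; field; rewrite gt_eqF.
  by apply: ler_wpM2l; rewrite mulr_ge0 // exprn_ge0.
have := modulus_distD (f (c + w)) T S.
by lra.
Qed.

End Taylor.

(** * Four-point harmonicity and subharmonicity *)

Section FourPoint.
Context {R : realType}.
Implicit Types (f e : R[i] -> R[i]) (u v : R[i] -> R) (c z w : R[i]).

(** The sum over [w, - w, i w, - i w] kills the real part of every [a w + b w^2],
so comparing it with [4 u c] measures the Laplacian without derivatives. *)
Definition sum4 u c w : R :=
  u (c + w) + u (c - w) + u (c + 'i%C * w) + u (c - 'i%C * w).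

Definition subharm u c := forall eps : R, 0 < eps -> exists2 eta : R, 0 < eta &
  forall w, modulus w < eta -> 4 * u c - eps * modulus w ^+ 2 <= sum4 u c w.

Definition harm u c := exists K eta : R, [/\ 0 <= K, 0 < eta &
  forall w, modulus w < eta -> `|sum4 u c w - 4 * u c| <= K * modulus w ^+ 3].

Definition cont_at u c := forall eps : R, 0 < eps -> exists2 eta : R, 0 < eta &
  forall z, modulus (z - c) < eta -> `|u z - u c| < eps.

Definition bigOw n e := exists K eta : R, [/\ 0 <= K, 0 < eta, eta <= 1 &
  forall w, modulus w < eta -> modulus (e w) <= K * modulus w ^+ n].

Lemma modulus_iM z : modulus ('i%C * z) = modulus z.
Proof. by rewrite modulusM modulus_i mul1r. Qed.

Lemma bigOwD n e1 e2 : bigOw n e1 -> bigOw n e2 -> bigOw n (fun w => e1 w + e2 w).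
Proof.
move=> [K1 [h1 [K10 h10 h11 H1]]] [K2 [h2 [K20 h20 h21 H2]]].
exists (K1 + K2), (Num.min h1 h2); split.
- exact: addr_ge0.
- by rewrite lt_min h10.
- by rewrite ge_min h11.
move=> w; rewrite lt_min => /andP[/H1 A /H2 B].
by apply: le_trans (modulusD _ _) _; rewrite mulrDl; exact: lerD.
Qed.

Lemma bigOwM n m e1 e2 : bigOw n e1 -> bigOw m e2 -> bigOw (n + m) (fun w => e1 w * e2 w).
Proof.
move=> [K1 [h1 [K10 h10 h11 H1]]] [K2 [h2 [K20 h20 h21 H2]]].
exists (K1 * K2), (Num.min h1 h2); split.
- exact: mulr_ge0.
- by rewrite lt_min h10.
- by rewrite ge_min h11.
move=> w; rewrite lt_min => /andP[/H1 A /H2 B].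
by rewrite modulusM exprD mulrACA; apply: ler_pM; rewrite ?modulus_ge0.
Qed.

Lemma bigOw_le m n e : (n <= m)%N -> bigOw m e -> bigOw n e.
Proof.
move=> nm [K [h [K0 h0 h1 H]]]; exists K, h; split => // w wh.
apply: le_trans (H w wh) _; apply: ler_wpM2l => //.
by apply: ler_wiXn2l; rewrite ?modulus_ge0 //; exact/ltW/(lt_le_trans wh).
Qed.

Lemma bigOwMl n c e : bigOw n e -> bigOw n (fun w => c * e w).
Proof.
move=> [K [h [K0 h0 h1 H]]]; exists (modulus c * K), h; split => //.
  by rewrite mulr_ge0 ?modulus_ge0.
by move=> w /H A; rewrite modulusM -mulrA ler_wpM2l ?modulus_ge0.
Qed.

Lemma bigOw_rot n c e : modulus c = 1 -> bigOw n e -> bigOw n (fun w => e (c * w)).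
Proof.
move=> c1 [K [h [K0 h0 h1 H]]]; exists K, h; split => // w wh.
by have := H (c * w); rewrite modulusM c1 mul1r => /(_ wh).
Qed.

Lemma bigOw_mon n : bigOw n (fun w => w ^+ n).
Proof. by exists 1, 1; split => // w _; rewrite mul1r modulusX. Qed.

Lemma bigOw_cst c : bigOw 0 (fun=> c).
Proof. by exists (modulus c), 1; split; rewrite ?modulus_ge0 // => w _; rewrite expr0 mulr1. Qed.

Lemma bigOw_quad a b c : bigOw 0 (fun w => a + b * w + c * w ^+ 2).
Proof.
apply: bigOwD; first apply: bigOwD; first exact: bigOw_cst.
- by apply: bigOwMl; apply: (@bigOw_le 1) => //; have := bigOw_mon 1; under eq_fun do rewrite expr1.
- by apply: bigOwMl; apply: (@bigOw_le 2) => //; exact: bigOw_mon.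
Qed.

Lemma bigOw_ext n e1 e2 : (forall w, e1 w = e2 w) -> bigOw n e1 -> bigOw n e2.
Proof. by move=> /funext ->. Qed.

(** Twice differentiability at [c], with a cubic remainder. *)
Definition taylor2 f c := exists a1 a2 : R[i],
  bigOw 3 (fun w => f (c + w) - (f c + a1 * w + a2 * w ^+ 2)).

Lemma taylor2_affine a b c : taylor2 (fun z => a * z + b) c.
Proof.
exists a, 0; exists 0, 1; split => // w _; rewrite [leRHS]mul0r /=.
have -> : a * (c + w) + b - (a * c + b + a * w + 0 * w ^+ 2) = 0 by ring.
by rewrite modulus0.
Qed.

Lemma taylor2_analytic f c : analytic_in_disc f -> modulus c < 1 -> taylor2 f c.
Proof.
move=> fa c1; have [a1 [a2 [K [h [K0 h0 H]]]]] := analytic_taylor2 fa c1.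
exists a1, a2, K, (Num.min h 1); split => //.
- by rewrite lt_min h0 ltr01.
- by rewrite ge_min lexx orbT.
- by move=> w; rewrite lt_min => /andP[/H].
Qed.

(** Pairing [w] with [- w] removes the linear term.  Replacing [w] by [i w]
changes the sign of the quadratic one, which then cancels between two pairs in
[taylor2_quad]. *)
Lemma taylor2_pair f c : taylor2 f c -> f c != 0 ->
  exists b, bigOw 3 (fun w => f (c + w) * f (c - w) / f c ^+ 2 - (1 + b * w ^+ 2)).
Proof.
move=> [a1 [a2]]; set e := fun w => _ => He f0.
have He' : bigOw 3 (fun w => e (- w)).
  have h1 : modulus (-1 : R[i]) = 1 by rewrite modulusN modulus1.
  by apply: bigOw_ext (bigOw_rot h1 He) => w; rewrite mulN1r.
exists ((2 * f c * a2 - a1 ^+ 2) / f c ^+ 2).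
have H : bigOw 3 (fun w => (f c ^+ 2)^-1 * (a2 ^+ 2 * w ^+ 4
   + e w * (f c + (- a1) * w + a2 * w ^+ 2)
   + e (- w) * (f c + a1 * w + a2 * w ^+ 2) + e w * e (- w))).
  apply: bigOwMl; apply: bigOwD; first apply: bigOwD; first apply: bigOwD.
  - by apply: bigOwMl; apply: (@bigOw_le 4) => //; exact: bigOw_mon.
  - by apply: (bigOwM He (bigOw_quad _ _ _)).
  - by apply: (bigOwM He' (bigOw_quad _ _ _)).
  - by apply: (@bigOw_le (3 + 3)) => //; exact: bigOwM.
apply: bigOw_ext H => w.
have E1 : f (c + w) = f c + a1 * w + a2 * w ^+ 2 + e w by rewrite /e; ring.
have E2 : f (c - w) = f c + - a1 * w + a2 * w ^+ 2 + e (- w) by rewrite /e; ring.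
rewrite E1 E2; field; exact: f0.
Qed.

Lemma mulii : 'i%C * 'i%C = -1 :> R[i].
Proof. by apply/eqP; rewrite eq_complex /=; apply/andP; split; apply/eqP; ring. Qed.

Lemma taylor2_quad f c : taylor2 f c -> f c != 0 ->
  bigOw 3 (fun w => f (c + w) * f (c - w) * f (c + 'i%C * w) * f (c - 'i%C * w)
                  / f c ^+ 4 - 1).
Proof.
move=> tf f0; have [b] := taylor2_pair tf f0; set e := fun w => _ => He.
have He' : bigOw 3 (fun w => e ('i%C * w)) by apply: bigOw_rot He; rewrite modulus_i.
have H : bigOw 3 (fun w => (- b ^+ 2) * w ^+ 4 + e w * (1 + 0 * w + (- b) * w ^+ 2)
    + e ('i%C * w) * (1 + 0 * w + b * w ^+ 2) + e w * e ('i%C * w)).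
  apply: bigOwD; first apply: bigOwD; first apply: bigOwD.
  - by apply: bigOwMl; apply: (@bigOw_le 4) => //; exact: bigOw_mon.
  - by apply: (bigOwM He (bigOw_quad _ _ _)).
  - by apply: (bigOwM He' (bigOw_quad _ _ _)).
  - by apply: (@bigOw_le (3 + 3)) => //; exact: bigOwM.
apply: bigOw_ext H => w.
have E1 : f (c + w) * f (c - w) = f c ^+ 2 * (1 + b * w ^+ 2 + e w).
  by rewrite /e; field; exact: f0.
have E2 : f (c + 'i%C * w) * f (c - 'i%C * w)
          = f c ^+ 2 * (1 - b * w ^+ 2 + e ('i%C * w)).
  rewrite /e.
  have -> : ('i%C * w) ^+ 2 = - w ^+ 2 by rewrite exprMn expr2 mulii mulN1r.
  by field; exact: f0.
rewrite -(mulrA (f (c + w) * _)) E1 E2; field; exact: f0.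
Qed.

Lemma ln_le_sub1 (x : R) : 0 < x -> ln x <= x - 1.
Proof. by move=> x0; have := expR_ge1Dx (ln x); rewrite lnK ?posrE //; lra. Qed.

Lemma ln_ge_1subV (x : R) : 0 < x -> 1 - x^-1 <= ln x.
Proof.
by move=> x0; have := @ln_le_sub1 x^-1; rewrite invr_gt0 lnV ?posrE // => /(_ x0); lra.
Qed.

Lemma ln_near1 (x : R) : `|x - 1| <= 1 / 2 -> `|ln x| <= 2 * `|x - 1|.
Proof.
move=> h; have x0 : 1 / 2 <= x by move: h; rewrite ler_norml; lra.
have xp : 0 < x by lra.
have h1 := ln_le_sub1 xp; have h2 := ln_ge_1subV xp.
rewrite ler_norml; apply/andP; split; last first.
  by have := ler_norm (x - 1); have := normr_ge0 (x - 1); lra.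
apply: le_trans h2; have -> : 1 - x^-1 = (x - 1) / x by field; rewrite gt_eqF.
rewrite ler_pdivlMr //.
have := ler_norm (- (x - 1)); rewrite normrN; have := normr_ge0 (x - 1); nra.
Qed.

(** To second order [ln |f|] is the real part of a complex quadratic polynomial
at a point where [f] does not vanish, and such a polynomial has the same value at
the centre as its mean over the four points. *)
Lemma harm_ln_modulus f c : taylor2 f c -> f c != 0 ->
  harm (fun z => ln (modulus (f z))) c.
Proof.
move=> tf f0; have [K [h [K0 h0 h1 H]]] := taylor2_quad tf f0.
pose d := (2 * (K + 1))^-1.
have d0 : 0 < d by rewrite invr_gt0 mulr_gt0 // ltr_pwDr.
exists (2 * K), (Num.min h d); split; first by rewrite mulr_ge0.
  by rewrite lt_min h0.
move=> w; rewrite lt_min => /andP[wh wd].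
set P := f (c + w) * f (c - w) * f (c + 'i%C * w) * f (c - 'i%C * w).
have HP := H w wh; rewrite -/P in HP.
have wge := modulus_ge0 w.
have w1 : modulus w <= 1 by exact/ltW/(lt_le_trans wh).
have Kd : K * modulus w ^+ 3 <= 1 / 2.
  apply: (@le_trans _ _ (K * modulus w)).
    by rewrite ler_wpM2l // -[leRHS]expr1 ler_wiXn2l.
  apply: (@le_trans _ _ (K * d)); first by rewrite ler_wpM2l // ltW.
  by rewrite /d ler_pdivrMr ?mulr_gt0 //; lra.
set X := modulus (P / f c ^+ 4).
have HX : `|X - 1| <= K * modulus w ^+ 3.
  by rewrite -(modulus1 (R:=R)); apply: le_trans (modulus_dist _ _) _.
have X0 : 0 < X by move: (le_trans HX Kd); rewrite ler_norml; lra.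
have : P != 0.
  by apply: contraTneq X0 => P0; rewrite /X P0 mul0r modulus0 ltxx.
rewrite !mulf_eq0 !negb_or => /andP[/andP[/andP[p1 p2] p3] p4].
have -> : sum4 (fun z => ln (modulus (f z))) c w - 4 * ln (modulus (f c)) = ln X.
  rewrite /sum4 /X modulusM modulusV modulusX !modulusM.
  rewrite lnM ?posrE ?mulr_gt0 ?invr_gt0 ?exprn_gt0 ?modulus_gt0 //.
  rewrite lnV ?posrE ?exprn_gt0 ?modulus_gt0 // lnXn ?modulus_gt0 //.
  rewrite !lnM ?posrE ?mulr_gt0 ?modulus_gt0 //.
  by rewrite mulr_natl.
apply: le_trans (ln_near1 (le_trans HX Kd)) _.
by rewrite -mulrA ler_wpM2l.
Qed.

Lemma harm_subharm u c : harm u c -> subharm u c.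
Proof.
move=> [K [h [K0 h0 H]]] eps eps0.
have K1 : 0 < K + 1 by rewrite ltr_pwDr.
exists (Num.min h (eps / (K + 1))); first by rewrite lt_min h0 divr_gt0.
move=> w; rewrite lt_min => /andP[/H A B].
have C : K * modulus w ^+ 3 <= eps * modulus w ^+ 2.
  rewrite exprS mulrA ler_wpM2r ?sqr_ge0 //.
  move: B; rewrite ltr_pdivlMr // => B; have := modulus_ge0 w; nra.
by move: A; rewrite ler_norml; lra.
Qed.

Lemma harmN u c : harm u c -> harm (fun z => - u z) c.
Proof.
move=> [K [h [K0 h0 H]]]; exists K, h; split => // w /H.
by rewrite -normrN /sum4; congr (`|_| <= _); ring.
Qed.

Lemma subharmD u v c : subharm u c -> subharm v c -> subharm (fun z => u z + v z) c.
Proof.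
move=> Hu Hv eps eps0; have e0 : 0 < eps / 2 by rewrite divr_gt0.
have [h1 h10 H1] := Hu _ e0; have [h2 h20 H2] := Hv _ e0.
exists (Num.min h1 h2); first by rewrite lt_min h10.
by move=> w; rewrite lt_min => /andP[/H1 A /H2 B]; move: A B; rewrite /sum4; lra.
Qed.

Lemma subharm_cst (a : R) c : subharm (fun=> a) c.
Proof.
move=> eps eps0; exists 1 => // w _; rewrite /sum4.
have : 0 <= eps * modulus w ^+ 2 by rewrite mulr_ge0 ?sqr_ge0 // ltW.
lra.
Qed.

Lemma subharmMl (a : R) u c : 0 <= a -> subharm u c -> subharm (fun z => a * u z) c.
Proof.
move=> a0 Hu eps eps0; have a1 : 0 < a + 1 by rewrite ltr_pwDr.
have [h h0 H] := Hu _ (divr_gt0 eps0 a1); exists h => // w /H A.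
have := ler_wpM2l a0 A; rewrite /sum4.
have : a * (eps / (a + 1) * modulus w ^+ 2) <= eps * modulus w ^+ 2.
  rewrite mulrA ler_wpM2r ?sqr_ge0 // mulrA ler_pdivrMr //; nra.
lra.
Qed.

Lemma subharm_sum (I : Type) (s : seq I) (P : pred I) (F : I -> R[i] -> R) c :
  (forall j, P j -> subharm (F j) c) -> subharm (fun z => \sum_(j <- s | P j) F j z) c.
Proof.
move=> H; elim: s => [|j s IH].
  by under eq_fun do rewrite big_nil; exact: subharm_cst.
under eq_fun do rewrite big_cons.
by case Pj: (P j) => //; apply: subharmD IH; exact: H.
Qed.

(** A convex nondecreasing function of a subharmonic function is subharmonic:
only a supporting line of nonnegative slope at the value taken is needed. *)
Lemma subharm_comp (g : R -> R) u c (m : R) :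
  0 <= m -> (forall y, g (u c) + m * (y - u c) <= g y) ->
  subharm u c -> subharm (fun z => g (u z)) c.
Proof.
move=> m0 Hg Hu eps eps0.
have m1 : 0 < m + 1 by rewrite ltr_pwDr.
have [h h0 H] := Hu _ (divr_gt0 eps0 m1); exists h => // w /H A.
have := ler_wpM2l m0 A; rewrite /sum4.
have : m * (eps / (m + 1) * modulus w ^+ 2) <= eps * modulus w ^+ 2.
  rewrite mulrA ler_wpM2r ?sqr_ge0 // mulrA ler_pdivrMr //; nra.
have h1 := Hg (u (c + w)); have h2 := Hg (u (c - w)).
have h3 := Hg (u (c + 'i%C * w)); have h4 := Hg (u (c - 'i%C * w)).
lra.
Qed.

Lemma subharm_near u v c (h : R) : 0 < h -> (forall z, modulus (z - c) < h -> u z = v z) ->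
  subharm u c -> subharm v c.
Proof.
move=> h0 E Hu eps eps0; have [k k0 H] := Hu _ eps0.
exists (Num.min k h); first by rewrite lt_min k0.
move=> w; rewrite lt_min => /andP[/H A wh].
have e z : modulus z = modulus w -> u (c + z) = v (c + z).
  by move=> zw; apply: E; rewrite addrC addKr zw.
rewrite -E ?subrr ?modulus0 //.
by move: A; rewrite /sum4 !e ?modulusN ?modulus_iM.
Qed.

End FourPoint.

(** * Compactness and the maximum principle *)

Section Continuity.
Context {R : realType}.
Implicit Types (u v : R[i] -> R) (c z w : R[i]).

Lemma cont_at_comp (g : R -> R) u c :
  {for u c, continuous g} -> cont_at u c -> cont_at (fun z => g (u z)) c.
Proof.
move=> /cvgrPdist_lt gc uc eps eps0.
have /nbhs_ballP[d /= d0 Hd] := gc _ eps0.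
have [h h0 Hh] := uc _ d0; exists h => // z /Hh zh.
have := Hd (u z); rewrite -ball_normE /= distrC zh => /(_ isT).
by rewrite distrC.
Qed.

Lemma cont_at_cst (a : R) c : cont_at (fun=> a) c.
Proof. by move=> e e0; exists 1 => // z _; rewrite subrr normr0. Qed.

Lemma cont_atD u v c : cont_at u c -> cont_at v c -> cont_at (fun z => u z + v z) c.
Proof.
move=> Hu Hv e e0; have e2 : 0 < e / 2 by rewrite divr_gt0.
have [h1 h10 H1] := Hu _ e2; have [h2 h20 H2] := Hv _ e2.
exists (Num.min h1 h2); first by rewrite lt_min h10.
move=> z; rewrite lt_min => /andP[/H1 A /H2 B].
have -> : u z + v z - (u c + v c) = (u z - u c) + (v z - v c) by ring.
by apply: le_lt_trans (ler_normD _ _) _; lra.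
Qed.

Lemma cont_atMl (a : R) u c : cont_at u c -> cont_at (fun z => a * u z) c.
Proof.
move=> Hu; apply: (@cont_at_comp (fun x => a * x)) => //.
by apply: continuousM; [exact: cvg_cst|exact: cvg_id].
Qed.

Lemma cont_at_sum (I : Type) (s : seq I) (P : pred I) (F : I -> R[i] -> R) c :
  (forall j, P j -> cont_at (F j) c) -> cont_at (fun z => \sum_(j <- s | P j) F j z) c.
Proof.
move=> H; elim: s => [|j s IH].
  by under eq_fun do rewrite big_nil; exact: cont_at_cst.
under eq_fun do rewrite big_cons.
by case Pj: (P j) => //; apply: cont_atD IH; exact: H.
Qed.

Lemma cont_at_modulus c : cont_at (fun z => modulus z) c.
Proof.
move=> e e0; exists e => // z; exact/le_lt_trans/modulus_dist.
Qed.

Lemma cont_at_modulus_taylor2 (f : R[i] -> R[i]) c :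
  taylor2 f c -> cont_at (fun z => modulus (f z)) c.
Proof.
move=> [a1 [a2 H]].
have {}H : bigOw 1 (fun w => f (c + w) - f c).
  have H2 : bigOw 1 (fun w => (f (c + w) - (f c + a1 * w + a2 * w ^+ 2)) + a1 * w + a2 * w ^+ 2).
    apply: bigOwD; first apply: bigOwD; first exact: bigOw_le H.
    - by apply: bigOwMl; have := @bigOw_mon R 1%N; under eq_fun do rewrite expr1.
    - by apply: bigOwMl; apply: (bigOw_le (m := 2%N)) => //; exact: bigOw_mon.
  by apply: bigOw_ext H2 => w; ring.
have [K [h [K0 h0 h1 {}H]]] := H.
move=> e e0; have K1 : 0 < K + 1 by rewrite ltr_pwDr.
exists (Num.min h (e / (K + 1))); first by rewrite lt_min h0 divr_gt0.
move=> z; rewrite lt_min => /andP[/H].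
have -> : c + (z - c) = z by ring.
rewrite expr1 => A.
rewrite ltr_pdivlMr // => B.
apply: le_lt_trans (modulus_dist _ _) _; apply: le_lt_trans A _.
by have := modulus_ge0 (z - c); nra.
Qed.

Let psi (x : R * R) : R[i] := (x.1 +i* x.2)%C.

Let psiE z : psi (complex.Re z, complex.Im z) = z.
Proof. by case: z. Qed.

Let psi_ball (x y : R * R) (e : R) : ball x (e / 2) y -> modulus (psi y - psi x) < e.
Proof.
case: x => x1 x2; case: y => y1 y2 [/=]; rewrite -!ball_normE /= => h1 h2.
have := modulus_le_ReIm (psi (y1, y2) - psi (x1, x2)); rewrite /psi /=.
by rewrite (distrC y1) (distrC y2); lra.
Qed.

Let compact_psi (K : set R[i]) :
  (forall z, K z -> modulus z <= 1) ->
  (forall z, (forall e : R, 0 < e -> exists2 z', K z' & modulus (z - z') < e) -> K z) ->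
  compact (psi @^-1` K).
Proof.
move=> K1 Kc; apply: (@subclosed_compact (R * R)%type _ (`[(-1 : R), 1]%classic `*` `[(-1 : R), 1]%classic)).
- move=> x Hx; apply: Kc => e e0.
  have e2 : 0 < e / 2 by rewrite divr_gt0.
  have [y [Ay yx]] := Hx _ (nbhsx_ballx x _ e2).
  by exists (psi y) => //; rewrite modulus_distC; exact: psi_ball.
- by apply: compact_setX; exact: segment_compact.
- move=> x /K1 h; split; rewrite /= in_itv /= -ler_norml.
    exact: le_trans (modulus_Re (psi x)) h.
  exact: le_trans (modulus_Im (psi x)) h.
Qed.

(** Compactness comes from the coordinate plane [R * R]. *)
Lemma closed_disc_max (K : set R[i]) u :
  (exists z, K z) ->
  (forall z, K z -> modulus z <= 1) ->
  (forall z, (forall e : R, 0 < e -> exists2 z', K z' & modulus (z - z') < e) -> K z) ->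
  (forall z, K z -> cont_at u z) ->
  exists2 c, K c & forall z, K z -> u z <= u c.
Proof.
move=> [z0 Kz0] K1 Kc uc.
have [] := @compact_EVT_max _ _ (fun x => u (psi x)) _ _ (compact_psi K1 Kc).
- by exists (complex.Re z0, complex.Im z0); rewrite /= psiE.
- apply: continuous_in_subspaceT => x /set_mem Ax.
  apply/cvgrPdist_lt => e e0.
  have [h h0 Hh] := uc _ Ax _ e0.
  have h2 : 0 < h / 2 by rewrite divr_gt0.
  by apply: filterS (nbhsx_ballx x _ h2) => y /psi_ball /Hh; rewrite distrC.
move=> c /set_mem cK H; exists (psi c) => // z Kz.
by rewrite -(psiE z); apply: H; apply/mem_set; rewrite /= psiE.
Qed.

Lemma disc_closed (rho : R) z :
  (forall e : R, 0 < e -> exists2 z', modulus z' <= rho & modulus (z - z') < e) ->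
  modulus z <= rho.
Proof.
move=> H; apply/ler_addgt0Pr => e /H [z' z'1 zz'].
by have := modulus_sub_ge z z'; lra.
Qed.

Lemma unif_cont_disc (rho : R) u : rho < 1 ->
  (forall z, modulus z < 1 -> cont_at u z) ->
  forall e : R, 0 < e -> exists2 h : R, 0 < h &
   forall z z', modulus z <= rho -> modulus (z' - z) < h -> `|u z' - u z| < e.
Proof.
move=> rho1 uc e e0.
have e2 : 0 < e / 2 by rewrite divr_gt0.
pose K := [set z : R[i] | modulus z <= rho].
have cK : compact (psi @^-1` K).
  apply: compact_psi => z; first by move/le_trans; apply; exact: ltW.
  exact: disc_closed.
have ncK := (compact_near_coveringP _).1 cK.
pose P (n : nat) (x : R * R) := forall z',
  modulus (z' - psi x) < n.+1%:R^-1 -> `|u z' - u (psi x)| < e.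
have HP x : (psi @^-1` K) x -> \forall x' \near x & n \near \oo, P n x'.
  move=> Kx; have [h h0 Hh] := uc _ (le_lt_trans Kx rho1) _ e2.
  have h2 : 0 < h / 2 by rewrite divr_gt0.
  exists (ball x (h / 2 / 2), [set n : nat | n.+1%:R^-1 < h / 2]).
    split; first by apply: nbhsx_ballx; rewrite divr_gt0.
    by apply: near_infty_natSinv_lt (PosNum h2).
  move=> [y n] /= [/psi_ball yx hn] z' /= zy.
  have /Hh A : modulus (psi y - psi x) < h by lra.
  have /Hh B : modulus (z' - psi x) < h.
    apply: le_lt_trans (modulus_distD _ _ (psi y)) _.
    by rewrite (splitr h) ltrD // (lt_trans zy).
  have -> : u z' - u (psi y) = (u z' - u (psi x)) - (u (psi y) - u (psi x)) by ring.
  by apply: le_lt_trans (ler_normB _ _) _; lra.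
have [N _ HN] := ncK _ _ P _ HP.
exists N.+1%:R^-1; first by rewrite invr_gt0.
move=> z z' zr zz'; rewrite -(psiE z).
by apply: (HN N (leqnn _)); rewrite /= /K psiE.
Qed.

(** Maximum principle.  At an interior maximum of [u + eps |z|^2] the four-point
inequality is contradicted, since it would gain [4 eps |w|^2]. *)
Lemma max_principle (K : set R[i]) u :
  (forall z, K z -> modulus z <= 1) ->
  (forall z, (forall e : R, 0 < e -> exists2 z', K z' & modulus (z - z') < e) -> K z) ->
  (forall z, K z -> cont_at u z) ->
  (forall z, K z -> u z <= 0 \/
     subharm u z /\ exists2 h : R, 0 < h & forall z', modulus (z' - z) < h -> K z') ->
  forall z, K z -> u z <= 0.
Proof.
move=> K1 Kc uc H z0 Kz0; rewrite leNgt; apply/negP => u0.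
pose e := u z0 / 2.
have e0 : 0 < e by rewrite divr_gt0.
pose v z := u z + e * modulus z ^+ 2.
have vc z : K z -> cont_at v z.
  move=> Kz; apply: cont_atD; first exact: uc.
  apply: cont_atMl; apply: (@cont_at_comp (fun x => x ^+ 2)); last exact: cont_at_modulus.
  exact: exprn_continuous.
have [c Kcc Hc] := closed_disc_max (ex_intro _ _ Kz0) K1 Kc vc.
have uc0 : 0 < u c.
  have := Hc _ Kz0; rewrite /v => A.
  have : e * modulus c ^+ 2 <= e by rewrite ler_piMr ?exprn_ile1 ?modulus_ge0 ?K1 // ltW.
  have : 0 <= e * modulus z0 ^+ 2 by rewrite mulr_ge0 ?sqr_ge0 // ltW.
  by rewrite /e in A *; lra.
have [|[sc [h h0 Hh]]] := H _ Kcc; first by rewrite leNgt uc0.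
have [k k0 Hk] := sc _ e0.
pose m := Num.min h k / 2.
have m0 : 0 < m by rewrite divr_gt0 // lt_min h0.
have [mh mk] : m < h /\ m < k.
  have := lexx (Num.min h k); rewrite {1}/m le_min => /andP[? ?].
  by rewrite /m; move: m0; rewrite /m; split; lra.
pose w : R[i] := (m%:C)%C.
have wm : modulus w = m by rewrite modulus_real gtr0_norm.
have Kw z : modulus z = m -> v (c + z) <= v c.
  by move=> zm; apply/Hc/Hh; rewrite addrC addKr zm.
have := Hk w; rewrite wm => /(_ mk).
have h1 := Kw w wm; have h2 := Kw (- w); rewrite modulusN wm in h2.
have h3 := Kw ('i%C * w); rewrite modulus_iM wm in h3.
have h4 := Kw (- ('i%C * w)); rewrite modulusN modulus_iM wm in h4.
move: h1 (h2 erefl) (h3 erefl) (h4 erefl) => {h2 h3 h4}.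
have := congr1 (fun x => e * x) (modulus_sqr4 c w); rewrite wm /v /sum4.
have : 0 < e * m ^+ 2 by rewrite mulr_gt0 // exprn_gt0.
rewrite !mulrDr; lra.
Qed.

End Continuity.

(** * Green functions of discs and comparison *)

Section Green.
Context {R : realType}.
Implicit Types (u : R[i] -> R) (z w zt : R[i]) (rho : R).

(** The Green function of the disc of radius [rho] with pole [zt]. *)
Definition green rho z zt : R :=
  ln (modulus ((rho ^+ 2)%:C%C - (zt^*)%C * z)) - ln rho - ln (modulus (z - zt)).

(** By [greenE], [exp (2 green) = 1 + green_ratio]; this reduces estimates of the
Green function to estimates of a rational expression in the moduli. *)
Definition green_ratio rho z zt : R :=
  (rho ^+ 2 - modulus z ^+ 2) * (rho ^+ 2 - modulus zt ^+ 2)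
    / (rho ^+ 2 * modulus (z - zt) ^+ 2).

Lemma modulus_conj z : modulus (z^*)%C = modulus z.
Proof. by case: z => a b; rewrite /modulus /= sqrrN. Qed.

Lemma modulus_sqr_green rho z zt :
  modulus ((rho ^+ 2)%:C%C - (zt^*)%C * z) ^+ 2
  = (rho ^+ 2 - modulus z ^+ 2) * (rho ^+ 2 - modulus zt ^+ 2)
    + rho ^+ 2 * modulus (z - zt) ^+ 2.
Proof. by case: z => a b; case: zt => x y; rewrite !modulus_sqr /=; ring. Qed.

Lemma green_num_neq0 rho z zt : 0 < rho -> modulus z <= rho -> modulus zt < rho ->
  (rho ^+ 2)%:C%C - (zt^*)%C * z != 0.
Proof.
move=> r0 zr ztr; rewrite -modulus_gt0.
apply: lt_le_trans (modulus_sub_ge _ _).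
rewrite modulus_real ger0_norm ?sqr_ge0 // modulusM modulus_conj.
have := modulus_ge0 z; have := modulus_ge0 zt; nra.
Qed.

Lemma modulus_sub_gt0 z w : z != w -> 0 < modulus (z - w).
Proof. by rewrite modulus_gt0 subr_eq0. Qed.

Lemma subr_sqr_ge0 (a b : R) : 0 <= a -> a <= b -> 0 <= b ^+ 2 - a ^+ 2.
Proof. by move=> a0 ab; rewrite subr_ge0 lerXn2r // nnegrE // (le_trans a0). Qed.

Section Value.
Variables (rho : R) (z zt : R[i]).
Hypotheses (r0 : 0 < rho) (zr : modulus z <= rho) (ztr : modulus zt < rho)
  (zzt : z != zt).

Lemma green_ratio_ge0 : 0 <= green_ratio rho z zt.
Proof.
apply: divr_ge0; last by rewrite mulr_ge0 ?sqr_ge0.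
by apply: mulr_ge0; apply: subr_sqr_ge0; rewrite ?modulus_ge0 // ltW.
Qed.

Lemma greenE : green rho z zt = ln (1 + green_ratio rho z zt) / 2.
Proof.
have d0 := modulus_sub_gt0 zzt.
have n0 : 0 < modulus ((rho ^+ 2)%:C%C - (zt^*)%C * z).
  by rewrite modulus_gt0; exact: green_num_neq0.
have -> : 1 + green_ratio rho z zt =
   (modulus ((rho ^+ 2)%:C%C - (zt^*)%C * z) / (rho * modulus (z - zt))) ^+ 2.
  rewrite expr_div_n modulus_sqr_green /green_ratio.
  by field; rewrite !gt_eqF.
rewrite lnXn ?divr_gt0 ?mulr_gt0 // lnM ?posrE ?invr_gt0 ?mulr_gt0 //.
rewrite lnV ?posrE ?mulr_gt0 // lnM ?posrE //.
by rewrite /green -mulr_natr; field.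
Qed.

Lemma green_ge (y : R) : 0 <= y -> y <= green_ratio rho z zt ->
  ln (1 + y) / 2 <= green rho z zt.
Proof.
move=> y0 yY; rewrite greenE; apply: ler_wpM2r; first by [].
by rewrite ler_ln ?posrE; lra.
Qed.

Lemma green_ge0 : 0 <= green rho z zt.
Proof. by have := green_ge (lexx 0) green_ratio_ge0; rewrite addr0 ln1 mul0r. Qed.

Lemma green_le_ratio : green rho z zt <= green_ratio rho z zt / 2.
Proof.
rewrite greenE; apply: ler_wpM2r; first by [].
by have := @ln_le_sub1 R (1 + green_ratio rho z zt); have := green_ratio_ge0; lra.
Qed.

End Value.

Lemma green_boundary rho z zt : 0 < rho -> modulus z = rho -> modulus zt < rho ->
  green rho z zt = 0.
Proof.
move=> r0 zr ztr.
have zzt : z != zt by apply/eqP => E; move: ztr; rewrite -E zr ltxx.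
by rewrite greenE ?zr // /green_ratio zr subrr !mul0r addr0 ln1 mul0r.
Qed.

Lemma subharmMl_harm (a : R) u z : harm u z -> subharm (fun x => a * u x) z.
Proof.
move=> H; have [a0|a0] := leP 0 a; first exact/subharmMl/harm_subharm.
have -> : (fun x => a * u x) = (fun x => - a * (- u x)) by apply/funext => x; ring.
by apply: subharmMl; [lra|exact/harm_subharm/harmN].
Qed.

Section GreenHarmonic.
Variables (rho : R) (z zt : R[i]) (a : R).
Hypotheses (r0 : 0 < rho) (zr : modulus z <= rho) (ztr : modulus zt < rho)
  (zzt : z != zt).

Lemma greenMlE : (fun x => a * green rho x zt) =
  (fun x => (a * ln (modulus (- (zt^*)%C * x + (rho ^+ 2)%:C%C)) + (- a * ln rho))
   + - a * ln (modulus (1 * x + - zt))).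
Proof.
apply/funext => x; rewrite /green mulNr mul1r (addrC _ (_%:C)%C); ring.
Qed.

Lemma subharm_green : subharm (fun x => a * green rho x zt) z.
Proof.
rewrite greenMlE; apply: subharmD; first apply: subharmD; last 2 first.
- exact: subharm_cst.
- apply: subharmMl_harm.
  apply: (@harm_ln_modulus _ (fun x => 1 * x + - zt)); first exact: taylor2_affine.
  by rewrite mul1r subr_eq0.
apply: subharmMl_harm.
apply: (@harm_ln_modulus _ (fun x => - (zt^*)%C * x + (rho ^+ 2)%:C%C)).
  exact: taylor2_affine.
by rewrite addrC mulNr green_num_neq0.
Qed.

Lemma cont_at_ln_affine (b c : R[i]) : b * z + c != 0 ->
  cont_at (fun x => ln (modulus (b * x + c))) z.
Proof.
move=> h; apply: (@cont_at_comp _ (@ln R) (fun x => modulus (b * x + c))).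
  by apply: continuous_ln; rewrite modulus_gt0.
exact: (@cont_at_modulus_taylor2 _ (fun x => b * x + c) _ (taylor2_affine _ _ _)).
Qed.

Lemma cont_at_green : cont_at (fun x => a * green rho x zt) z.
Proof.
rewrite greenMlE; apply: cont_atD; first apply: cont_atD; last 2 first.
- exact: cont_at_cst.
- by apply/cont_atMl/cont_at_ln_affine; rewrite mul1r subr_eq0.
apply/cont_atMl/cont_at_ln_affine.
by rewrite addrC mulNr green_num_neq0.
Qed.

End GreenHarmonic.

(** Away from the poles [u - H - sum_j c_j g_j] is subharmonic whatever the signs
of the [c_j], so the maximum principle applies to it. *)
Lemma green_comparison rho n (zt : 'I_n -> R[i]) (c : 'I_n -> R) (H : R)
    (K : set R[i]) u :
  0 < rho -> rho <= 1 -> (forall j, modulus (zt j) < rho) ->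
  (forall z, K z -> modulus z <= rho) ->
  (forall z, (forall e : R, 0 < e -> exists2 z', K z' & modulus (z - z') < e) -> K z) ->
  (forall z j, K z -> z != zt j) ->
  (forall z, K z -> cont_at u z) ->
  (forall z, K z -> u z <= H + \sum_j c j * green rho z (zt j) \/
     subharm u z /\ exists2 h : R, 0 < h & forall z', modulus (z' - z) < h -> K z') ->
  forall z, K z -> u z <= H + \sum_j c j * green rho z (zt j).
Proof.
move=> r0 r1 ztr Kr Kc Kzt uc HK z Kz.
rewrite -subr_le0.
pose v x := u x + (- H + \sum_j - c j * green rho x (zt j)).
have vE x : v x = u x - (H + \sum_j c j * green rho x (zt j)).
  rewrite /v; under eq_bigr do rewrite mulNr.
  by rewrite sumrN opprD.
rewrite -vE; apply: (@max_principle _ K v) => // {z Kz}z Kz.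
- exact: le_trans (Kr _ Kz) r1.
- apply: cont_atD; first exact: uc.
  apply: cont_atD; first exact: cont_at_cst.
  by apply: cont_at_sum => j _; apply: cont_at_green => //; [exact: Kr|exact: Kzt].
- rewrite vE subr_le0; have [?|[us Kh]] := HK _ Kz; [by left|right; split => //].
  apply: subharmD; first exact: us.
  apply: subharmD; first exact: subharm_cst.
  by apply: subharm_sum => j _; apply: subharm_green => //; [exact: Kr|exact: Kzt].
Qed.

(** The comparison function [V - q sum_j g_j] with [q = (t + V) / (n Gam)] equals
[V] on the outer circle and is at least [- t] on the circles of radius [s] about
the [zt j], where the mean of the [g_j] is at most [Gam]. *)
Lemma two_constants rho n (zt : 'I_n -> R[i]) (s V t Gam : R) u w :
  0 < rho -> rho < 1 -> (forall j, modulus (zt j) < rho) -> 0 < s -> (0 < n)%N ->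
  0 < Gam -> 0 <= t + V ->
  (forall z, modulus z < 1 -> cont_at u z /\ subharm u z) ->
  (forall z, modulus z = rho -> u z <= V) ->
  (forall j z, modulus z <= rho -> modulus (z - zt j) = s -> u z <= - t) ->
  (forall i z, modulus z <= rho -> modulus (z - zt i) = s ->
     (forall j, s <= modulus (z - zt j)) ->
     \sum_j green rho z (zt j) <= n%:R * Gam) ->
  modulus w <= rho -> (forall j, s <= modulus (w - zt j)) ->
  u w <= V - (t + V) / (n%:R * Gam) * \sum_j green rho w (zt j).
Proof.
move=> r0 r1 ztr s0 n0 G0 tV uP uV ut HG wr ws.
pose q := (t + V) / (n%:R * Gam).
have nG : 0 < n%:R * Gam by rewrite mulr_gt0 // ltr0n.
have q0 : 0 <= q by rewrite divr_ge0 // ltW.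
pose K := [set z : R[i] | modulus z <= rho /\ forall j, s <= modulus (z - zt j)].
have sumE z : V + \sum_j - q * green rho z (zt j) = V - q * \sum_j green rho z (zt j).
  by rewrite -mulr_sumr mulNr.
rewrite -/q -sumE.
apply: (@green_comparison rho n zt (fun=> - q) V K u) => //.
- exact: ltW.
- by move=> z [].
- move=> z Hz; split.
    by apply: disc_closed => e /Hz [z' [z'1 _] zz']; exists z'.
  move=> j; apply/ler_addgt0Pr => e /Hz [z' [_ /(_ j) sz'] zz'].
  have := modulus_distD z' (zt j) z; rewrite (modulus_distC z' z); lra.
- move=> z j [_ /(_ j)]; apply: contraTneq => ->.
  by rewrite subrr modulus0 -ltNge.
- by move=> z [zr _]; have [] := uP z (le_lt_trans zr r1).
move=> z [zr zs]; have [uc us] := uP z (le_lt_trans zr r1).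
have [zeq|zne] := eqVneq (modulus z) rho.
  left; rewrite sumE big1 ?mulr0 ?subr0; first exact: uV.
  by move=> j _; rewrite green_boundary.
have [[i /eqP zi]|Hs] := pselect (exists i, modulus (z - zt i) == s).
  left; apply: (le_trans (ut _ _ zr zi)); rewrite sumE.
  have := HG _ _ zr zi zs; set S := \sum_(_ < _) _ => HS.
  have : q * S <= t + V.
    apply: (@le_trans _ _ (q * (n%:R * Gam))); first by rewrite ler_wpM2l.
    by rewrite /q divfK // gt_eqF.
  by lra.
right; split => //.
pose d := \big[Num.min/(rho - modulus z)]_j (modulus (z - zt j) - s).
have d0 : 0 < d.
  rewrite lt_bigmin // => [|j _]; first by rewrite subr_gt0 lt_neqAle zne.
  rewrite subr_gt0 lt_neqAle zs andbT eq_sym.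
  by apply/negP => E; apply: Hs; exists j.
exists d => // z' zz'; split.
  have : d <= rho - modulus z by exact: bigmin_le_id.
  have := modulus_sub_ge z' z; lra.
move=> j; have : d <= modulus (z - zt j) - s by exact: bigmin_le_cond.
have := modulus_distD z (zt j) z'; rewrite (modulus_distC z z'); lra.
Qed.

End Green.

(** * Circles and the truncated logarithm of the modulus *)

Section Circle.
Context {R : realType}.
Implicit Types (r a b x : R).

Lemma sin_mean_value x : 0 < x -> exists2 c, 0 < c < x & sin x = cos c * x.
Proof.
move=> x0; have [|c] := @MVT R sin cos 0 x x0 (fun y _ => is_derive_sin y).
  by apply: continuous_subspaceT => y; exact: continuous_sin.
by rewrite in_itv /= sin0 !subr0 => cx E; exists c.
Qed.

Lemma norm_sin_le x : `|sin x| <= `|x|.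
Proof.
wlog x0 : x / 0 < x.
  move=> H; have [x0|x0|->] := ltgtP x 0; [|exact: H|by rewrite sin0 normr0].
  by have := H (- x); rewrite sinN !normrN oppr_gt0; apply.
have [c _ ->] := sin_mean_value x0.
by rewrite normrM ler_piMl // cos_max.
Qed.

Lemma cos_ge_1sub x : 1 - x ^+ 2 / 2 <= cos x.
Proof.
have -> : cos x = 1 - 2 * sin (x / 2) ^+ 2.
  have {1}-> : x = (x / 2) *+ 2 by rewrite -mulr_natr divfK.
  by rewrite cos_mulr2n cos2sin2 !mulr2n; ring.
have := norm_sin_le (x / 2); rewrite -(@ler_pXn2r _ 2) ?nnegrE // !real_normK ?num_real //.
by rewrite expr_div_n; lra.
Qed.

Lemma norm_sin_ge x : `|x| <= 1 -> `|x| / 2 <= `|sin x|.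
Proof.
wlog x0 : x / 0 < x.
  move=> H; have [x0|x0|->] := ltgtP x 0; [|exact: H|by rewrite sin0 normr0 mul0r].
  by have := H (- x); rewrite sinN !normrN oppr_gt0; apply.
move=> x1; have [c /andP[c0 cx] ->] := sin_mean_value x0.
rewrite gtr0_norm // in x1 *; rewrite normrM (gtr0_norm x0) mulrC ler_wpM2r //; first exact: ltW.
have := cos_ge_1sub c; have := ler_norm (cos c); nra.
Qed.

Lemma modulus_circle_point r a : 0 <= r -> modulus (circle_point r a) = r.
Proof.
move=> r0; rewrite /modulus /circle_point /= !exprMn -mulrDr cos2Dsin2 mulr1.
by rewrite sqrtr_sqr ger0_norm.
Qed.

Lemma circle_point_chord r a b : 0 <= r ->
  modulus (circle_point r a - circle_point r b) = 2 * r * `|sin ((a - b) / 2)|.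
Proof.
move=> r0; apply/eqP; rewrite -(@eqrXn2 _ 2) ?modulus_ge0 ?mulr_ge0 //.
rewrite modulus_sqr /circle_point /= exprMn real_normK ?num_real //.
have -> : sin ((a - b) / 2) ^+ 2 = (1 - cos (a - b)) / 2.
  rewrite [in RHS](_ : a - b = ((a - b) / 2) *+ 2); last by rewrite -mulr_natr divfK.
  by rewrite cos_mulr2n cos2sin2 !mulr2n; field.
rewrite cosB; have := cos2Dsin2 a; have := cos2Dsin2 b => Eb Ea; apply/eqP.
transitivity (r ^+ 2 * (cos a ^+ 2 + sin a ^+ 2) + r ^+ 2 * (cos b ^+ 2 + sin b ^+ 2)
   - 2 * r ^+ 2 * (cos a * cos b + sin a * sin b)); first by ring.
by rewrite Ea Eb; field.
Qed.

Lemma circle_point_dist_le r a b : 0 <= r ->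
  modulus (circle_point r a - circle_point r b) <= r * `|a - b|.
Proof.
move=> r0; rewrite circle_point_chord //.
have := norm_sin_le ((a - b) / 2); rewrite normrM (ger0_norm (_ : 0 <= 2^-1)) //.
by nra.
Qed.

Lemma circle_point_dist_ge r a b : 0 <= r -> `|a - b| <= 2 ->
  r * `|a - b| / 2 <= modulus (circle_point r a - circle_point r b).
Proof.
move=> r0 ab; rewrite circle_point_chord //.
have := @norm_sin_ge ((a - b) / 2); rewrite normrM (ger0_norm (_ : 0 <= 2^-1)) //.
move=> H; have : `|a - b| / 2 <= 1 by lra.
by move/H; nra.
Qed.

Lemma circle_point_radial r r' a :
  modulus (circle_point r a - circle_point r' a) = `|r - r'|.
Proof.
have -> : circle_point r a - circle_point r' a = circle_point (r - r') a.
  by apply/eqP; rewrite eq_complex /=; apply/andP; split; apply/eqP; ring.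
rewrite /modulus /circle_point /= !exprMn -mulrDr cos2Dsin2 mulr1.
by rewrite sqrtr_sqr.
Qed.

Lemma circle_point_surj r (z : R[i]) : modulus z = r ->
  exists2 a, 0 <= a <= 2 * pi & z = circle_point r a.
Proof.
move=> zr; have r0 : 0 <= r by rewrite -zr modulus_ge0.
have p0 := pi_ge0 R.
have := r0; rewrite le_eqVlt => /predU1P[r00|rp].
  exists 0; first by rewrite lexx mulr_ge0.
  have /modulus0_eq0 -> : modulus z = 0 by rewrite zr.
  by apply/eqP; rewrite eq_complex /= -r00 !mul0r eqxx.
case: z zr => x y zr.
have E : x ^+ 2 + y ^+ 2 = r ^+ 2 by rewrite -zr modulus_sqr.
have xr : -1 <= x / r <= 1.
  by rewrite ler_pdivlMr // ler_pdivrMr //; nra.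
have cE : cos (acos (x / r)) = x / r by rewrite acosK // in_itv.
have xE : r * cos (acos (x / r)) = x by rewrite cE mulrC divfK // gt_eqF.
have yE : r * sin (acos (x / r)) = `|y|.
  rewrite sin_acos //; apply/eqP; rewrite -(@eqrXn2 _ 2) ?mulr_ge0 ?sqrtr_ge0 //.
  rewrite exprMn sqr_sqrtr; last by rewrite subr_ge0 -ler_norml in xr *; rewrite -real_normK ?num_real // expr_le1.
  rewrite real_normK ?num_real //; apply/eqP.
  have -> : y ^+ 2 = r ^+ 2 - x ^+ 2 by rewrite -E; ring.
  by field; rewrite gt_eqF.
have := acos_ge0 xr; have := acos_lepi xr => h1 h2.
have [y0|y0] := leP 0 y.
  exists (acos (x / r)); first lra.
  by apply/eqP; rewrite eq_complex /= xE yE ger0_norm // !eqxx.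
exists (2 * pi - acos (x / r)); first lra.
have e2 : 2 * pi - acos (x / r) = - acos (x / r) + pi *+ 2 by rewrite mulr2n; ring.
apply/eqP; rewrite eq_complex /= e2 cosD2pi sinD2pi cosN sinN mulrN xE yE ltr0_norm //.
by rewrite opprK !eqxx.
Qed.

Lemma pi_lt4 : (pi : R) < 4.
Proof. by have := pihalf_lt2 R; lra. Qed.

End Circle.

Section LogModulus.
Context {R : realType}.
Variable f : R[i] -> R[i].
Hypothesis fa : analytic_in_disc f.
Implicit Types (B V : R) (z : R[i]).

(** [ln |f|] cut off from below at [- B]: finite everywhere, zeros included. *)
Definition logmod B z : R := ln (Num.max (modulus (f z)) (expR (- B))).

Let max_gt0 B z : 0 < Num.max (modulus (f z)) (expR (- B)).
Proof. by rewrite lt_max expR_gt0 orbT. Qed.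

Lemma logmod_geN B z : - B <= logmod B z.
Proof.
by rewrite /logmod -{1}(expRK (- B)) ler_ln ?posrE ?expR_gt0 // le_max lexx orbT.
Qed.

Lemma logmod_le B V z : - B <= V -> modulus (f z) <= expR V -> logmod B z <= V.
Proof.
move=> BV fV; rewrite /logmod -{1}(expRK V) ler_ln ?posrE ?expR_gt0 //.
by rewrite ge_max fV ler_expR.
Qed.

Lemma logmod_ge B V z : expR V <= modulus (f z) -> V <= logmod B z.
Proof.
move=> fV; rewrite /logmod -{1}(expRK V) ler_ln ?posrE ?expR_gt0 //.
by rewrite le_max fV.
Qed.

Lemma cont_at_modulus_f z : modulus z < 1 -> cont_at (fun x => modulus (f x)) z.
Proof. by move=> z1; exact/cont_at_modulus_taylor2/taylor2_analytic. Qed.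

Lemma cont_at_logmod B z : modulus z < 1 -> cont_at (logmod B) z.
Proof.
move=> z1; apply: (@cont_at_comp _ (@ln R)).
  by apply: continuous_ln; exact: max_gt0.
apply: (@cont_at_comp _ (fun x => Num.max x (expR (- B)))); last exact: cont_at_modulus_f.
by apply: continuous_max; [exact: cvg_id|exact: cvg_cst].
Qed.

Lemma subharm_logmod B z : modulus z < 1 -> subharm (logmod B) z.
Proof.
move=> z1; have [fz|fz] := leP (modulus (f z)) (expR (- B)).
  have E : logmod B z = - B.
    by apply/eqP; rewrite eq_le logmod_geN andbT logmod_le.
  move=> eps eps0; exists 1 => // w _; rewrite E.
  have h x := logmod_geN B x.
  have := h (z + w); have := h (z - w); have := h (z + 'i%C * w).
  have := h (z - 'i%C * w); rewrite /sum4.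
  have : 0 <= eps * modulus w ^+ 2 by rewrite mulr_ge0 ?sqr_ge0 // ltW.
  lra.
have d0 : 0 < modulus (f z) - expR (- B) by rewrite subr_gt0.
have [h h0 Hh] := cont_at_modulus_f z1 d0.
apply: (@subharm_near _ (fun x => ln (modulus (f x))) _ _ h h0).
  move=> x /Hh; rewrite ltr_norml => /andP[A _].
  by rewrite /logmod max_l //; lra.
apply/harm_subharm/harm_ln_modulus; first exact: taylor2_analytic.
by rewrite -modulus_gt0; apply: lt_trans fz; exact: expR_gt0.
Qed.

End LogModulus.

(** * Domination by circular means *)

Section CircleMean.
Context {R : realType}.
Implicit Types (rho : R).

Lemma grid_cell (N : nat) (x : R) : (0 < N)%N -> 0 <= x <= N%:R ->
  exists j : 'I_N, j%:R <= x <= j.+1%:R.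
Proof.
case: N => // N _ /andP[x0 xN].
have [xlt|xge] := ltP x N.+1%:R.
  have /andP[h1 h2] := truncn_itv x0.
  have jN : (Num.truncn x < N.+1)%N by rewrite -(ltr_nat R); exact: le_lt_trans xlt.
  by exists (Ordinal jN); rewrite /= h1 ltW.
by exists ord_max => /=; rewrite xN andbT (le_trans _ xge) // ler_nat.
Qed.

(** The kernel is a Green function with pole just outside the circle: with [N]
poles at distance [1/N] from the circle [|z| = rho], in the disc of radius
[rho + 2/N], each one is bounded below on its own arc, so that a single term of
the sum already dominates [v] there, while it is [O(1/N)] well inside. *)
Lemma circle_mean_discrete (v : R[i] -> R) rho (a : R[i]) eps :
  (forall z, modulus z < 1 -> cont_at v z /\ subharm v z) ->
  (forall z, 0 <= v z) ->
  1 / 2 <= rho -> rho < 1 -> modulus a <= 2 * rho - 1 -> 0 < eps ->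
  exists (N : nat) (m : 'I_N -> R), [/\ (0 < N)%N,
    forall j, 0 <= m j,
    forall (j : 'I_N) t, 2 * pi * j%:R / N%:R <= t <= 2 * pi * j.+1%:R / N%:R ->
      m j <= v (circle_point rho t) &
    v a <= eps + 332 / (1 - rho) * (N%:R^-1 * \sum_j m j)].
Proof.
move=> vP v0 rho2 rho1 ar eps0.
have e2 : 0 < eps / 2 by rewrite divr_gt0.
have [h h0 Hh] := unif_cont_disc rho1 (fun z z1 => (vP z z1).1) e2.
set d := 1 - rho; have d0 : 0 < d by rewrite /d; lra.
have hd0 : 0 < Num.min (h / 8) (d / 2) by rewrite lt_min !divr_gt0.
have [N N0 HN] : exists2 N : nat, (0 < N)%N & N%:R^-1 < Num.min (h / 8) (d / 2).
  have [M _ HM] := near_infty_natSinv_lt (PosNum hd0).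
  by exists M.+1 => //; apply: (HM M (leqnn M)).
move: HN; rewrite lt_min => /andP[Nh Nd].
have N0' : 0 < N%:R :> R by rewrite ltr0n.
have iN0 : 0 < N%:R^-1 :> R by rewrite invr_gt0.
set q := N%:R^-1 in Nh Nd iN0 *.
have pi4 := @pi_lt4 R; have pi0 := pi_gt0 R.
pose e (j : nat) : R := 2 * pi * j%:R / N%:R.
pose m (j : 'I_N) := Num.max 0 (v (circle_point rho (e j)) - eps / 2).
have rho0 : 0 <= rho by lra.
have cell (j : 'I_N) t : e j <= t <= e j.+1 ->
    `|v (circle_point rho t) - v (circle_point rho (e j))| < eps / 2 /\
    modulus (circle_point rho t - circle_point rho (e j)) <= 8 * q.
  move=> tj.
  have tq : `|t - e j| <= 8 * q.
    have : e j.+1 = e j + 2 * pi * q by rewrite /e /q -natr1; ring.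
    by move: tj => /andP[? ?] ?; rewrite ger0_norm; nra.
  have D : modulus (circle_point rho t - circle_point rho (e j)) <= 8 * q.
    apply: le_trans (circle_point_dist_le _ _ rho0) _.
    by have := normr_ge0 (t - e j); nra.
  split => //; apply: Hh; first by rewrite modulus_circle_point.
  by apply: le_lt_trans D _; lra.
exists N, m; split => //.
- by move=> j; rewrite /m le_max lexx.
- move=> j t /cell[]; rewrite ltr_norml /m ge_max v0 /= => ? _; lra.
pose r1 := rho + q; pose r2 := rho + 2 * q.
pose zt (j : 'I_N) : R[i] := circle_point r1 (e j).
have r20 : 0 < r2 by rewrite /r2; lra.
have ztE j : modulus (zt j) = r1 by rewrite modulus_circle_point // /r1; lra.
have ztr j : modulus (zt j) < r2 by rewrite ztE /r1 /r2; lra.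
have zne (z : R[i]) j : modulus z <= rho -> z != zt j.
  by move=> zr; apply: contraTneq zr => ->; rewrite ztE -ltNge /r1; lra.
(* On its own cell a pole has ratio at least [2 / 81], and
   [ln (1 + 2 / 81) / 2 >= 1 / 83]; the final constant is [332 = 4 * 83]. *)
have comp : forall z, modulus z <= rho ->
    v z <= eps + \sum_j (83 * m j) * green r2 z (zt j).
  apply: (@green_comparison _ r2 N zt _ eps [set z | modulus z <= rho]) => //.
  - by rewrite /r2; move: Nd; rewrite /d; lra.
  - by move=> z /= zr; rewrite /r2; lra.
  - by move=> z Hz; exact: disc_closed.
  - by move=> z /= zr; have [] := vP z (le_lt_trans zr rho1).
  move=> z /= zr; have [zeq|zlt] := eqVneq (modulus z) rho; last first.
    right; split; first by have [] := vP z (le_lt_trans zr rho1).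
    exists (rho - modulus z); first by rewrite subr_gt0 lt_neqAle zlt.
    by move=> z' zz'; have := modulus_sub_ge z' z; lra.
  left; have [t tpi zt'] := circle_point_surj zeq.
  have [j tj] : exists j : 'I_N, e j <= t <= e j.+1.
    have [|j jt] := @grid_cell N (t * N%:R / (2 * pi)) N0.
      rewrite divr_ge0 ?mulr_ge0 //=; [|lra..].
      by rewrite ler_pdivrMr ?mulr_gt0 // mulrC ler_wpM2l //; lra.
    exists j; rewrite /e ler_pdivrMr // ler_pdivlMr // !(mulrC (2 * pi)).
    by move: jt; rewrite ler_pdivlMr ?mulr_gt0 // ler_pdivrMr ?mulr_gt0.
  have [vj zj] := cell _ _ tj; rewrite -zt' in vj zj.
  have zzt : modulus (z - zt j) <= 9 * q.
    apply: le_trans (modulus_distD _ _ (circle_point rho (e j))) _.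
    by rewrite circle_point_radial /r1 opprD addNKr normrN gtr0_norm //; lra.
  have gj : 1 / 83 <= green r2 z (zt j).
    have zn := modulus_sub_gt0 (zne z j zr).
    have D0 : 0 < r2 ^+ 2 * modulus (z - zt j) ^+ 2.
      by rewrite mulr_gt0 // exprn_gt0.
    apply: (@le_trans _ _ (ln (1 + 2 / 81) / 2)).
      have := @ln_ge_1subV R (1 + 2 / 81).
      have -> : (1 + 2 / 81 : R)^-1 = 81 / 83 by field.
      by lra.
    apply: green_ge => //; [by rewrite /r2; lra|exact: zne|].
    rewrite /green_ratio ler_pdivlMr // ztE zeq.
    have S : modulus (z - zt j) ^+ 2 <= 81 * q ^+ 2.
      by have := modulus_ge0 (z - zt j); nra.
    apply: (@le_trans _ _ (2 / 81 * (r2 ^+ 2 * (81 * q ^+ 2)))).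
      by rewrite ler_wpM2l // ler_wpM2l // sqr_ge0.
    have -> : 2 / 81 * (r2 ^+ 2 * (81 * q ^+ 2)) = (2 * q * r2) * (q * r2) by field.
    apply: ler_pM; rewrite ?mulr_ge0 ?(ltW r20) ?(ltW iN0) //.
      by rewrite /r2; nra.
    by rewrite /r1 /r2; nra.
  rewrite (bigD1 j) //=.
  have S0 : 0 <= \sum_(i < N | i != j) 83 * m i * green r2 z (zt i).
    apply: sumr_ge0 => i _; rewrite mulr_ge0 ?mulr_ge0 //.
      by rewrite /m le_max lexx.
    by apply: green_ge0 => //; [rewrite /r2; lra|exact: zne].
  have m0 : 0 <= m j by rewrite /m le_max lexx.
  have mv : v z - eps <= m j.
    by rewrite /m le_max; apply/orP; right; move: vj; rewrite ltr_norml; lra.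
  by nra.
apply: le_trans (comp a _) _; first by lra.
rewrite lerD2l mulrA mulr_sumr; apply: ler_sum => j _.
have m0 : 0 <= m j by rewrite /m le_max lexx.
have G : green r2 a (zt j) <= 4 * q / d.
  have aj : modulus a <= rho by lra.
  have zn := modulus_sub_gt0 (zne a j aj).
  apply: le_trans (green_le_ratio _ _ _ _) _ => //; [by rewrite /r2; lra|exact: zne|].
  rewrite ler_pdivrMr //.
  set D := modulus (a - zt j) in zn *.
  have Dge : r1 - modulus a <= D.
    by have := modulus_sub_ge (zt j) a; rewrite ztE modulus_distC.
  have a0 := modulus_ge0 a.
  apply: (@le_trans _ _ (8 * q / D)).
    rewrite /green_ratio ler_pdivrMr ?mulr_gt0 ?exprn_gt0 // ztE -/D.
    have -> : 8 * q / D * (r2 ^+ 2 * D ^+ 2) = (2 * D * (2 * r2)) * (q * (2 * r2)).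
      by field; rewrite gt_eqF.
    rewrite !subr_sqr; clear - d0 Nd iN0 Dge a0 zn rho2 rho1 ar.
    rewrite /r2 /r1 /d in Dge Nd d0 *; apply: ler_pM.
    - by apply: mulr_ge0; lra.
    - by apply: mulr_ge0; lra.
    - by apply: ler_pM; lra.
    - by apply: ler_pM; lra.
  rewrite ler_pdivrMr //.
  have -> : 4 * q / d * 2 * D = 8 * q * (D / d) by field; rewrite gt_eqF.
  by rewrite ler_peMr ?mulr_ge0 ?(ltW iN0) // ler_pdivlMr // mul1r; rewrite /r1 /d in Dge *; lra.
have -> : 332 / d * q * m j = 83 * m j * (4 * q / d) by field; rewrite gt_eqF.
by rewrite ler_wpM2l // mulr_ge0.
Qed.

End CircleMean.

(** * Points where the modulus is not too small *)

Section Reach.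
Context {R : realType}.
Variable f : R[i] -> R[i].
Hypothesis fa : analytic_in_disc f.
Implicit Types (r d A V t th : R) (z w : R[i]).

(** A lower bound at every point of a circle would fail at the zeros of [f]; one
good point near each arc, at the scale of the distance to the unit circle, is
what propagates outwards. *)
Definition good_points r A := forall th, exists2 w : R[i],
  modulus (w - circle_point r th) <= (1 - r) / 10 & expR (- A) <= modulus (f w).

Lemma bounded_disc r : r < 1 ->
  exists2 B : R, 0 <= B & forall z, modulus z <= r -> modulus (f z) <= expR B.
Proof.
move=> r1; have [r0|r0] := ltP r 0.
  by exists 0 => // z zr; have := modulus_ge0 z; lra.
have [||||c _ Hc] := @closed_disc_max R [set z | modulus z <= r] (fun z => modulus (f z)).
- by exists 0; rewrite /mkset modulus0.
- by move=> z /= zr; lra.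
- by move=> z; exact: disc_closed.
- by move=> z /= zr; apply: cont_at_modulus_f => //; lra.
exists (modulus (f c)); first exact: modulus_ge0.
by move=> z zr; apply: le_trans (Hc z zr) _; have := expR_ge1Dx (modulus (f c)); lra.
Qed.

(** The pole is at distance [d] from the circle [|z| = 1 - d], the point [w] at
distance of order [d'], and both lie within [O(d')] of each other: the ratio is
of order [d d' / d'^2]. *)
Lemma green_lower (d d' th : R) (w zt : R[i]) :
  0 < d -> 2 * d <= d' -> d' <= 1 ->
  modulus (w - circle_point (1 - d') th) <= d' / 10 ->
  modulus zt = 1 - 2 * d ->
  modulus (zt - circle_point (1 - 2 * d) th) <= d' -> w != zt ->
  modulus w <= 1 - d /\ 1 / 25 * (d / d') <= green (1 - d) w zt.
Proof.
move=> d0 dd' d1 wd' ztE ztd wzt.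
have r'0 : 0 <= 1 - d' by lra.
have d'0 : 0 < d' by lra.
have wr : modulus w <= 1 - 9 / 10 * d'.
  by have := modulus_sub_ge w (circle_point (1 - d') th); rewrite modulus_circle_point //; lra.
have wr1 : modulus w <= 1 - d by lra.
split => //.
have wz : modulus (w - zt) <= 21 / 10 * d'.
  have h1 := modulus_distD w zt (circle_point (1 - d') th).
  have h2 := modulus_distD (circle_point (1 - d') th) zt (circle_point (1 - 2 * d) th).
  rewrite circle_point_radial in h2.
  have h3 : `|1 - d' - (1 - 2 * d)| <= d' by rewrite ler_norml; lra.
  by rewrite modulus_distC in ztd; lra.
set y := 9 / 100 * (d / d').
have y0 : 0 <= y by rewrite /y mulr_ge0 // divr_ge0 // ltW.
have y1 : y <= 45 / 1000.
  rewrite /y; have : d / d' <= 1 / 2 by rewrite ler_pdivrMr //; lra.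
  by lra.
apply: (@le_trans _ _ (ln (1 + y) / 2)).
  have y2 : 0 < 1 + y by lra.
  have := ln_ge_1subV y2.
  have -> : 1 - (1 + y)^-1 = y / (1 + y) by field; rewrite gt_eqF.
  have : y * (200 / 209) <= y / (1 + y) by rewrite ler_pdivlMr //; nra.
  by move: y0; rewrite /y; lra.
have zn := modulus_sub_gt0 wzt.
apply: green_ge => //; [lra|by rewrite ztE; lra|].
rewrite /green_ratio ler_pdivlMr; last by rewrite mulr_gt0 // exprn_gt0 //; lra.
rewrite ztE; have w0 := modulus_ge0 w.
have S : modulus (w - zt) ^+ 2 <= 441 / 100 * d' ^+ 2 by nra.
apply: (@le_trans _ _ (y * ((1 - d) ^+ 2 * (441 / 100 * d' ^+ 2)))).
  by rewrite ler_wpM2l // ler_wpM2l // sqr_ge0.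
have -> : y * ((1 - d) ^+ 2 * (441 / 100 * d' ^+ 2))
   = (3969 / 10000 * d' * (1 - d)) * (d * (1 - d)).
  by rewrite /y; field; rewrite gt_eqF.
rewrite !subr_sqr; clear - d0 dd' d1 d'0 wr w0; apply: ler_pM.
- by apply: mulr_ge0; lra.
- by apply: mulr_ge0; lra.
- by apply: ler_pM; lra.
- by apply: ler_pM; lra.
Qed.

(** If [|f|] were below [e^-t] on a whole disc of radius [d / 5], [two_constants]
with this disc would contradict the good point at distance [d']: the Green
function is at most [60] on its boundary and at least [(d / d') / 25] at that
point, and [1600 > 60 * 25]. *)
Lemma good_points_step d d' A V :
  0 < d -> 2 * d <= d' -> d' <= 1 -> 1 <= A -> 0 <= V ->
  good_points (1 - d') A ->
  (forall z, modulus z = 1 - d -> modulus (f z) <= expR V) ->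
  good_points (1 - 2 * d) (1600 * (d' / d) * (A + V)).
Proof.
move=> d0 dd' d1 A1 V0 HA HV th; apply: contrapT => Hn.
set t := 1600 * (d' / d) * (A + V) in Hn.
have d'0 : 0 < d' by lra.
have dd1 : 1 <= d' / d by rewrite ler_pdivlMr // mul1r; lra.
have tA : A < t.
  rewrite /t; set x := d' / d in dd1 *; nra.
have fs z : modulus (z - circle_point (1 - 2 * d) th) <= d / 5 -> modulus (f z) <= expR (- t).
  move=> zs; rewrite leNgt; apply/negP => ft; apply: Hn; exists z; last exact: ltW.
  by rewrite opprB addrCA subrr addr0; lra.
have [w wd' wA] := HA th.
set zt := circle_point (1 - 2 * d) th in fs.
have ztE : modulus zt = 1 - 2 * d by rewrite modulus_circle_point; lra.
have ws : d / 5 <= modulus (w - zt).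
  rewrite leNgt; apply/negP => /ltW/fs ft.
  by have := le_trans wA ft; rewrite ler_expR; lra.
have wzt : w != zt.
  by apply: contraTneq ws => ->; rewrite subrr modulus0 -ltNge; lra.
have [wr gw] : modulus w <= 1 - d /\ 1 / 25 * (d / d') <= green (1 - d) w zt.
  apply: (@green_lower d d' th) => //.
  - by have -> : d' / 10 = (1 - (1 - d')) / 10 by ring.
  - by rewrite /zt subrr modulus0; lra.
have tV : 0 < t + V by lra.
have tw : logmod f t w <= V - (t + V) / (1%:R * 60) * \sum_(j < 1) green (1 - d) w zt.
  apply: (@two_constants _ (1 - d) 1 (fun=> zt) (d / 5)) => //.
  - lra.
  - lra.
  - by move=> _; rewrite ztE; lra.
  - lra.
  - exact: ltW.
  - by move=> z z1; split; [exact: cont_at_logmod|exact: subharm_logmod].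
  - by move=> z /HV; apply: logmod_le; lra.
  - by move=> _ z _ zs; apply: logmod_le => //; apply: fs; rewrite zs; lra.
  - move=> _ z zr zs _; rewrite big_ord1 mul1r.
    have zzt : z != zt.
      by apply/eqP => zz; move: zs; rewrite zz subrr modulus0; lra.
    apply: le_trans (green_le_ratio _ zr _ zzt) _; [lra|rewrite ztE; lra|].
    rewrite /green_ratio ztE zs ler_pdivrMr // ler_pdivrMr; last first.
      by rewrite mulr_gt0 // exprn_gt0 //; clear - d0 dd' d1; lra.
    have z0 : 1 - 2 * d - d / 5 <= modulus z.
      by have := modulus_sub_ge zt z; rewrite ztE modulus_distC zs; lra.
    have zn := modulus_ge0 z.
    have -> : 60 * 2 * ((1 - d) ^+ 2 * (d / 5) ^+ 2)
        = (12 / 5 * d * (1 - d)) * (2 * d * (1 - d)) by field.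
    rewrite !subr_sqr; clear - d0 dd' d1 z0 zn zr; apply: ler_pM.
    - by apply: mulr_ge0; lra.
    - by apply: mulr_ge0; lra.
    - have : (1 - d - modulus z) * (1 - d + modulus z) <= (6 / 5 * d) * (2 * (1 - d)).
        by apply: ler_pM; lra.
      lra.
    - have : (1 - d - (1 - 2 * d)) * (1 - d + (1 - 2 * d)) <= d * (2 * (1 - d)).
        by apply: ler_pM; lra.
      lra.
have uw : - A <= logmod f t w by exact: logmod_ge.
rewrite big_ord1 mul1r in tw.
have E : d / d' * (d' / d) = 1 by field; rewrite !gt_eqF.
have D0 : 0 <= d' / d by lra.
have G : 1 / 25 <= green (1 - d) w zt * (d' / d).
  by have := ler_wpM2r D0 gw; rewrite -(mulrA (1 / 25)) E mulr1.
have : (t + V) / 60 * green (1 - d) w zt <= A + V by lra.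
move/(ler_wpM2r D0); rewrite -(mulrA ((t + V) / 60)).
have : (t + V) / 60 * (1 / 25) <= (t + V) / 60 * (green (1 - d) w zt * (d' / d)).
  by rewrite ler_wpM2l // divr_ge0 // ltW.
have -> : (A + V) * (d' / d) = t / 1600 by rewrite /t; field; rewrite gt_eqF.
lra.
Qed.

(** If [f] vanished on the disc of radius [1/10], letting [t] tend to infinity in
[two_constants] would make it vanish at [z1]. *)
Lemma good_points0 z1 : modulus z1 < 1 -> f z1 != 0 -> exists2 A, 1 <= A & good_points 0 A.
Proof.
move=> z11 fz1.
suff [w0 w01 fw0] : exists2 w0, modulus w0 <= 1 / 10 & f w0 != 0.
  exists (Num.max 1 (- ln (modulus (f w0)))); first by rewrite le_max lexx.
  move=> th; exists w0.
    have -> : circle_point 0 th = 0 :> R[i] by rewrite /circle_point !mul0r.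
    by rewrite !subr0.
  rewrite -[leRHS]lnK ?posrE ?modulus_gt0 // ler_expR.
  by rewrite lerNl le_max lexx orbT.
apply: contrapT => Hn.
have f0 z : modulus z <= 1 / 10 -> f z = 0.
  by move=> zs; apply/eqP; apply/negPn/negP => fz; apply: Hn; exists z.
have z1s : 1 / 10 < modulus z1.
  by rewrite ltNge; apply/negP => /f0 E; rewrite E eqxx in fz1.
set rho := (1 + modulus z1) / 2.
have rho1 : rho < 1 by rewrite /rho; lra.
have z1rho : modulus z1 < rho by rewrite /rho; lra.
have rho0 : 1 / 10 < rho by lra.
have [V V0 HV] := bounded_disc rho1.
have z10 : z1 != 0 by apply: contraTneq z1s => ->; rewrite modulus0 -leNgt; lra.
have m00 : modulus (0 : R[i]) < rho by rewrite modulus0; lra.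
have g0 : 0 < green rho z1 0.
  apply: (@lt_le_trans _ _ (ln (1 + green_ratio rho z1 0) / 2)); last first.
    by rewrite -greenE //; lra.
  rewrite divr_gt0 // ln_gt0 // ltrDl.
  rewrite /green_ratio modulus0 subr0 expr0n /= subr0.
  rewrite divr_gt0 ?mulr_gt0 ?exprn_gt0 //; [|lra..].
  by rewrite subr_sqr mulr_gt0; lra.
set g := green rho z1 0 in g0.
pose L := ln (modulus (f z1)).
pose t := 50 * (V + `|L| + 1) / g.
have t0 : 0 < t.
  by rewrite /t divr_gt0 // mulr_gt0 //; have := normr_ge0 L; lra.
have tw : logmod f t z1 <= V - (t + V) / (1%:R * 50) * \sum_(j < 1) green rho z1 0.
  apply: (@two_constants _ rho 1 (fun=> 0) (1 / 10)) => //.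
  - lra.
  - by apply: addr_ge0 => //; exact: ltW.
  - by move=> z z1'; split; [exact: cont_at_logmod|exact: subharm_logmod].
  - by move=> z zr; apply: logmod_le; [lra|apply: HV; rewrite zr].
  - move=> _ z _ zs; apply: logmod_le => //.
    by rewrite f0 ?modulus0 ?expR_ge0 // -zs subr0.
  - move=> _ z zr zs _; rewrite big_ord1 mul1r.
    have zzt : z != 0.
      by apply/eqP => zz; move: zs; rewrite zz subrr modulus0; lra.
    apply: le_trans (green_le_ratio _ zr _ zzt) _ => //; [lra|].
    rewrite /green_ratio zs modulus0 expr0n /= subr0 ler_pdivrMr // ler_pdivrMr; last first.
      by rewrite mulr_gt0 // exprn_gt0; lra.
    have h2 : 0 <= rho ^+ 2 by rewrite sqr_ge0.
    have h1 : rho ^+ 2 <= 1 by rewrite expr_le1 //; lra.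
    have -> : 50 * 2 * (rho ^+ 2 * (1 / 10) ^+ 2) = 1 * rho ^+ 2 by field.
    by rewrite ler_wpM2r //; have := sqr_ge0 (modulus z); lra.
  - exact: ltW.
  - by move=> _; rewrite subr0 ltW.
rewrite big_ord1 mul1r -/g in tw.
have uw : L <= logmod f t z1.
  by apply: logmod_ge; rewrite /L lnK // posrE modulus_gt0.
have E : (t + V) / 50 * g = (V + `|L| + 1) + V / 50 * g.
  by rewrite /t; field; rewrite gt_eqF.
have : 0 <= V / 50 * g by rewrite mulr_ge0 ?divr_ge0 // ltW.
have := ler_norm (- L); rewrite normrN.
by rewrite E in tw; lra.
Qed.

(** Any constant that does not depend on the radii is good enough for iterating
the step. *)
Definition step_constant (C : R) := 1 <= C /\ forall d d' A V,
  0 < d -> 2 * d <= d' -> d' <= 1 -> 1 <= A -> 0 <= V ->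
  good_points (1 - d') A ->
  (forall z, modulus z = 1 - d -> modulus (f z) <= expR V) ->
  good_points (1 - 2 * d) (C * (d' / d) * (A + V)).

Lemma step_constant_exists : exists C, step_constant C.
Proof.
exists 1600; split; first by rewrite (ler_nat R 1).
exact: good_points_step.
Qed.

Lemma good_points_chain_arith (N q K A0 C : R) :
  1 <= N -> 1 <= C -> 4 * C * N <= q -> 0 <= K -> 1 <= A0 ->
  2 * C * N * (A0 + 4 * C * N * K) + 2 * C * N * K * q <= (A0 + 4 * C * N * K) * q.
Proof.
move=> N1 C1 qN K0 A01.
have CN : 0 <= C * N by rewrite mulr_ge0 //; lra.
have NK : 0 <= C * N * K by rewrite mulr_ge0.
have q4 : 0 <= q - 4 * C * N by lra.
have h1 : 0 <= (q - 4 * C * N) * A0 by apply: mulr_ge0 => //; lra.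
have h2 : 0 <= (q - 4 * C * N) * (C * N * K) by apply: mulr_ge0.
have h3 : 0 <= C * N * A0 by apply: mulr_ge0 => //; lra.
lra.
Qed.

(** A step multiplies the bound by [2 C N] and adds a multiple of [q^(k+1)]; as
[q >= 4 C N], the powers [q^k] absorb both. *)
Lemma good_points_chain (C N q K : R) z1 : step_constant C ->
  modulus z1 < 1 -> f z1 != 0 -> 2 <= N -> 4 * C * N <= q -> 0 <= K ->
  (forall k z, modulus z = 1 - (N ^+ k)^-1 / 2 -> modulus (f z) <= expR (K * q ^+ k)) ->
  exists2 K' : R, 1 <= K' & forall k, good_points (1 - (N ^+ k)^-1) (K' * q ^+ k).
Proof.
move=> [C1 HC] z11 fz1 N2 qN K0 HV; have [A0 A01 HA0] := good_points0 z11 fz1.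
set K' := A0 + 4 * C * N * K.
have N1 : 1 <= N by lra.
have N0 : 0 < N by lra.
have q1 : 1 <= q by nra.
have CN : 0 <= C * N by rewrite mulr_ge0 //; lra.
have NK : 0 <= C * N * K by rewrite mulr_ge0.
have K'A : A0 <= K' by rewrite /K'; lra.
have K'1 : 1 <= K' by lra.
exists K' => //; elim=> [|k IH].
  rewrite expr0 invr1 subrr expr0 mulr1 => th; have [w wd wA] := HA0 th.
  by exists w => //; apply: le_trans wA; rewrite ler_expR lerN2.
have Nk : 0 < N ^+ k by rewrite exprn_gt0.
have qk : 1 <= q ^+ k by rewrite exprn_ege1.
set d := (N ^+ k.+1)^-1 / 2.
have dE : d = (N ^+ k)^-1 / N / 2 by rewrite /d exprS invfM; ring.
have iNk : 0 < (N ^+ k)^-1 by rewrite invr_gt0.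
have d0 : 0 < d by rewrite dE divr_gt0 // divr_gt0.
have := HC d (N ^+ k)^-1 (K' * q ^+ k) (K * q ^+ k.+1).
have -> : 1 - 2 * d = 1 - (N ^+ k.+1)^-1 by rewrite /d mulrC divfK.
have Ed : (N ^+ k)^-1 / d = 2 * N.
  by rewrite dE; field; rewrite (gt_eqF Nk) (gt_eqF N0).
move=> H; have {H}H : good_points (1 - (N ^+ k.+1)^-1)
    (C * ((N ^+ k)^-1 / d) * (K' * q ^+ k + K * q ^+ k.+1)).
  apply: H => //.
  - by rewrite dE mulrC divfK // ler_pdivrMr // ler_peMr // ltW.
  - by rewrite invf_le1 // exprn_ege1.
  - by rewrite -[leLHS]mulr1 ler_pM.
  - by rewrite mulr_ge0 // exprn_ge0 // (le_trans _ q1).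
  - by move=> z /HV.
move=> th; have [w wd wA] := H th; exists w => //; apply: le_trans wA.
rewrite ler_expR lerN2 Ed exprS.
have -> : C * (2 * N) * (K' * q ^+ k + K * (q * q ^+ k))
  = (2 * C * N * K' + (2 * C * N * K) * q) * q ^+ k by ring.
rewrite [leRHS]mulrA ler_wpM2r //; first exact: le_trans qk.
exact: good_points_chain_arith.
Qed.

End Reach.

(** * Logarithmic sums *)

Section HarmonicTypeSum.
Context {R : realType}.

Definition lnp (x : R) : R := ln (Num.max 1 x).

Lemma lnp_ge0 x : 0 <= lnp x.
Proof. by rewrite ln_ge0 // le_max lexx. Qed.

Lemma ln_le_lnp x : 0 < x -> ln x <= lnp x.
Proof. by move=> x0; rewrite ler_ln ?posrE ?lt_max ?ltr01 // le_max lexx orbT. Qed.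

Lemma lnp_le1 x : x <= 1 -> lnp x = 0.
Proof. by move=> x1; rewrite /lnp max_l // ln1. Qed.

Lemma lnp_ge1 x : 1 <= x -> lnp x = ln x.
Proof. by move=> x1; rewrite /lnp max_r. Qed.

(** [n^n / n! <= e^n], in logarithmic form. *)
Lemma sum_ln_ratio_le (n : nat) : \sum_(k < n) ln (n%:R / k.+1%:R) <= n%:R :> R.
Proof.
elim: n => [|n IH]; first by rewrite big_ord0.
rewrite big_ord_recr /= divff ?pnatr_eq0 // ln1 addr0.
have [->|n0] := posnP n; first by rewrite big_ord0.
have nR : 0 < n%:R :> R by rewrite ltr0n.
have -> : \sum_(k < n) ln (n.+1%:R / k.+1%:R : R)
   = \sum_(k < n) (ln (n%:R / k.+1%:R) + ln (n.+1%:R / n%:R)).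
  apply: eq_bigr => k _; rewrite -lnM ?posrE ?divr_gt0 ?ltr0n //; congr ln.
  by field; rewrite !gt_eqF ?ltr0n.
rewrite big_split /= sumr_const card_ord -natr1; apply: lerD => //.
have := @ln_le_sub1 R (n.+1%:R / n%:R); rewrite divr_gt0 ?ltr0n // => /(_ isT) H.
have {}H : ln (n.+1%:R / n%:R) <= n%:R^-1 :> R.
  by apply: le_trans H _; rewrite -natr1 mulrDl divff ?gt_eqF // mul1r addrC addKr.
rewrite -[leLHS]mulr_natr natr1. apply: le_trans (ler_wpM2r (ltW nR) H) _.
by rewrite mulVf ?gt_eqF.
Qed.

(** Terms with [k >= n] vanish. *)
Lemma sum_lnp_ratio_le (n M : nat) : (n <= M)%N ->
  \sum_(k < M) lnp (n%:R / k.+1%:R) <= n%:R.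
Proof.
move=> nM; rewrite -(big_mkord xpredT (fun k => lnp (n%:R / k.+1%:R))).
rewrite (big_cat_nat (leq0n n) nM) //= [X in _ + X]big_nat_cond [X in _ + X]big1 ?addr0; last first.
  move=> k /andP[/andP[nk _] _]; apply: lnp_le1.
  by rewrite ler_pdivrMr ?ltr0n // mul1r ler_nat; exact: leqW.
rewrite big_mkord; apply: le_trans (sum_ln_ratio_le n); apply: ler_sum => k _.
by rewrite lnp_ge1 // ler_pdivlMr ?ltr0n // mul1r ler_nat.
Qed.

Lemma sum_distn_le (N : nat) (i : 'I_N) (g : nat -> R) : (forall k, 0 <= g k) ->
  \sum_(j < N) g `|i - j|%N <= g 0%N + 2 * \sum_(k < N) g k.+1.
Proof.
move=> g0.
have part m : (m <= N)%N -> \sum_(k < m) g k.+1 <= \sum_(k < N) g k.+1.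
  move=> mN; rewrite -!(big_mkord xpredT (fun k => g k.+1)) (big_cat_nat (leq0n m) mN) //=.
  by rewrite lerDl sumr_ge0.
rewrite -(big_mkord xpredT (fun j => g `|i - j|%N)).
rewrite (big_cat_nat (leq0n i) (ltnW (ltn_ord i))) /=.
rewrite [X in _ + X](big_ltn (ltn_ord i)) distnn.
have h1 : \sum_(0 <= j < i) g `|i - j|%N <= \sum_(k < N) g k.+1.
  apply: le_trans (part i (ltnW (ltn_ord i))).
  rewrite -(big_mkord xpredT (fun k => g k.+1)) [leRHS]big_nat_rev /= !big_nat.
  apply: ler_sum => j /andP[_ ji].
  by rewrite add0n subnSK // distnEl // ltnW.
have h2 : \sum_(i.+1 <= j < N) g `|i - j|%N <= \sum_(k < N) g k.+1.
  apply: le_trans (part (N - i.+1)%N (leq_subr _ _)).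
  rewrite -{1}(add0n i.+1) big_addn -(big_mkord xpredT (fun k => g k.+1)) !big_nat.
  apply: ler_sum => j _; rewrite distnEr ?leqW ?leq_addl //; last by rewrite addnS leqW // leq_addl.
  by rewrite addnS -addSn addnK.
lra.
Qed.

End HarmonicTypeSum.

(** * Sets where the modulus is very small *)

Section BadArc.
Context {R : realType}.

Lemma green_le_ln (rho x : R) (z zt : R[i]) : 0 < rho -> rho <= 1 -> modulus z <= rho ->
  modulus zt < rho -> 0 < x -> x <= modulus (z - zt) ->
  green rho z zt <= ln (2 / x).
Proof.
move=> r0 r1 zr ztr x0 xz.
have num0 : 0 < modulus ((rho ^+ 2)%:C%C - (zt^*)%C * z).
  by rewrite modulus_gt0; exact: green_num_neq0.
have num : modulus ((rho ^+ 2)%:C%C - (zt^*)%C * z) <= 2 * rho.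
  apply: le_trans (modulusB _ _) _.
  rewrite modulus_real ger0_norm ?sqr_ge0 // modulusM modulus_conj.
  by have := modulus_ge0 z; have := modulus_ge0 zt; nra.
rewrite /green lnM ?posrE ?invr_gt0 // lnV ?posrE //.
have h1 : ln (modulus ((rho ^+ 2)%:C%C - (zt^*)%C * z)) <= ln 2 + ln rho.
  by rewrite -lnM ?posrE // ler_ln ?posrE // mulr_gt0.
have h2 : ln x <= ln (modulus (z - zt)) by rewrite ler_ln ?posrE // (lt_le_trans x0).
lra.
Qed.

(** Points chosen in the cells [J] of a grid of mesh [l/N] keep a logarithmic
potential close to that of arc length: the cell at distance [k] contributes
[ln (N / (l k))], and [sum_k ln (n/k) <= n] absorbs the spread of the [k]. *)
Lemma green_sum_cells (rho r l al : R) (N n : nat) (J : {set 'I_N}) (ph : 'I_N -> R)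
    (i : 'I_N) (z : R[i]) :
  #|J| = n -> (0 < n)%N -> 1 / 2 <= r -> r < rho -> rho <= 1 -> 0 < l -> l <= 1 ->
  i \in J ->
  (forall j, j \in J -> al + l * j%:R / N%:R <= ph j <= al + l * j.+1%:R / N%:R) ->
  modulus z <= rho -> modulus (z - circle_point r (ph i)) = l / (16 * N%:R) ->
  (forall j, j \in J -> l / (16 * N%:R) <= modulus (z - circle_point r (ph j))) ->
  \sum_(j in J) green rho z (circle_point r (ph j))
    <= n%:R * (ln (32 * N%:R / (l * n%:R)) + 3).
Proof.
move=> Jn n0 r2 rrho rho1 l0 l1 iJ Hph zr zi zj.
have N0 : (0 < N)%N by exact: leq_ltn_trans (leq0n _) (ltn_ord i).
have NR : 0 < N%:R :> R by rewrite ltr0n.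
have nR : 0 < n%:R :> R by rewrite ltr0n.
set s := l / (16 * N%:R) in zi zj.
have s0 : 0 < s by rewrite divr_gt0 // mulr_gt0.
have sE : l / N%:R = 16 * s by rewrite /s; field; rewrite gt_eqF.
have r0 : 0 <= r by lra.
pose dst (j : 'I_N) : nat := `|i - j|%N.
have far j : j \in J -> (maxn 1%N (dst j))%:R * s <= modulus (z - circle_point r (ph j)).
  move=> jJ; have [k1|k2] := leqP (dst j) 1%N.
    by rewrite mul1r; exact: zj.
  have hp : ((dst j)%:R - 1) * (16 * s) <= `|ph i - ph j| <= 1.
    have := Hph i iJ; have := Hph j jJ; rewrite -sE -!natr1.
    set x := i%:R; set y := j%:R => /andP[a1 a2] /andP[b1 b2].
    have e1 : l * (y + 1) / N%:R = y * (l / N%:R) + l / N%:R by ring.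
    have e2 : l * (x + 1) / N%:R = x * (l / N%:R) + l / N%:R by ring.
    have e3 : l * y / N%:R = y * (l / N%:R) by ring.
    have e4 : l * x / N%:R = x * (l / N%:R) by ring.
    have mesh (m : 'I_N) : 0 <= m%:R * (l / N%:R) /\ m%:R * (l / N%:R) + l / N%:R <= l.
      have q0 : 0 < l / N%:R by rewrite divr_gt0.
      split; first by rewrite mulr_ge0 // ltW.
      have -> : m%:R * (l / N%:R) + l / N%:R = m.+1%:R * (l / N%:R) by rewrite -natr1; ring.
      rewrite mulrCA ler_piMr ?(ltW l0) // ler_pdivrMr // mul1r ler_nat; exact: ltn_ord.
    have [] := mesh i; have [] := mesh j; rewrite -/x -/y => m1 m2 m3 m4.
    apply/andP; split; last by rewrite ler_norml; lra.
    have -> : (dst j)%:R = `|x - y|.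
      by rewrite /dst /x /y natr_absz intr_norm rmorphB.
    have q0 : 0 < l / N%:R by rewrite divr_gt0.
    rewrite mulrBl mul1r.
    have [xy|xy] := leP 0 (x - y).
      rewrite (ger0_norm xy) mulrBl; apply: le_trans (ler_norm _); lra.
    rewrite (ltr0_norm xy) opprB mulrBl -normrN; apply: le_trans (ler_norm _); lra.
  have k2' : 2 <= (dst j)%:R :> R by rewrite (ler_nat R 2).
  set k := (dst j)%:R in k2' hp *.
  move: hp => /andP[h1 h2].
  have h3 := @circle_point_dist_ge R r (ph i) (ph j) r0.
  have h4 := modulus_distD (circle_point r (ph i)) (circle_point r (ph j)) z.
  rewrite (modulus_distC _ z) zi in h4.
  have h5 : r * `|ph i - ph j| / 2
     <= modulus (circle_point r (ph i) - circle_point r (ph j)) by apply: h3; lra.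
  have h6 : 1 / 2 * (k / 2 * (16 * s)) <= r * `|ph i - ph j|.
    apply: ler_pM => //; first by rewrite !mulr_ge0 //; lra.
    by apply: le_trans h1; apply: ler_wpM2r; lra.
  have h7 : 2 * s <= k * s by rewrite ler_wpM2r // ltW.
  lra.
have term j : j \in J -> green rho z (circle_point r (ph j))
    <= ln (32 * N%:R / (l * n%:R)) + lnp (n%:R / (maxn 1%N (dst j))%:R).
  move=> jJ; have m0 : 0 < (maxn 1%N (dst j))%:R :> R by rewrite ltr0n leq_max.
  apply: (@le_trans _ _ (ln (2 / ((maxn 1%N (dst j))%:R * s)))).
    apply: green_le_ln => //; first lra.
    - by rewrite modulus_circle_point.
    - by rewrite mulr_gt0.
    - exact: far.
  have -> : 2 / ((maxn 1%N (dst j))%:R * s) =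
      (32 * N%:R / (l * n%:R)) * (n%:R / (maxn 1%N (dst j))%:R).
    by rewrite /s; field; rewrite !gt_eqF.
  rewrite lnM ?posrE ?divr_gt0 ?mulr_gt0 // lerD2l.
  by apply: ln_le_lnp; rewrite divr_gt0.
apply: le_trans (ler_sum _ term) _.
rewrite big_split /= sumr_const Jn -[X in X + _]mulr_natl mulrDr lerD2l.
have nN : (n <= N)%N by rewrite -Jn -[leqRHS]card_ord max_card.
apply: (@le_trans _ _ (\sum_(j < N) lnp (n%:R / (maxn 1%N (dst j))%:R))).
  by rewrite big_mkcond /=; apply: ler_sum => j _; case: ifP => // _; exact: lnp_ge0.
apply: le_trans (sum_distn_le i (g := fun k => lnp (n%:R / (maxn 1%N k)%:R)) (fun k => lnp_ge0 _)) _.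
rewrite maxn0 divr1.
have h1 : lnp n%:R <= n%:R :> R.
  rewrite lnp_ge1 ?ler1n //; have := ln_le_sub1 nR; lra.
have h2 : \sum_(k < N) lnp (n%:R / (maxn 1%N k.+1)%:R) <= n%:R :> R.
  rewrite (eq_bigr (fun k : 'I_N => lnp (n%:R / k.+1%:R))); first exact: sum_lnp_ratio_le.
  by move=> k _; rewrite (maxn_idPr (ltn0Sn _)).
lra.
Qed.

Variable f : R[i] -> R[i].
Hypothesis fa : analytic_in_disc f.

(** One bad point per bad cell, with the truncation at [- t] varying by less than
[1] within [l / (16 N)] of each of them, is fed into [two_constants]; the
potential [Gam = ln (32 N / (l n)) + 3] then has to be at least the exponent on
the right, which bounds the number [n] of bad cells. *)
Lemma bad_cells (d d' A V l al t : R) :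
  0 < d -> d <= 1 / 4 -> 2 * d <= d' -> d' <= 1 -> 1 <= A -> 0 <= V ->
  good_points f (1 - d') A ->
  (forall z, modulus z = 1 - d -> modulus (f z) <= expR V) ->
  0 < l -> l <= d' -> A + 1 < t ->
  exists2 N : nat, (0 < N)%N & forall J : {set 'I_N},
   (forall j, j \in J -> exists2 ph,
      al + l * j%:R / N%:R <= ph <= al + l * j.+1%:R / N%:R &
      modulus (f (circle_point (1 - 2 * d) ph)) <= expR (- t)) ->
   #|J|%:R * (l / N%:R) <= 32 * expR 3 * expR (- ((t - 1) / (25 * (d' / d) * (A + V)))).
Proof.
move=> d0 d4 dd' d'1 A1 V0 HA HV l0 ld' tA.
have rho1 : 1 - d < 1 by lra.
have [h h0 Hh] := unif_cont_disc rho1 (fun z => @cont_at_logmod _ f fa t z) ltr01.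
have [N N0 HN] : exists2 N : nat, (0 < N)%N & N%:R^-1 < h.
  have [M _ HM] := near_infty_natSinv_lt (PosNum h0).
  by exists M.+1 => //; apply: (HM M (leqnn M)).
exists N => // J HJ.
set tau := (t - 1) / _.
have [->|J0] := eqVneq J finset.set0.
  by rewrite finset.cards0 mul0r mulr_ge0 ?expR_ge0 // mulr_ge0 ?expR_ge0.
have n0 : (0 < #|J|)%N by rewrite finset.card_gt0.
set n := #|J| in n0 *.
have NR : 0 < N%:R :> R by rewrite ltr0n.
have nR : 0 < n%:R :> R by rewrite ltr0n.
have d'0 : 0 < d' by lra.
have [ph Hph] : exists ph : 'I_N -> R, forall j, j \in J ->
    (al + l * j%:R / N%:R <= ph j <= al + l * j.+1%:R / N%:R) /\
    modulus (f (circle_point (1 - 2 * d) (ph j))) <= expR (- t).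
  have : forall j, exists x, j \in J ->
    (al + l * j%:R / N%:R <= x <= al + l * j.+1%:R / N%:R) /\
    modulus (f (circle_point (1 - 2 * d) x)) <= expR (- t).
    move=> j; have [jJ|jJ] := boolP (j \in J); last by exists 0.
    by have [x ? ?] := HJ j jJ; exists x.
  by move=> /choice[ph Hph]; exists ph.
have [w wd' wA] := HA al.
pose zt (k : 'I_n) : R[i] := circle_point (1 - 2 * d) (ph (enum_val k)).
have eJ (k : 'I_n) : enum_val k \in J by exact: enum_valP.
have ztE k : modulus (zt k) = 1 - 2 * d by rewrite modulus_circle_point; lra.
have bigE (F : 'I_N -> R) : \sum_(j in J) F j = \sum_(k < n) F (enum_val k).
  by rewrite big_enum_val.
set s := l / (16 * N%:R).
have s0 : 0 < s by rewrite divr_gt0 // mulr_gt0.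
have sh : s < h.
  apply: le_lt_trans HN; rewrite /s invfM mulrA ler_piMl ?invr_ge0 ?ler0n //; lra.
have us k z : modulus (z - zt k) <= s -> logmod f t z <= - (t - 1).
  move=> zs; have := Hh (zt k) z; rewrite ztE => H.
  have {}H : `|logmod f t z - logmod f t (zt k)| < 1.
    by apply: H; [lra|exact: le_lt_trans sh].
  have : logmod f t (zt k) <= - t by apply: logmod_le => //; have [] := Hph _ (eJ k).
  by move: H; rewrite ltr_norml; lra.
have uw : - A <= logmod f t w by exact: logmod_ge.
have ws k : s <= modulus (w - zt k).
  by rewrite leNgt; apply/negP => /ltW/us; lra.
have green_w k : modulus w <= 1 - d /\ 1 / 25 * (d / d') <= green (1 - d) w (zt k).
  apply: (@green_lower _ d d' al) => //.
  - by have -> : d' / 10 = (1 - (1 - d')) / 10 by ring.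
  - have r0 : 0 <= 1 - 2 * d by lra.
    apply: le_trans (circle_point_dist_le _ _ r0) _.
    have [/andP[p1 p2] _] := Hph _ (eJ k).
    set j := enum_val k in p1 p2 *.
    have h1 : 0 <= l * j%:R / N%:R by rewrite divr_ge0 // mulr_ge0 // ltW.
    have h2 : l * j.+1%:R / N%:R <= l.
      rewrite -mulrA ler_piMr ?(ltW l0) // ler_pdivrMr // mul1r ler_nat; exact: ltn_ord.
    have : `|ph j - al| <= d' by rewrite ler_norml; lra.
    have := normr_ge0 (ph j - al); nra.
  - by apply: contraTneq (ws k) => ->; rewrite subrr modulus0 -ltNge.
have wr : modulus w <= 1 - d by have [] := green_w (Ordinal n0).
set X := 32 * N%:R / (l * n%:R).
have nN : n%:R <= N%:R :> R by rewrite ler_nat /n -[leqRHS]card_ord max_card.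
have X1 : 1 <= X.
  rewrite /X ler_pdivlMr ?mulr_gt0 // mul1r; have : l * n%:R <= 1 * N%:R.
    by apply: ler_pM => //; [exact: ltW|lra].
  by lra.
have G0 : 0 < ln X + 3 by have := ln_ge0 X1; lra.
have tV : 0 <= t - 1 + V by lra.
have [r2 rrho] : 1 / 2 <= 1 - 2 * d /\ 1 - 2 * d < 1 - d by clear - d0 d4; split; lra.
have rho1' : 1 - d <= 1 := ltW rho1.
have l1 : l <= 1 := le_trans ld' d'1.
have tw : logmod f t w <= V - (t - 1 + V) / (n%:R * (ln X + 3)) * \sum_(k < n) green (1 - d) w (zt k).
  apply: (@two_constants _ (1 - d) n zt s) => //.
  - lra.
  - by move=> k; rewrite ztE; lra.
  - by move=> z z1; split; [exact: cont_at_logmod|exact: subharm_logmod].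
  - by move=> z /HV; apply: logmod_le; lra.
  - by move=> k z _ zs; apply: (us k); rewrite zs.
  - move=> k z zr zk zs.
    rewrite -(bigE (fun j => green (1 - d) z (circle_point (1 - 2 * d) (ph j)))).
    apply: (@green_sum_cells (1 - d) (1 - 2 * d) l al N n J ph (enum_val k)) => //.
    - by move=> j /Hph[].
    - move=> j jJ; have := zs (enum_rank_in jJ j).
      by rewrite /zt enum_rankK_in.
have gsum : n%:R * (1 / 25 * (d / d')) <= \sum_(k < n) green (1 - d) w (zt k).
  rewrite mulr_natl -[X in _ *+ X]card_ord -sumr_const.
  by apply: ler_sum => k _; have [] := green_w k.
have key : (t - 1 + V) / (n%:R * (ln X + 3)) * (n%:R * (1 / 25 * (d / d'))) <= A + V.
  apply: (@le_trans _ _ ((t - 1 + V) / (n%:R * (ln X + 3)) * \sum_(k < n) green (1 - d) w (zt k))).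
    by apply: ler_wpM2l gsum; rewrite divr_ge0 // mulr_ge0 // ltW.
  by lra.
have AV : 0 < A + V by rewrite ltr_wpDr // (lt_le_trans ltr01).
have dd0 : 0 < d' / d by rewrite divr_gt0.
have key2 : tau <= ln X + 3.
  rewrite /tau ler_pdivrMr; last by rewrite mulr_gt0 // mulr_gt0.
  have -> : (ln X + 3) * (25 * (d' / d) * (A + V)) = (25 * (d' / d) * (ln X + 3)) * (A + V) by ring.
  have c0 : 0 <= 25 * (d' / d) * (ln X + 3).
    by apply: mulr_ge0; [apply: mulr_ge0 => //; exact: ltW|exact: ltW].
  apply: le_trans (ler_wpM2l c0 key).
  have -> : 25 * (d' / d) * (ln X + 3) * ((t - 1 + V) / (n%:R * (ln X + 3)) * (n%:R * (1 / 25 * (d / d'))))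
     = t - 1 + V by field; rewrite !gt_eqF.
  by rewrite lerDl.
have X0 : 0 < X := lt_le_trans ltr01 X1.
have -> : n%:R * (l / N%:R) = 32 * X^-1.
  by rewrite /X; field; rewrite !gt_eqF.
rewrite -mulrA ler_wpM2l // -expRD -[X in X^-1]lnK ?posrE // -expRN ler_expR.
by clear - key2; lra.
Qed.

End BadArc.

(** * Layer-cake integration of exponential tails *)

Section LayerCake.
Context {R : realType}.

Lemma powR_succ_le_exp2 (p : R) : 0 <= p ->
  exists2 c : R, 0 < c & forall k, k.+1%:R `^ p <= c * 2 ^+ k.
Proof.
move=> p0; have l2 : 0 < ln 2 :> R by rewrite ln_gt0 // ltr1n.
pose e := ln 2 / (p + 1) : R.
have e0 : 0 < e by rewrite divr_gt0 // ltr_pwDr.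
exists (2 * expR (p * `|ln e|)); first by rewrite mulr_gt0 // expR_gt0.
move=> k; have k0 : 0 < k.+1%:R :> R by rewrite ltr0n.
rewrite /powR (gt_eqF k0).
have -> : 2 * expR (p * `|ln e|) * 2 ^+ k = expR (k.+1%:R * ln 2 + p * `|ln e|).
  rewrite expRD mulrC mulrA -exprSr; congr (_ * _).
  by rewrite -[X in X ^+ _](@lnK R 2) ?posrE // -expRM_natl -mulr_natl.
rewrite ler_expR.
have h1 : ln k.+1%:R <= k.+1%:R * e + `|ln e|.
  have := @ln_le_sub1 R (k.+1%:R * e); rewrite mulr_gt0 // lnM ?posrE // => /(_ isT).
  by have := ler_norm (- ln e); rewrite normrN; lra.
have h2 : p * e <= ln 2.
  by rewrite /e mulrA ler_pdivrMr ?ltr_pwDr // mulrC ler_wpM2l ?(ltW l2) // lerDl.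
have h3 : k.+1%:R * (p * e) <= k.+1%:R * ln 2 by rewrite ler_wpM2l // ltW.
have := ler_wpM2l p0 h1; lra.
Qed.

Lemma measurable_abs_lne_powR d (T : measurableType d) (D : set T) (g : T -> R) (p : R) :
  measurable_fun D g ->
  measurable_fun D ((fun x => `|lne (g x)%:E| `^ p)%E : T -> \bar R).
Proof.
move=> mg; apply: (@measurableT_comp _ _ _ _ _ _ (fun y : \bar R => y `^ p)%E).
  exact: measurable_poweR.
apply: (@measurableT_comp _ _ _ _ _ _ (fun y : \bar R => `|y|)%E).
  exact: measurable_realfun.abse_measurable.
apply: (@measurableT_comp _ _ _ _ _ _ (fun y : R => lne y%:E)) mg.
rewrite /lne; apply: measurable_fun_ifT.
- exact: measurable_fun_ler.
- exact: measurable_cst.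
- by apply/measurable_EFinP; exact: measurable_realfun.measurable_ln.
Qed.

Lemma nneseries_le_cst (u : nat -> \bar R) (B : \bar R) :
  (forall k, 0 <= u k)%E -> (forall n, \sum_(0 <= k < n) u k <= B)%E ->
  (\sum_(0 <= k <oo) u k <= B)%E.
Proof.
move=> u0 uB; apply: lime_le; first by apply: is_cvg_nneseries => n _ _; exact: u0.
by apply: nearW.
Qed.

(** At level [k] the integrand is at most [((k+1) T)^p] on a set of measure at most
[4^-k], and [(k+1)^p = O(2^k)].  The set where [g] vanishes, and the integrand is
infinite, lies in all levels. *)
Lemma layer_integral (p : R) : 1 <= p -> exists2 Cp : R, 0 < Cp &
  forall d (X : measurableType d) (mu : {measure set X -> \bar R}) (D : set X)
    (g : X -> R) (T c : R),
  measurable D -> measurable_fun D g -> (forall x, D x -> 0 <= g x) ->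
  0 < T -> 1 <= c -> (mu D <= c%:E)%E ->
  (forall x, D x -> g x <= expR T) ->
  (forall k : nat, (mu (D `&` [set x | (g x <= expR (- (k.+1%:R * T)))%R])
      <= ((4 ^+ k.+1)^-1)%:E)%E) ->
  (\int[mu]_(x in D) (`|lne (g x)%:E| `^ p) <= (Cp * c * T `^ p)%:E)%E.
Proof.
move=> p1; have p0 : 0 <= p by lra.
have [cp cp0 Hcp] := powR_succ_le_exp2 p0.
exists (2 * cp); first by rewrite mulr_gt0.
move=> d X mu D g T c mD mg g0 T0 c1 muD gT Hk.
have Tp0 : 0 < T `^ p by rewrite powR_gt0.
pose E (k : nat) : set X := if k is k'.+1 then D `&` [set x | g x <= expR (- (k%:R * T))] else D.
have mE k : measurable (E k).
  case: k => // k; rewrite /E.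
  have -> : D `&` [set x | g x <= expR (- (k.+1%:R * T))] =
     D `&` g @^-1` [set` `]-oo, expR (- (k.+1%:R * T))]].
    by apply/seteqP; split => x /=; rewrite in_itv.
  exact: mg.
have ED k : E k `<=` D by case: k => [|k] x //= [].
have muE k : (mu (E k) <= (c * ((4 : R) ^+ k)^-1)%:E)%E.
  case: k => [|k]; first by rewrite expr0 invr1 mulr1.
  apply: le_trans (Hk k) _; rewrite lee_fin ler_peMl // invr_ge0 exprn_ge0 //.
pose F (k : nat) (x : X) : \bar R := ((k.+1%:R * T) `^ p * \1_(E k) x)%:E.
have F0 k x : (0 <= F k x)%E by rewrite lee_fin mulr_ge0 ?powR_ge0.
have F1 k x : E k x -> F k x = ((k.+1%:R * T) `^ p)%:E.
  by move=> Ex; rewrite /F indicE mem_set // mulr1.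
have FT k x : E k x -> ((T `^ p)%:E <= F k x)%E.
  move=> Ex; rewrite F1 // lee_fin ge0_ler_powR ?nnegrE ?(ltW T0) //.
    by rewrite mulr_ge0 // ltW.
  by rewrite ler_peMl ?(ltW T0) // ler1n.
have mF k : measurable_fun D (F k).
  apply/measurable_EFinP; apply: measurable_funM; first exact: measurable_cst.
  by apply: measurable_indic; exact: mE.
have Fge k x : (F k x <= \sum_(0 <= j <oo) F j x)%E.
  apply: le_trans (nneseries_lim_ge k.+1 _); last by move=> j _ _; exact: F0.
  by rewrite big_nat_recr //= leeDr // sume_ge0.
have pw x : D x -> (`|lne (g x)%:E| `^ p <= \sum_(0 <= j <oo) F j x)%E.
  move=> Dx; have := g0 _ Dx; rewrite le_eqVlt => /predU1P[gx|gx].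
    have Ex k : E k x.
      by case: k => [//|k]; split => //=; rewrite -gx expR_ge0.
    suff -> : (\sum_(0 <= j <oo) F j x = +oo)%E by rewrite leey.
    apply/eqyP => A A0.
    pose n := (Num.trunc (A / T `^ p)).+1.
    apply: (@le_trans _ _ (\sum_(0 <= j < n) F j x)%E); last first.
      by apply: nneseries_lim_ge => j _ _; exact: F0.
    apply: (@le_trans _ _ (\sum_(0 <= j < n) (T `^ p)%:E)%E); last first.
      by apply: lee_sum => j _; exact: FT.
    rewrite sumEFin lee_fin sumr_const_nat subn0 -mulr_natl -ler_pdivrMr //.
    by have /andP[_ /ltW] := truncn_itv (divr_ge0 (ltW A0) (ltW Tp0)).
  rewrite lne_EFin // abse_EFin poweR_EFin.
  set L := `|ln (g x)|.
  have lT : ln (g x) <= T by rewrite -(expRK T) ler_ln ?posrE ?expR_gt0 // gT.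
  have bound k : L <= k.+1%:R * T -> E k x -> ((L `^ p)%:E <= \sum_(0 <= j <oo) F j x)%E.
    move=> Lk Ex; apply: le_trans (Fge k x); rewrite F1 // lee_fin.
    by rewrite ge0_ler_powR ?nnegrE ?normr_ge0 // mulr_ge0 // ltW.
  have [LT|LT] := leP L T; first by apply: (bound 0%N) => //; rewrite mul1r.
  have lneg : ln (g x) = - L.
    by rewrite /L; case: (ler0P (ln (g x))) LT => h; [rewrite opprK|rewrite /L gtr0_norm // ltNge lT].
  have /andP[h1 h2] := truncn_itv (divr_ge0 (normr_ge0 (ln (g x))) (ltW T0)).
  set m := Num.trunc _ in h1 h2; rewrite -/L in h1 h2.
  rewrite ler_pdivlMr // in h1; rewrite ltr_pdivrMr // in h2.
  apply: (bound m); first exact: ltW.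
  move: h1; case: m {h2} => [//|m] h1; split => //=.
  by rewrite -[leLHS]lnK ?posrE // ler_expR lneg lerN2.
apply: le_trans (ge0_le_integral _ _ _ _ _ pw) _ => //.
- by move=> x _; exact: poweR_ge0.
- exact: measurable_abs_lne_powR.
- by apply: ge0_emeasurable_sum => // k x _ _; exact: F0.
rewrite integral_nneseries //.
apply: nneseries_le_cst => [k|n]; first by apply: integral_ge0 => x _; exact: F0.
have term k : (\int[mu]_(x in D) F k x <= (c * cp * T `^ p * (1 / 2) ^+ k)%:E)%E.
  have := @integralZl_indic _ _ _ mu D mD (fun=> E k) ((k.+1%:R * T) `^ p).
  move=> /(_ _ (mE k)) -> //; last first.
    by move=> h; have := powR_ge0 (k.+1%:R * T) p; rewrite leNgt h.
  rewrite integral_indic // setIidl; last exact: ED.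
  apply: (@le_trans _ _ (((k.+1%:R * T) `^ p)%:E * (c * ((4 : R) ^+ k)^-1)%:E)%E).
    by apply: lee_wpmul2l; [rewrite lee_fin powR_ge0|exact: muE].
  rewrite -EFinM lee_fin powRM ?ler0n ?(ltW T0) //.
  have -> : c * cp * T `^ p * (1 / 2) ^+ k = (cp * 2 ^+ k) * (T `^ p * (c * (4 ^+ k)^-1)).
    have -> : (4 : R) ^+ k = 2 ^+ k * 2 ^+ k by rewrite -exprMn; congr (_ ^+ _); ring.
    rewrite expr_div_n expr1n.
    by field; rewrite expf_neq0.
  rewrite -[leLHS]mulrA; apply: ler_wpM2r => //.
  by rewrite mulr_ge0 ?(ltW Tp0) // mulr_ge0 ?invr_ge0 ?exprn_ge0 //; lra.
apply: le_trans (lee_sum _ (fun k _ => term k)) _.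
rewrite sumEFin lee_fin -mulr_sumr big_mkord.
have hs : \sum_(k < n) (1 / 2 : R) ^+ k <= 2.
  have h0 : 0 <= 1 / 2 :> R by lra.
  have := sum_geometric_le n h0 (lexx _).
  have : 0 <= (1 / 2 : R) ^+ n by rewrite exprn_ge0.
  lra.
have -> : 2 * cp * c * T `^ p = c * cp * T `^ p * 2 by ring.
apply: ler_wpM2l hs; rewrite mulr_ge0 ?(ltW Tp0) // mulr_ge0 ?(ltW cp0) //; lra.
Qed.

End LayerCake.

(** * Powers, lower sums and measures on the circle *)

Section PositivePower.
Context {R : realType}.
Variable p : R.
Hypothesis p1 : 1 <= p.

(** Extended by [0] to negative arguments, the power has supporting lines on the
whole real line. *)
Definition pospow (y : R) : R := (Num.max 0 y) `^ p.

(** For [y >= 0] this is Young's inequality applied to [y * x^(p-1)]. *)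
Lemma pospow_tangent (x : R) : 0 <= x -> exists2 m, 0 <= m &
  forall y, pospow x + m * (y - x) <= pospow y.
Proof.
move=> x0; have p0 : 0 < p by exact: lt_le_trans p1.
exists (p * x `^ (p - 1)); first by rewrite mulr_ge0 ?powR_ge0 // ltW.
have pos y : 0 <= y -> x `^ p + p * x `^ (p - 1) * (y - x) <= y `^ p.
  move=> y0.
  have xp : x * x `^ (p - 1) = x `^ p by exact: mulr_powRB1.
  have [p1'|p1'] := eqVneq p 1.
    by rewrite p1' subrr powRr0 !powRr1 //; lra.
  have pp : 0 < p - 1 by rewrite subr_gt0 lt_neqAle eq_sym p1'.
  pose q := p / (p - 1).
  have q0 : 0 < q by rewrite divr_gt0.
  have pq : p^-1 + q^-1 = 1 by rewrite /q; field; rewrite (gt_eqF pp) (gt_eqF p0).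
  have := conjugate_powR y0 (powR_ge0 x (p - 1)) p0 q0 pq.
  rewrite -powRrM.
  have -> : (p - 1) * q = p by rewrite /q; field; rewrite gt_eqF.
  have -> : x `^ p / q = x `^ p * ((p - 1) / p) by rewrite /q invf_div.
  move=> /(ler_wpM2l (ltW p0)).
  have -> : p * (y `^ p / p + x `^ p * ((p - 1) / p)) = y `^ p + x `^ p * (p - 1).
    by field; rewrite gt_eqF.
  by rewrite -xp; lra.
move=> y; rewrite /pospow (max_r x0).
have [y0|y0] := leP 0 y; first exact: pos.
apply: le_trans (pos 0 (lexx _)).
rewrite lerD2l ler_wpM2l ?mulr_ge0 ?powR_ge0 //; lra.
Qed.

Lemma continuous_pospow : continuous pospow.
Proof.
move=> x; have p0 : 0 < p by exact: lt_le_trans p1.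
have [x0|x0] := leP x 0.
  have gx : pospow x = 0 by rewrite /pospow max_l // powR0 // gt_eqF.
  apply/cvgrPdist_lt => e e0.
  have d0 : 0 < Num.min e 1 by rewrite lt_min e0 ltr01.
  apply: filterS (nbhsx_ballx x _ d0) => y; rewrite -ball_normE /= lt_min => /andP[ye y1].
  rewrite gx sub0r normrN /pospow.
  have m0 : 0 <= Num.max 0 y by rewrite le_max lexx.
  have my : Num.max 0 y <= `|x - y|.
    by rewrite ge_max normr_ge0 /= distrC; apply: le_trans (ler_norm _); lra.
  rewrite ger0_norm ?powR_ge0 //; apply: le_lt_trans ye.
  apply: le_trans (my); have [->|mp] := eqVneq (Num.max 0 y) 0.
    by rewrite powR0 // gt_eqF.
  apply: ge1r_powR => //; rewrite lt_neqAle eq_sym mp m0 /=.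
  by apply: le_trans my _; exact: ltW.
apply: (@cvg_trans _ ((fun y => y `^ p) @ x)).
  apply: near_eq_cvg; near=> y.
  rewrite /pospow max_r //; apply: ltW; near: y; exact: lt_nbhsr.
rewrite /pospow (max_r (ltW x0)).
have : derivable (@powR R ^~ p) x 1 by apply: derivable_powR; rewrite in_itv /= andbT.
by move/derivable1_diffP => /differentiable_continuous.
Unshelve. all: by end_near. Qed.

End PositivePower.

Section CircleIntegrals.
Context {R : realType}.
Local Notation mu := (@lebesgue_measure R).

Lemma measure_itvcc (a b : R) : a <= b -> mu `[a, b] = (b - a)%:E.
Proof.
rewrite le_eqVlt => /predU1P[->|ab].
  by rewrite lebesgue_measure_itv /= lte_fin ltxx subrr.
by rewrite lebesgue_measure_itv /= lte_fin ab EFinB.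
Qed.

Lemma lower_sum_le_integral (F : R -> \bar R) (L : R) (N : nat) (m : 'I_N -> R) :
  (0 < N)%N -> 0 < L -> measurable_fun `[0, L] F -> (forall x, 0 <= F x)%E ->
  (forall j, 0 <= m j) ->
  (forall (j : 'I_N) x, L * j%:R / N%:R <= x <= L * j.+1%:R / N%:R -> ((m j)%:E <= F x)%E) ->
  ((L / N%:R * \sum_j m j)%:E <= \int[mu]_(x in `[0%R, L]) F x)%E.
Proof.
move=> N0 L0 mF F0 m0 mle.
have NR : 0 < N%:R :> R by rewrite ltr0n.
have q0 : 0 < L / N%:R by rewrite divr_gt0.
pose a (j : nat) : R := L * j%:R / N%:R.
have aE j : a j = L / N%:R * j%:R by rewrite /a mulrAC.
have aS j : a j.+1 = a j + L / N%:R by rewrite !aE -natr1 mulrDr mulr1.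
have a_le (i j : nat) : (i <= j)%N -> a i <= a j.
  by move=> ij; rewrite !aE ler_wpM2l ?(ltW q0) // ler_nat.
pose I (j : 'I_N) : set R := `[a j, a j.+1[%classic.
pose G (j : 'I_N) (x : R) : \bar R := (m j * \1_(I j) x)%:E.
have mI j : measurable (I j) by exact: measurable_itv.
have G0 j x : (0 <= G j x)%E by rewrite lee_fin mulr_ge0.
have mG j : measurable_fun `[0, L] (G j).
  apply/measurable_EFinP; apply: measurable_funM; first exact: measurable_cst.
  exact: measurable_indic.
have Gle x : (\sum_j G j x <= F x)%E.
  have [[j xj]|H] := pselect (exists j, I j x); last first.
    rewrite big1 // => j _; rewrite /G indicE memNset ?mulr0 // => xj.
    by apply: H; exists j.
  rewrite (bigD1 j) //= big1 ?adde0.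
    rewrite /G indicE mem_set // mulr1; apply: mle.
    by move: xj; rewrite /I /= in_itv /= => /andP[-> /ltW].
  move=> k kj; rewrite /G indicE memNset ?mulr0 // => xk.
  move: xj xk; rewrite /I /= !in_itv /= => /andP[j1 j2] /andP[k1 k2].
  have [jk|jk|jk] := ltngtP j k.
  - by have := a_le _ _ jk; lra.
  - by have := a_le _ _ jk; lra.
  - by move/val_inj: jk kj => ->; rewrite eqxx.
have mD : measurable (`[0, L]%classic : set R) by exact: measurable_itv.
apply: le_trans (ge0_le_integral mu mD _ _ mF (fun x _ => Gle x)); last 2 first.
- by move=> x _; apply: sume_ge0.
- exact: emeasurable_sum.
rewrite ge0_integral_sum //.
have -> : L / N%:R * \sum_j m j = \sum_j m j * (L / N%:R).
  by rewrite mulr_sumr; apply: eq_bigr => j _; rewrite mulrC.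
rewrite -sumEFin; apply: lee_sum => j _.
have := @integralZl_indic _ _ _ mu _ mD (fun=> I j) (m j).
move=> /(_ _ (mI j)) -> //; last by move=> h; have := m0 j; rewrite leNgt h.
rewrite integral_indic //; last exact: mI.
rewrite setIidl; last first.
  move=> x; rewrite /I /= !in_itv /= => /andP[x1 x2].
  have := a_le _ _ (leq0n j); have := a_le _ _ (ltn_ord j).
  have -> : a 0%N = 0 by rewrite aE mulr0.
  have -> : a N = L by rewrite aE divfK // gt_eqF.
  lra.
suff : ((m j * (L / N%:R))%:E <= (m j)%:E * mu (I j))%E by [].
have -> : mu (I j) = (L / N%:R)%:E.
  rewrite /I lebesgue_measure_itv /= lte_fin aS ltrDl q0.
  by rewrite -EFinB addrAC subrr add0r.
by rewrite -EFinM.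
Qed.

Lemma measure_cover (N : nat) (E : set R) (P : nat -> bool) (a q : R) :
  0 < q -> measurable E ->
  (forall x, E x -> exists2 j : 'I_N, P j & a + q * j%:R <= x <= a + q * j.+1%:R) ->
  (mu E <= ((\sum_(j < N) P j)%:R * q)%:E)%E.
Proof.
move=> q0 mE HE.
pose G (j : nat) : set R := if P j then `[a + q * j%:R, a + q * j.+1%:R]%classic else set0.
have mG j : measurable (G j) by rewrite /G; case: ifP => _; [exact: measurable_itv|exact: measurable0].
have mU : measurable (\big[setU/set0]_(j < N) G j) by apply: bigsetU_measurable.
have EU : E `<=` \big[setU/set0]_(j < N) G j.
  move=> x /HE[j Pj xj]; rewrite -bigcup_mkord; exists j => //=.
  by rewrite /G Pj /= in_itv.
apply: le_trans (le_measure mu (mem_set mE) (mem_set mU) EU) _.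
apply: le_trans (@Boole_inequality _ _ _ mu G N (fun j _ => mG j)) _.
rewrite natr_sum mulr_suml -sumEFin; apply: lee_sum => j _.
rewrite /G; case: (P j) => /=; last by rewrite measure0 mul0r.
rewrite measure_itvcc; first by rewrite mul1r lee_fin -natr1; lra.
by rewrite lerD2l ler_wpM2l ?(ltW q0) // ler_nat.
Qed.

Variable f : R[i] -> R[i].
Hypothesis fa : analytic_in_disc f.

Lemma continuous_circle (u : R[i] -> R) (r : R) : 0 <= r -> r < 1 ->
  (forall z, modulus z < 1 -> cont_at u z) ->
  continuous (fun t : R => u (circle_point r t)).
Proof.
move=> r0 r1 uc x; apply/cvgrPdist_lt => e e0.
have x1 : modulus (circle_point r x) < 1 by rewrite modulus_circle_point.
have [h h0 Hh] := uc _ x1 e e0.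
apply: filterS (nbhsx_ballx x _ h0) => y; rewrite -ball_normE /= => xy.
rewrite distrC; apply: Hh; apply: le_lt_trans (circle_point_dist_le _ _ r0) _.
by rewrite distrC; have := normr_ge0 (x - y); nra.
Qed.

Lemma measurable_circle (r : R) (D : set R) : 0 <= r -> r < 1 ->
  measurable_fun D (fun t : R => modulus (f (circle_point r t))).
Proof.
move=> r0 r1; apply: (@measurable_funS _ _ _ _ setT) => //.
apply: continuous_measurable_fun.
by apply: (@continuous_circle (fun z => modulus (f z))) => // z; exact: cont_at_modulus_f.
Qed.

(** A comparison with no poles at all. *)
Lemma max_modulus (rho V : R) : rho < 1 ->
  (forall z, modulus z = rho -> modulus (f z) <= expR V) ->
  forall z, modulus z <= rho -> modulus (f z) <= expR V.
Proof.
move=> rho1 HV z0 z0r.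
have [zr|zr] := eqVneq (modulus z0) rho; first exact: HV.
have rho0 : 0 < rho.
  apply: (@le_lt_trans _ _ (modulus z0)); first exact: modulus_ge0.
  by rewrite lt_neqAle zr.
have : logmod f (- V) z0 <= V + \sum_(j < 0) 0 * green rho z0 (0 : R[i]).
  apply: (@green_comparison _ rho 0 (fun=> 0) (fun=> 0) V [set z | modulus z <= rho]) => //.
  - exact: ltW.
  - by case.
  - by move=> z; exact: disc_closed.
  - by move=> z [].
  - by move=> z /= h; apply: cont_at_logmod => //; lra.
  move=> z /= h; have [ze|zn] := eqVneq (modulus z) rho.
    left; rewrite big_ord0 addr0; apply: logmod_le; first by rewrite opprK.
    exact: HV.
  right; split; first by apply: subharm_logmod => //; lra.
  exists (rho - modulus z); first by rewrite subr_gt0 lt_neqAle zn.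
  by move=> z' zz'; have := modulus_sub_ge z' z; lra.
rewrite big_ord0 addr0 => H.
have [fz|fz] := eqVneq (f z0) 0; first by rewrite fz modulus0 expR_ge0.
rewrite -[leLHS]lnK ?posrE ?modulus_gt0 // ler_expR; apply: le_trans H.
by apply: logmod_ge; rewrite lnK // posrE modulus_gt0.
Qed.

End CircleIntegrals.

(** * The logarithmic means on circles *)

Section CircleMeans.
Context {R : realType}.
Local Notation mu := (@lebesgue_measure R).
Variable f : R[i] -> R[i].
Hypothesis fa : analytic_in_disc f.

Lemma bad_arc_measure (d d' A V l al t : R) :
  0 < d -> d <= 1 / 4 -> 2 * d <= d' -> d' <= 1 -> 1 <= A -> 0 <= V ->
  good_points f (1 - d') A ->
  (forall z, modulus z = 1 - d -> modulus (f z) <= expR V) ->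
  0 < l -> l <= d' -> A + 1 < t ->
  (mu (`[al, (al + l)%R] `&`
     [set x | (modulus (f (circle_point (1 - 2 * d) x)) <= expR (- t))%R])
   <= (32 * expR 3 * expR (- ((t - 1) / (25 * (d' / d) * (A + V)))))%:E)%E.
Proof.
move=> d0 d4 dd' d'1 A1 V0 HA HV l0 ld' tA.
have [N N0 HN] := bad_cells fa al d0 d4 dd' d'1 A1 V0 HA HV l0 ld' tA.
have NR : 0 < N%:R :> R by rewrite ltr0n.
have q0 : 0 < l / N%:R by rewrite divr_gt0.
pose bad (x : R) := modulus (f (circle_point (1 - 2 * d) x)) <= expR (- t).
pose P (j : nat) : bool := `[< exists2 x, al + l * j%:R / N%:R <= x <= al + l * j.+1%:R / N%:R & bad x >].
set E := (X in mu X).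
have mE : measurable E.
  have -> : E = `[al, (al + l)%R] `&`
     (fun x => modulus (f (circle_point (1 - 2 * d) x))) @^-1` [set` `]-oo, expR (- t)]].
    by apply/seteqP; split => x /=; rewrite !in_itv.
  have r0 : 0 <= 1 - 2 * d by lra.
  have r1 : 1 - 2 * d < 1 by lra.
  by apply: (@measurable_circle _ _ fa _ `[al, (al + l)%R] r0 r1); exact: measurable_itv.
apply: (@le_trans _ _ (((\sum_(j < N) P j)%:R * (l / N%:R))%:E)).
  apply: (@measure_cover _ N E P al (l / N%:R) q0 mE) => x [].
  rewrite /= in_itv /= => /andP[x1 x2] bx.
  have [|j jx] := @grid_cell _ N ((x - al) / (l / N%:R)) N0.
    rewrite divr_ge0 ?(ltW q0) ?subr_ge0 //= ler_pdivrMr //.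
    by rewrite mulrCA divff ?gt_eqF // mulr1; lra.
  move: jx; rewrite ler_pdivlMr // ler_pdivrMr // => jx.
  have cellx : al + l / N%:R * j%:R <= x <= al + l / N%:R * j.+1%:R.
    by rewrite !(mulrC (l / N%:R)); lra.
  exists j => //; apply/asboolP; exists x => //.
  by rewrite (mulrAC l j%:R) (mulrAC l j.+1%:R).
rewrite lee_fin.
have -> : (\sum_(j < N) P j)%N = #|[set j : 'I_N | P j]%SET|.
  rewrite -sum1_card [RHS]big_mkcond /=; apply: eq_bigr => j _.
  by rewrite finset.in_set; case: (P j).
by apply: HN => j; rewrite finset.in_set => /asboolP.
Qed.

(** Each arc of length at most [d'] has its own good point; [O(1 / d')] arcs cover
the circle, and [2 d <= d'] turns this count into a factor [1 / d]. *)
Lemma bad_circle_measure (d d' A V t : R) :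
  0 < d -> d <= 1 / 4 -> 2 * d <= d' -> d' <= 1 -> 1 <= A -> 0 <= V ->
  good_points f (1 - d') A ->
  (forall z, modulus z = 1 - d -> modulus (f z) <= expR V) ->
  A + 1 < t ->
  (mu (`[0%R, (2 * pi)%R] `&`
     [set x | (modulus (f (circle_point (1 - 2 * d) x)) <= expR (- t))%R])
   <= (144 * expR 3 / d * expR (- ((t - 1) / (25 * (d' / d) * (A + V)))))%:E)%E.
Proof.
move=> d0 d4 dd' d'1 A1 V0 HA HV tA.
have d'0 : 0 < d' by lra.
have pi4 := @pi_lt4 R; have pi0 := pi_gt0 R.
have pd0 : 0 <= 2 * pi / d' by rewrite divr_ge0 ?mulr_ge0 // ltW.
have /andP[M1 M2] := truncn_itv pd0.
set M := (Num.trunc (2 * pi / d')).+1 in M2.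
have M0 : 0 < M%:R :> R by rewrite ltr0n.
have MR : M%:R <= 9 / (2 * d).
  apply: (@le_trans _ _ (9 / d')).
    rewrite /M -natr1; apply: (@le_trans _ _ (2 * pi / d' + 1)); first lra.
    have -> : 2 * pi / d' + 1 = (2 * pi + d') / d' by field; rewrite gt_eqF.
    by rewrite ler_wpM2r ?invr_ge0 ?(ltW d'0) //; lra.
  by rewrite ler_wpM2l // lef_pV2 ?posrE //; lra.
pose l : R := 2 * pi / M%:R.
have l0 : 0 < l by rewrite divr_gt0 // mulr_gt0.
have ld' : l <= d'.
  by rewrite /l ler_pdivrMr // (mulrC d'); move: M2; rewrite ltr_pdivrMr // => /ltW.
set e := expR (- ((t - 1) / _)).
set bad := [set x : R | _].
pose G (j : nat) : set R := `[l * j%:R, (l * j%:R + l)%R]%classic `&` bad.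
have r0 : 0 <= 1 - 2 * d by lra.
have r1 : 1 - 2 * d < 1 by lra.
have mB (a b : R) : measurable (`[a, b] `&` bad).
  have -> : `[a, b] `&` bad = `[a, b] `&`
     (fun x => modulus (f (circle_point (1 - 2 * d) x))) @^-1` [set` `]-oo, expR (- t)]].
    by apply/seteqP; split => x /=; rewrite !in_itv.
  by apply: (@measurable_circle _ _ fa _ `[a, b] r0 r1); exact: measurable_itv.
have mG j : measurable (G j) by exact: mB.
have Gj j : (mu (G j) <= (32 * expR 3 * e)%:E)%E
  := bad_arc_measure (l * j%:R) d0 d4 dd' d'1 A1 V0 HA HV l0 ld' tA.
have mU : measurable (\big[setU/set0]_(j < M) G j) by apply: bigsetU_measurable.
have EU : `[0%R, (2 * pi)%R] `&` bad `<=` \big[setU/set0]_(j < M) G j.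
  move=> x [/=]; rewrite in_itv /= => /andP[x0 xpi] bx.
  have [|j] := @grid_cell _ M (x / l) (ltn0Sn _).
    rewrite divr_ge0 ?(ltW l0) //= ler_pdivrMr //.
    by rewrite /l mulrCA divff ?gt_eqF // mulr1.
  rewrite ler_pdivlMr // ler_pdivrMr // => /andP[j1 j2].
  rewrite -bigcup_mkord; exists j => //=; split => //=.
  by rewrite in_itv /= mulrC j1 /= -[X in _ + X]mul1r -mulrDl natr1.
apply: le_trans (le_measure mu (mem_set (mB _ _)) (mem_set mU) EU) _.
apply: le_trans (@Boole_inequality _ _ _ mu G M (fun j _ => mG j)) _.
apply: (@le_trans _ _ (\sum_(j < M) (32 * expR 3 * e)%:E)%E).
  by apply: lee_sum => j _; exact: Gj.
rewrite sumEFin lee_fin sumr_const card_ord -[leLHS]mulr_natl.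
have -> : 144 * expR 3 / d * e = 9 / (2 * d) * (32 * expR 3 * e).
  by field; rewrite gt_eqF.
by apply: ler_wpM2r MR; rewrite mulr_ge0 ?expR_ge0 // mulr_ge0 ?expR_ge0.
Qed.

(** Put [A1 = 25 (d' / d) (A + V)] and [c = 144 e^4].  At level [k T] with
[T = A1 (ln (c / d) + 2)] the bad set has measure at most [4^-k]; the logarithm
pays for the factor [1 / d] in [bad_circle_measure]. *)
Lemma mean_log_upper (p : R) : 1 <= p -> exists2 Cp : R, 0 < Cp &
  forall d d' A V : R,
  0 < d -> d <= 1 / 4 -> 2 * d <= d' -> d' <= 1 -> 1 <= A -> 0 <= V ->
  good_points f (1 - d') A ->
  (forall z, modulus z = 1 - d -> modulus (f z) <= expR V) ->
  (mean_log p (1 - 2 * d) f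
   <= (Cp * (25 * (d' / d) * (A + V) * (ln (144 * expR 4 / d) + 2)))%:E)%E.
Proof.
move=> p1; have [Cp Cp0 HCp] := @layer_integral R p p1.
have p0 : 0 < p by lra.
exists ((8 * Cp) `^ (1 / p)); first by rewrite powR_gt0 // mulr_gt0.
move=> d d' A V d0 d4 dd' d'1 A1 V0 HA HV.
set A2 := 25 * (d' / d) * (A + V).
set c := 144 * expR 4 / d.
have dd1 : 2 <= d' / d by rewrite ler_pdivlMr.
have A2ge : 50 * (A + V) <= A2.
  by rewrite /A2 ler_wpM2r; lra.
have c1 : 1 <= c.
  rewrite /c ler_pdivlMr // mul1r; have := expR_ge1Dx (4 : R); lra.
have lc : 0 <= ln c by rewrite ln_ge0.
set T := A2 * (ln c + 2).
have A20 : 0 < A2 by lra.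
have T2 : 2 * A2 <= T by rewrite /T; nra.
have r0 : 0 <= 1 - 2 * d by lra.
have r1 : 1 - 2 * d < 1 by lra.
have pi4 := @pi_lt4 R; have pi0 := pi_gt0 R; have pi2 := pi_ge2 R.
have mu8 : (mu `[0%R, (2 * pi)%R] <= 8%:E)%E.
  by rewrite measure_itvcc ?lee_fin; lra.
have main : (\int[mu]_(x in `[0%R, (2 * pi)%R])
   (`|lne (modulus (f (circle_point (1 - 2 * d) x)))%:E| `^ p) <= (Cp * 8 * T `^ p)%:E)%E.
  apply: (HCp _ _ mu `[0%R, (2 * pi)%R]%classic (fun x => modulus (f (circle_point (1 - 2 * d) x))) T 8) => //.
  - exact: measurable_circle.
  - by move=> x _; exact: modulus_ge0.
  - by lra.
  - by lra.
  - move=> x _; apply: (@le_trans _ _ (expR V)); last by rewrite ler_expR; lra.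
    apply: (@max_modulus _ f fa (1 - d)) => //; first by lra.
    by rewrite modulus_circle_point //; lra.
  move=> k; have tk : A + 1 < k.+1%:R * T.
    have : 1 * T <= k.+1%:R * T by rewrite ler_wpM2r ?ler1n //; lra.
    by lra.
  apply: le_trans (bad_circle_measure d0 d4 dd' d'1 A1 V0 HA HV tk) _.
  rewrite lee_fin -/A2.
  have -> : (k.+1%:R * T - 1) / A2 = k.+1%:R * (ln c + 2) - A2^-1.
    by rewrite /T; field; rewrite gt_eqF.
  have A2i : A2^-1 <= 1 by rewrite invf_le1 //; lra.
  apply: (@le_trans _ _ (c * expR (- (k.+1%:R * (ln c + 2))))).
    have -> : c = 144 * expR 3 / d * expR 1.
      have E : expR 4 = expR 3 * expR 1 :> R by rewrite -expRD; congr expR; ring.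
      by rewrite /c E; ring.
    rewrite -[leRHS]mulrA -expRD; apply: ler_wpM2l; last by rewrite ler_expR; lra.
    by apply: divr_ge0; [rewrite mulr_ge0 ?expR_ge0|exact: ltW].
  rewrite -[X in X * _](@lnK _ c) ?posrE; last lra.
  rewrite -expRD.
  have -> : (4 ^+ k.+1)^-1 = expR (- (k.+1%:R * ln 4)) :> R.
    by rewrite expRN expRM_natl lnK // posrE.
  rewrite ler_expR.
  have l4 : ln 4 <= 2 :> R.
    have -> : (4 : R) = 2 * 2 by ring.
    rewrite lnM ?posrE //; have := @ln_le_sub1 R 2 (ltr0n R 2); lra.
  have k1 : 1 <= k.+1%:R :> R by rewrite ler1n.
  have h1 : ln c <= k.+1%:R * ln c by rewrite ler_peMl.
  have h2 : k.+1%:R * ln 4 <= k.+1%:R * 2 :> R by rewrite ler_wpM2l.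
  lra.
rewrite /mean_log; set I := (\int[_]_(x in _) _)%E in main *.
have I0 : (0 <= I)%E by apply: integral_ge0 => x _; exact: poweR_ge0.
have T0 : 0 <= T by lra.
apply: (@le_trans _ _ ((8 * Cp * T `^ p)%:E `^ (1 / p))%E).
  apply: gt0_ler_poweR; rewrite ?in_itv /= ?leey ?andbT.
  - by rewrite divr_ge0 // ltW.
  - by apply: mule_ge0 => //; rewrite lee_fin divr_ge0 // mulr_ge0 // ltW.
  - by rewrite lee_fin mulr_ge0 ?powR_ge0 // mulr_ge0 // ltW.
  - apply: le_trans (lee_wpmul2l _ main) _.
      by rewrite lee_fin divr_ge0 // mulr_ge0 // ltW.
    rewrite -EFinM lee_fin.
    have h : 1 / (2 * pi) <= 1 :> R by rewrite ler_pdivrMr ?mulr_gt0 // mul1r; lra.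
    have -> : 8 * Cp * T `^ p = 1 * (Cp * 8 * T `^ p) by ring.
    by apply: ler_wpM2r h; rewrite mulr_ge0 ?powR_ge0 // mulr_ge0 // ltW.
rewrite poweR_EFin lee_fin powRM ?powR_ge0 ?mulr_ge0 ?(ltW Cp0) //.
by rewrite -powRrM mul1r mulfV ?gt_eqF // powRr1.
Qed.

(** The estimate of [circle_mean_discrete] is linear in [v = (ln^+ |f|)^p]; the
root of order [p], taken at the end, turns the factor [C / d] into its power
[1 / p]. *)
Lemma mean_log_lower (p rho x : R) (a : R[i]) : 1 <= p -> 1 / 2 <= rho -> rho < 1 ->
  0 <= x -> (mean_log p rho f <= x%:E)%E -> modulus a <= 2 * rho - 1 ->
  logmod f 0 a <= (332 / (1 - rho)) `^ (1 / p) * x.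
Proof.
move=> p1 rho2 rho1 x0 mx ar.
have p0 : 0 < p by lra.
have rho0 : 0 <= rho by lra.
have pi0 := pi_gt0 R.
pose u := logmod f 0.
have u0 z : 0 <= u z by have := logmod_geN f 0 z; rewrite oppr0.
pose v z := pospow p (u z).
have vE z : v z = u z `^ p by rewrite /v /pospow max_r.
have vP z : modulus z < 1 -> cont_at v z /\ subharm v z.
  move=> z1; split.
    by apply: (@cont_at_comp _ (pospow p)); [exact: continuous_pospow|exact: cont_at_logmod].
  have [m m0 Hm] := pospow_tangent p1 (u0 z).
  by apply: (@subharm_comp _ (pospow p) _ _ m) => //; exact: subharm_logmod.
have v0 z : 0 <= v z by rewrite vE powR_ge0.
set c := 332 / (1 - rho).
have c0 : 0 <= c by apply: divr_ge0; [exact: ler0n|rewrite subr_ge0 ltW].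
have mF : measurable_fun `[0%R, (2 * pi)%R] ((fun t => `|lne (modulus (f (circle_point rho t)))%:E| `^ p)%E : R -> \bar R).
  by apply: measurable_abs_lne_powR; exact: measurable_circle.
have va eps : 0 < eps -> v a <= eps + c * x `^ p.
  move=> eps0.
  have [N [m [N0 m0 mv vb]]] := circle_mean_discrete vP v0 rho2 rho1 ar eps0.
  apply: le_trans vb _; rewrite lerD2l -/c ler_wpM2l //.
  have NR : 0 < N%:R :> R by rewrite ltr0n.
  have := @lower_sum_le_integral R _ (2 * pi) N m N0 _ mF.
  move=> H; have {}H : ((2 * pi / N%:R * \sum_j m j)%:E <= \int[mu]_(t in `[0%R, (2 * pi)%R])
     (`|lne (modulus (f (circle_point rho t)))%:E| `^ p))%E.
    apply: H => //; first by rewrite mulr_gt0.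
      by move=> t; exact: poweR_ge0.
    move=> j t tj; apply: (@le_trans _ _ ((u (circle_point rho t) `^ p)%:E)).
      by rewrite lee_fin -vE; exact: mv.
    rewrite /u /logmod oppr0 expR0.
    have := modulus_ge0 (f (circle_point rho t)); set y := modulus _ => y0.
    have [y1|y1] := leP y 1.
      by rewrite ln1 powR0 ?gt_eqF // poweR_ge0.
    rewrite lne_EFin ?(lt_trans ltr01) // abse_EFin poweR_EFin lee_fin.
    by rewrite ger0_norm // ln_ge0 // ltW.
  rewrite -lee_fin.
  have E (P S : R) : P != 0 -> N%:R^-1 * S = 1 / (2 * P) * (2 * P / N%:R * S).
    by move=> P0; field; rewrite P0 (gt_eqF NR).
  rewrite (E pi) ?(gt_eqF pi0) //.
  have q0 : 0 <= 1 / (2 * pi) :> R by rewrite divr_ge0 // mulr_ge0 // ltW.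
  rewrite EFinM; apply: le_trans (lee_wpmul2l _ H) _; first by rewrite lee_fin.
  move: mx; rewrite /mean_log; set J := (_ * _)%E => mx.
  have J0 : (0 <= J)%E.
    by apply: mule_ge0; [rewrite lee_fin|apply: integral_ge0 => t _; exact: poweR_ge0].
  have -> : J = ((J `^ (1 / p)) `^ p)%E.
    by rewrite -poweRrM mul1r mulVf ?gt_eqF // poweRe1.
  rewrite -poweR_EFin; apply: gt0_ler_poweR => //; rewrite ?in_itv /= ?leey ?andbT.
  - exact: ltW.
  - exact: poweR_ge0.
  - by rewrite lee_fin.
have {}va : v a <= c * x `^ p.
  by apply/ler_addgt0Pr => e /va; rewrite addrC.
have -> : logmod f 0 a = (v a) `^ (1 / p).
  by rewrite vE -powRrM mul1r mulfV ?gt_eqF // powRr1 //; exact: u0.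
apply: (@le_trans _ _ ((c * x `^ p) `^ (1 / p))).
  apply: ge0_ler_powR; rewrite ?nnegrE //; first by rewrite divr_ge0 // ltW.
  by rewrite mulr_ge0 ?powR_ge0.
by rewrite powRM ?powR_ge0 // -powRrM mul1r mulfV ?gt_eqF // powRr1.
Qed.

End CircleMeans.

(** * Orders of growth *)

Section LimitsAtOne.
Context {R : realType}.
Implicit Types (g : R -> \bar R) (y : \bar R).

Lemma left_nbhs1 (e : R) : 0 < e -> (1 : R)^'- [set r | 1 - e < r < 1].
Proof.
move=> e0; apply/(@nbhs_ballP R); exists e => //= r; rewrite -ball_normE /= => re r1.
by rewrite r1 andbT; move: re; rewrite ltr_norml; lra.
Qed.

Lemma left_nbhs1_sub (V : set R) : (1 : R)^'- V ->
  exists2 e : R, 0 < e & forall r, 1 - e < r < 1 -> V r.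
Proof.
move=> /(@nbhs_ballP R) [e /= e0 He]; exists e => // r /andP[r1 r2].
by apply: He => //; rewrite -ball_normE /= ltr_norml; lra.
Qed.

Lemma limf_einf_lt g y (e : R) : (limf_einf g (1 : R)^'- < y)%E -> 0 < e ->
  exists r, 1 - e < r < 1 /\ (g r < y)%E.
Proof.
rewrite limf_einfE => gy e0.
have : (ereal_inf (g @` [set r | (1 - e < r < 1)%R]) < y)%E.
  apply: le_lt_trans gy; apply: ereal_sup_ubound.
  by exists [set r | 1 - e < r < 1] => //; exact: left_nbhs1.
by move/ereal_inf_lt => [_ [r re <-] gr]; exists r.
Qed.

Lemma limf_einf_le g y : (forall e : R, 0 < e -> exists r, 1 - e < r < 1 /\ (g r <= y)%E) ->
  (limf_einf g (1 : R)^'- <= y)%E.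
Proof.
move=> H; rewrite limf_einfE; apply: ge_ereal_sup => _ [V /left_nbhs1_sub[e e0 HV] <-].
have [r [re gr]] := H _ e0; apply: le_trans gr; apply: ereal_inf_lbound.
by exists r => //; exact: HV.
Qed.

Lemma limf_einf_ge0 g : (forall r, 0 < r < 1 -> (0 <= g r)%E) ->
  (0 <= limf_einf g (1 : R)^'-)%E.
Proof.
move=> g0; rewrite limf_einfE.
apply: (@le_trans _ _ (ereal_inf (g @` [set r | (1 - 1 < r < 1)%R]))).
  by apply: le_ereal_inf_tmp => _ [r re <-]; apply: g0; move: re; rewrite /= subrr.
apply: ereal_sup_ubound; exists [set r | 1 - 1 < r < 1] => //.
by apply: left_nbhs1.
Qed.

Lemma limf_esup_lt g y : (limf_esup g (1 : R)^'- < y)%E ->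
  exists2 e : R, 0 < e & forall r, 1 - e < r < 1 -> (g r < y)%E.
Proof.
rewrite limf_esupE => /ereal_inf_lt [_ [V /left_nbhs1_sub[e e0 HV] <-] sy].
exists e => // r re; apply: le_lt_trans sy; apply: ereal_sup_ubound.
by exists r => //; exact: HV.
Qed.

Lemma limf_esup_le g y : (forall r, 0 < r < 1 -> (g r <= y)%E) ->
  (limf_esup g (1 : R)^'- <= y)%E.
Proof.
move=> H; rewrite limf_esupE.
apply: (@le_trans _ _ (ereal_sup (g @` [set r | (1 - 1 < r < 1)%R]))).
  apply: ereal_inf_lbound; exists [set r | 1 - 1 < r < 1] => //.
  by apply: left_nbhs1.
by apply: ge_ereal_sup => _ [r re <-]; apply: H; move: re; rewrite /= subrr.
Qed.

Lemma le_of_forall_gt (a b : \bar R) (c : R) :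
  (forall y : R, (b < y%:E)%E -> (a <= (y + c)%:E)%E) -> (a <= b + c%:E)%E.
Proof.
case: b => [b| |] H.
- apply/lee_addgt0Pr => e e0.
  have := H (b + e); rewrite lte_fin ltrDl e0 => /(_ isT).
  by rewrite -!EFinD addrAC.
- by rewrite leey.
- case: a H => [a| |] H.
  + have := H (a - c - 1)%R; rewrite ltNyr => /(_ isT).
    by rewrite lee_fin addrAC subrK lerDl oppr_ge0 ler10.
  + by have := H 0%R; rewrite ltNyr => /(_ isT).
  + by rewrite leNye.
Qed.

End LimitsAtOne.

Section Growth.
Context {R : realType}.
Variable f : R[i] -> R[i].
Hypothesis fa : analytic_in_disc f.

Lemma logp_EFin (x : R) : logp x%:E = (lnp x)%:E.
Proof.
rewrite /logp /lnp /=; case: ifP => x0.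
  have x1 : x <= 1 by lra.
  by rewrite (max_l x1) ln1 maxeNy.
have xp : 0 < x by rewrite ltNge x0.
have [x1|x1] := leP x 1; first by rewrite ln1 max_l // lee_fin -ln1 ler_ln ?posrE.
by rewrite max_r // lee_fin ln_ge0 // ltW.
Qed.

Lemma lnp_le_id (x : R) : x <= expR (lnp x).
Proof. by rewrite /lnp lnK ?posrE ?lt_max ?ltr01 // le_max lexx orbT. Qed.

Lemma lnp_le (x y : R) : x <= y -> lnp x <= lnp y.
Proof.
move=> xy; rewrite ler_ln ?posrE ?lt_max ?ltr01 //.
by rewrite ge_max !le_max lexx xy orbT.
Qed.

Lemma lnp_expR (x : R) : 0 <= x -> lnp (expR x) = x.
Proof. by move=> x0; rewrite lnp_ge1 ?expRK // -expR0 ler_expR. Qed.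

Lemma maxmod_ge (r : R) (z : R[i]) : r < 1 -> modulus z = r ->
  modulus (f z) <= maxmod f r.
Proof.
move=> r1 zr; have [B _ HB] := bounded_disc fa r1.
apply: ub_le_sup; last by exists z.
by exists (expR B) => _ [w /= wr <-]; apply: HB; rewrite wr.
Qed.

Lemma maxmod_le (r M : R) : 0 <= r ->
  (forall z, modulus z = r -> modulus (f z) <= M) -> maxmod f r <= M.
Proof.
move=> r0 H; apply: ge_sup.
  exists (modulus (f (circle_point r 0))), (circle_point r 0) => //=.
  exact: modulus_circle_point.
by move=> _ [z /= zr <-]; exact: H.
Qed.

Let ratioM (r : R) : \bar R := (logp (logp (maxmod f r)%:E) * ((ln (1 / (1 - r)))^-1)%:E)%E.
Let ratioP (p r : R) : \bar R := (logp (mean_log p r f) * ((- ln (1 - r))^-1)%:E)%E.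

Lemma ln_inv_1sub (r : R) : r < 1 -> ln (1 / (1 - r)) = - ln (1 - r).
Proof. by move=> r1; rewrite div1r lnV // posrE subr_gt0. Qed.

Lemma ln_inv_gt0 (r : R) : 0 < r < 1 -> 0 < - ln (1 - r).
Proof.
move=> /andP[r0 r1]; rewrite oppr_gt0 ln_lt0 //; lra.
Qed.

Lemma ratioME (r : R) : r < 1 ->
  ratioM r = (lnp (lnp (maxmod f r)) / (- ln (1 - r)))%:E.
Proof. by move=> r1; rewrite /ratioM !logp_EFin ln_inv_1sub // -EFinM. Qed.

Lemma ratioM_lt (r y : R) : 0 < r < 1 -> (ratioM r < y%:E)%E ->
  forall z, modulus z = r -> modulus (f z) <= expR (expR (y * - ln (1 - r))).
Proof.
move=> r01; have /andP[r0 r1] := r01.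
rewrite ratioME // lte_fin ltr_pdivrMr ?ln_inv_gt0 // => /ltW H z zr.
apply: le_trans (maxmod_ge r1 zr) _; apply: le_trans (lnp_le_id _) _.
by rewrite ler_expR; apply: le_trans (lnp_le_id _) _; rewrite ler_expR.
Qed.

Lemma ratioM_le (r y : R) : 0 < r < 1 -> 0 <= y ->
  (forall z, modulus z = r -> modulus (f z) <= expR (expR (y * - ln (1 - r)))) ->
  (ratioM r <= y%:E)%E.
Proof.
move=> r01 y0 H; have /andP[r0 r1] := r01; have X0 := ln_inv_gt0 r01.
rewrite ratioME // lee_fin ler_pdivrMr //.
rewrite -[leRHS]lnp_expR; last by rewrite mulr_ge0 // ltW.
apply: lnp_le; rewrite -[leRHS]lnp_expR ?expR_ge0 //.
by apply/lnp_le/maxmod_le => //; exact: ltW.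
Qed.

Lemma mean_log_ge0 (p r : R) : (0 <= mean_log p r f)%E.
Proof. exact: poweR_ge0. Qed.

Lemma ratioP_lt (p r y : R) : 0 < r < 1 -> (ratioP p r < y%:E)%E ->
  (mean_log p r f <= (expR (y * - ln (1 - r)))%:E)%E.
Proof.
move=> r01; have X0 := ln_inv_gt0 r01; have := mean_log_ge0 p r.
rewrite /ratioP; case: (mean_log p r f) => [m| |] //.
- move=> _; rewrite logp_EFin -EFinM lte_fin ltr_pdivrMr // => /ltW H.
  by rewrite lee_fin; apply: le_trans (lnp_le_id _) _; rewrite ler_expR.
- have -> : logp (+oo%E : \bar R) = +oo%E by rewrite /logp /= maxey.
  by rewrite gt0_mulye // lte_fin invr_gt0.
Qed.

Lemma ratioP_le (p r y : R) : 0 < r < 1 -> 0 <= y ->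
  (mean_log p r f <= (expR (y * - ln (1 - r)))%:E)%E -> (ratioP p r <= y%:E)%E.
Proof.
move=> r01 y0; have X0 := ln_inv_gt0 r01; have := mean_log_ge0 p r.
rewrite /ratioP; case: (mean_log p r f) => [m| |] // _.
rewrite lee_fin => H; rewrite logp_EFin -EFinM lee_fin ler_pdivrMr //.
rewrite -[leRHS]lnp_expR; last by rewrite mulr_ge0 // ltW.
exact: lnp_le.
Qed.

Lemma lambdaM_ge0 : (0 <= lambdaM f)%E.
Proof.
apply: limf_einf_ge0 => r r01; rewrite -/(ratioM r) ratioME; last by case/andP: r01.
by rewrite lee_fin divr_ge0 ?lnp_ge0 // ltW // ln_inv_gt0.
Qed.

Lemma logp_ge0 (x : \bar R) : (0 <= logp x)%E.
Proof. by rewrite /logp le_max lexx. Qed.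

Lemma lambda_mean_ge0 (p : R) : (0 <= lambda_mean p f)%E.
Proof.
apply: limf_einf_ge0 => r r01; apply: mule_ge0; first exact: logp_ge0.
by rewrite lee_fin invr_ge0 ltW // ln_inv_gt0.
Qed.

(** Radii [rho] with a small mean are moved to [2 rho - 1].  This doubles the
distance to the unit circle, which changes [X = - ln (1 - rho)] by [ln 2] only. *)
Lemma lambdaM_le_lambda_mean (p : R) : 1 <= p ->
  (lambdaM f <= lambda_mean p f + (1 / p)%:E)%E.
Proof.
move=> p1; have p0 : 0 < p by lra.
apply: le_of_forall_gt => y ly.
have y0 : 0 < y by rewrite -lte_fin; apply: le_lt_trans ly; exact: lambda_mean_ge0.
have ip0 : 0 < 1 / p by rewrite divr_gt0.
have l2 : 0 < ln 2 :> R by rewrite ln_gt0 // ltr1n.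
apply/lee_addgt0Pr => eta eta0; rewrite -EFinD.
set Y := y + 1 / p + eta.
have Y0 : 0 < Y by rewrite /Y; lra.
have l332 : 0 <= ln 332 :> R by rewrite ln_ge0 // (ler_nat R 1).
apply: limf_einf_le => e e0.
pose X0 : R := (1 / p * ln 332 + Y * ln 2) / eta.
have X00 : 0 <= X0.
  by rewrite /X0 divr_ge0 ?(ltW eta0) // addr_ge0 // mulr_ge0 // ltW.
have m0 : 0 < Num.min (e / 2) (Num.min (1 / 4) (expR (- X0))).
  by rewrite !lt_min expR_gt0 !divr_gt0.
have [rho [/andP[rho1 rho2] Hrho]] := limf_einf_lt ly m0.
set d := 1 - rho.
have d0 : 0 < d by rewrite /d; lra.
have : d < Num.min (e / 2) (Num.min (1 / 4) (expR (- X0))) by rewrite /d; lra.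
rewrite !lt_min => /andP[de /andP[d4 dX]].
set X := - ln d.
have XX0 : X0 < X.
  by rewrite /X ltrNr -[ltRHS]expRK ltr_ln ?posrE ?expR_gt0.
have r01 : 0 < rho < 1 by rewrite /d in d4; lra.
have mle := ratioP_lt r01 Hrho; rewrite -/d -/X in mle.
exists (2 * rho - 1).
have rE : 1 - (2 * rho - 1) = 2 * d by rewrite /d; ring.
split; first by rewrite /d in d4 de d0; lra.
apply: ratioM_le; [by rewrite /d in d4; lra|exact: ltW|].
move=> z zr; rewrite rE.
have h : 1 / 2 <= rho by rewrite /d in d4; lra.
have := mean_log_lower fa p1 h rho2 (expR_ge0 _) mle (_ : modulus z <= 2 * rho - 1).
rewrite zr lexx => /(_ isT) H.
have -> : - ln (2 * d) = X - ln 2 by rewrite lnM ?posrE // /X; ring.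
have {}H : logmod f 0 z <= expR (Y * (X - ln 2)).
  have p332 : 0 < 332 :> R by exact: (ltr0Sn R 331).
  apply: le_trans H _; rewrite -/d /powR (gt_eqF (divr_gt0 p332 d0)).
  rewrite -expRD ler_expR (lnM (x := 332)) ?posrE ?invr_gt0; [|exact: p332|exact: d0].
  rewrite lnV ?posrE; last exact: d0.
  rewrite -/X.
  have := XX0; rewrite /X0 ltr_pdivrMr // /Y => H; lra.
have [fz|fz] := leP (modulus (f z)) 1.
  by apply: le_trans fz _; rewrite -expR0 ler_expR expR_ge0.
rewrite -[leLHS]lnK ?posrE ?(lt_trans ltr01) // ler_expR; apply: le_trans H.
by apply: logmod_ge; rewrite lnK // posrE (lt_trans ltr01).
Qed.

Lemma sigmaM_gt0_nonzero : (0 < sigmaM f)%E ->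
  exists2 z, modulus z < 1 & f z != 0.
Proof.
move=> s0; apply: contrapT => Hn.
suff : (sigmaM f <= 0)%E by rewrite leNgt s0.
apply: limf_esup_le => r r01; apply: (ratioM_le r01 (lexx 0)) => z zr.
have [->|fz] := eqVneq (f z) 0; first by rewrite modulus0 expR_ge0.
by exfalso; apply: Hn; exists z => //; rewrite zr; case/andP: r01.
Qed.

End Growth.

(** * The upper bound for the order of the means *)

Section UpperBound.
Context {R : realType}.
Variable f : R[i] -> R[i].
Hypothesis fa : analytic_in_disc f.

(** With [N = e^h] and [q = N^s] this is the growth hypothesis of
[good_points_chain]; the finitely many radii about which the upper limit says
nothing only affect the constant. *)
Lemma growth_at_chain_radii (s h : R) : (sigmaM f < s%:E)%E -> 0 < s -> 0 < h ->
  exists2 K : R, 0 <= K & forall k z, modulus z = 1 - (expR h ^+ k)^-1 / 2 ->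
    modulus (f z) <= expR (K * expR (h * s) ^+ k).
Proof.
move=> ss s0 h0; have [e e0 He] := limf_esup_lt ss.
have e1 : 1 - e < 1 by lra.
have [B B0 HB] := bounded_disc fa e1.
exists (expR (s * ln 2) + B); first by rewrite addr_ge0 ?expR_ge0.
move=> k z zk.
have N1 : 1 <= expR h ^+ k by rewrite exprn_ege1 // -expR0 ler_expR ltW.
have q1 : 1 <= expR (h * s) ^+ k.
  by rewrite exprn_ege1 // -expR0 ler_expR mulr_ge0 // ltW.
have N0 : 0 < expR h ^+ k by lra.
have iN : 0 < (expR h ^+ k)^-1 <= 1 by rewrite invr_gt0 N0 invf_le1.
have z01 : 0 < modulus z < 1 by rewrite zk; lra.
have [ze|ze] := leP (modulus z) (1 - e).
  apply: le_trans (HB _ ze) _; rewrite ler_expR.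
  have E0 := expR_ge0 (s * ln 2).
  by apply: (@le_trans _ _ ((expR (s * ln 2) + B) * 1)); [lra|rewrite ler_wpM2l //; lra].
have zr : 1 - e < modulus z < 1 by rewrite ze; case/andP: z01.
apply: le_trans (ratioM_lt fa z01 (He _ zr) erefl) _.
rewrite ler_expR.
have -> : 1 - modulus z = (expR h ^+ k)^-1 / 2 by rewrite zk; ring.
rewrite lnM ?posrE ?invr_gt0 // !lnV ?posrE //.
have -> : ln (expR h ^+ k) = k%:R * h by rewrite lnXn ?expR_gt0 // expRK mulr_natl.
have -> : s * - (- (k%:R * h) - ln 2) = s * ln 2 + k%:R * (h * s) by ring.
by rewrite expRD expRM_natl ler_wpM2r //; lra.
Qed.

(** The bound of [mean_log_upper] with [d = e^-X], [d' <= e^(h - x X)] and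
[A <= K' V], [V = e^(lam X)]: the logarithmic factor is absorbed by the slack
between [y] and the exponent [1 - x + lam]. *)
Lemma upper_bound_asymptotics (Cp h K' x lam y : R) :
  0 < Cp -> 1 <= K' -> 1 - x + lam < y -> 0 <= y ->
  exists2 X0, 0 <= X0 & forall X d' A, X0 < X -> 0 <= d' ->
    d' <= expR (h - x * X) -> 0 <= A -> A <= K' * expR (lam * X) ->
    Cp * (25 * (d' / expR (- X)) * (A + expR (lam * X))
          * (ln (144 * expR 4 / expR (- X)) + 2)) <= expR (y * (X - ln 2)).
Proof.
move=> Cp0 K'1 yl y0; set e := 1 - x + lam in yl.
pose eta : R := (y - e) / 2.
have eta0 : 0 < eta by rewrite divr_gt0 // subr_gt0.
have yE : y = e + 2 * eta by rewrite /eta mulrC divfK // addrC subrK.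
pose c2 : R := ln 144 + 6.
have c20 : 0 <= c2 by rewrite addr_ge0 // ln_ge0 // (ler_nat R 1).
have ie0 : 0 < 1 / eta + c2 by rewrite ltr_pwDl // divr_gt0.
have K10 : 0 < K' + 1 by rewrite ltr_pwDr // (le_trans _ K'1).
pose D : R := Cp * (25 * expR h * (K' + 1)) * (1 / eta + c2).
have D0 : 0 < D.
  have c25 : 0 < 25 * expR h by rewrite mulr_gt0 // expR_gt0.
  by rewrite mulr_gt0 // mulr_gt0 // mulr_gt0.
exists (Num.max 0 ((ln D + y * ln 2) / eta)); first by rewrite le_max lexx.
move=> X d' A; rewrite gt_max => /andP[Xp X2] d'0 d'le A0 AV.
have {}X2 : ln D + y * ln 2 < eta * X by move: X2; rewrite ltr_pdivrMr // (mulrC X).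
set V := expR (lam * X) in AV *.
have V0 : 0 <= V by exact: expR_ge0.
have lnE : ln (144 * expR 4 / expR (- X)) + 2 = X + c2.
  rewrite !lnM ?posrE ?mulr_gt0 ?invr_gt0 ?expR_gt0 // lnV ?posrE ?expR_gt0 //.
  by rewrite !expRK /c2; ring.
rewrite lnE.
have dd0 : 0 <= d' / expR (- X) by rewrite divr_ge0 // expR_ge0.
have dd : d' / expR (- X) <= expR (h + (1 - x) * X).
  have -> : h + (1 - x) * X = (h - x * X) + X by ring.
  by rewrite expRN invrK expRD ler_wpM2r ?expR_ge0.
have AVV : A + V <= (K' + 1) * V by rewrite mulrDl mul1r lerD2r.
have XE : X + c2 <= (1 / eta + c2) * expR (eta * X).
  have hX := expR_ge1Dx (eta * X).
  have eX : 0 < eta * X by rewrite mulr_gt0.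
  have h3 : X <= 1 / eta * expR (eta * X).
    by rewrite mul1r mulrC ler_pdivlMr // mulrC; clear - hX; lra.
  have h4 : c2 * 1 <= c2 * expR (eta * X).
    by rewrite ler_wpM2l //; clear - hX eX; lra.
  by rewrite mulrDl lerD // -[leLHS]mulr1.
have step1 : 25 * (d' / expR (- X)) * (A + V) <= 25 * expR (h + (1 - x) * X) * ((K' + 1) * V).
  apply: ler_pM => //.
  - exact: mulr_ge0.
  - exact: addr_ge0.
  - by rewrite ler_wpM2l.
have step2 : Cp * (25 * (d' / expR (- X)) * (A + V) * (X + c2)) <=
    Cp * (25 * expR (h + (1 - x) * X) * ((K' + 1) * V) * ((1 / eta + c2) * expR (eta * X))).
  rewrite ler_wpM2l ?(ltW Cp0) //; apply: ler_pM => //.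
  - by apply: mulr_ge0; [exact: mulr_ge0|exact: addr_ge0].
  - by rewrite addr_ge0 // ltW.
apply: le_trans step2 _.
have -> : Cp * (25 * expR (h + (1 - x) * X) * ((K' + 1) * V) * ((1 / eta + c2) * expR (eta * X)))
   = D * expR ((e + eta) * X).
  have -> : (e + eta) * X = (1 - x) * X + lam * X + eta * X by rewrite /e; ring.
  by rewrite /D /V !expRD; ring.
rewrite -[X in X * _](@lnK _ D) ?posrE // -expRD ler_expR.
have -> : y * (X - ln 2) = (e + eta) * X + eta * X - y * ln 2 by rewrite yE; ring.
by clear - X2; lra.
Qed.

(** The good points at distance [N^-k] closest to [d^(lam / s)] carry the bound
[N^(k s) <= d^-lam], the same order as the growth of [ln M] at distance [d];
both are then transported from there to distance [2 d]. *)
Lemma lambda_mean_le_of_gt (p s lam y : R) : 1 <= p -> 1 < s -> 0 < lam -> lam < s ->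
  (0 < sigmaM f)%E -> (sigmaM f < s%:E)%E -> (lambdaM f < lam%:E)%E ->
  1 + lam * (1 - 1 / s) < y -> (lambda_mean p f <= y%:E)%E.
Proof.
move=> p1 s1 lam0 lams sig0 sigs laml yl.
have s0 : 0 < s by lra.
have [C HC] := step_constant_exists fa; have C1 := HC.1.
have [z1 z11 fz1] := sigmaM_gt0_nonzero sig0.
have ss1 : 0 < s - 1 by lra.
have l4C : 0 <= ln (4 * C) by rewrite ln_ge0 //; lra.
(* [N = e^h] is so large that [N^s >= 4 C N] *)
pose h : R := ln (4 * C) / (s - 1) + 1.
have h1 : 1 <= h by rewrite /h lerDr divr_ge0 // ltW.
have h0 : 0 < h by lra.
have N2 : 2 <= expR h by have := expR_ge1Dx h; lra.
have Nq : 4 * C * expR h <= expR (h * s).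
  rewrite -[X in X * _](@lnK _ (4 * C)) ?posrE; last by lra.
  rewrite -expRD ler_expR.
  have -> : h * s = h * (s - 1) + h by ring.
  have hs : h * (s - 1) = ln (4 * C) + (s - 1) by rewrite /h; field; rewrite gt_eqF.
  by rewrite lerD2r hs lerDl ltW.
have [K K0 HK] := growth_at_chain_radii sigs s0 h0.
have [K' K'1 Hreach] := good_points_chain fa HC z11 fz1 N2 Nq K0 HK.
have [Cp Cp0 HCp] := mean_log_upper fa p1.
pose x : R := lam / s.
have x0 : 0 < x by rewrite divr_gt0.
have x1 : x < 1 by rewrite ltr_pdivrMr // mul1r.
have xs : x * s = lam by rewrite /x divfK // gt_eqF.
have yl' : 1 - x + lam < y.
  by have -> : 1 - x + lam = 1 + lam * (1 - 1 / s) by rewrite /x; ring.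
have yp : 0 <= y.
  by apply: le_trans (ltW yl'); rewrite addr_ge0 ?subr_ge0 // ltW.
have [X1 X10 HX] := upper_bound_asymptotics h Cp0 K'1 yl' yp.
pose X0 : R := Num.max (ln 2 / (1 - x)) X1.
apply: limf_einf_le => e e0.
have m0 : 0 < Num.min (e / 2) (Num.min (1 / 4) (expR (- X0))).
  by rewrite !lt_min expR_gt0 !divr_gt0.
have [rho [/andP[rho1 rho2] Hrho]] := limf_einf_lt laml m0.
set d := 1 - rho.
have d0 : 0 < d by rewrite /d; lra.
have : d < Num.min (e / 2) (Num.min (1 / 4) (expR (- X0))) by rewrite /d; lra.
rewrite !lt_min => /andP[de /andP[d4 dX]].
set X := - ln d.
have dE : d = expR (- X) by rewrite opprK lnK.
have : X0 < X by rewrite /X ltrNr -[ltRHS]expRK ltr_ln ?posrE ?expR_gt0.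
rewrite /X0 gt_max => /andP[Xx XX1].
have {}Xx : ln 2 < (1 - x) * X by move: Xx; rewrite ltr_pdivrMr ?subr_gt0 // mulrC.
have Xp : 0 < X by exact: le_lt_trans XX1.
have r01 : 0 < rho < 1 by clear - d4 d0; rewrite /d in d4 d0; lra.
have rhoE : rho = 1 - d by rewrite /d; ring.
have HV := ratioM_lt fa r01 Hrho; rewrite -/d -/X {1}rhoE in HV.
set V := expR (lam * X) in HV.
(* the last radius [1 - N^-k] not beyond [1 - d^x] *)
have xXh : 0 <= x * X / h by apply: divr_ge0; [apply: mulr_ge0|]; exact: ltW.
have /andP[k1 k2] := truncn_itv xXh.
set k := Num.trunc _ in k1 k2.
rewrite ler_pdivlMr // in k1; rewrite ltr_pdivrMr // -natr1 mulrDl mul1r in k2.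
pose d' : R := (expR h ^+ k)^-1.
have d'E : d' = expR (- (k%:R * h)) by rewrite expRN expRM_natl.
have d'2 : 2 * d <= d'.
  rewrite d'E dE -[X in X * _](@lnK _ 2) ?posrE // -expRD ler_expR.
  by clear - k1 Xx; lra.
have d'1 : d' <= 1.
  by rewrite d'E -expR0 ler_expR oppr_le0 mulr_ge0 // ltW.
pose A : R := K' * expR (h * s) ^+ k.
have q1 : 1 <= expR (h * s) ^+ k.
  by rewrite exprn_ege1 // -expR0 ler_expR mulr_ge0 // ltW.
have A1 : 1 <= A by rewrite /A -[leLHS]mulr1 ler_pM.
have AV : A <= K' * V.
  rewrite /A /V ler_wpM2l //; first exact: le_trans K'1.
  by rewrite -expRM_natl ler_expR mulrA -xs [leRHS]mulrAC ler_wpM2r // ltW.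
have V0 : 0 <= V by exact: expR_ge0.
have mle := HCp d d' A V d0 (ltW d4) d'2 d'1 A1 V0 (Hreach k) HV.
exists (1 - 2 * d); split; first by clear - d0 de; lra.
apply: ratioP_le => //; first by clear - d0 d4; lra.
apply: le_trans mle _; rewrite lee_fin.
have -> : - ln (1 - (1 - 2 * d)) = X - ln 2.
  by rewrite opprB addrCA subrr addr0 lnM ?posrE // /X; ring.
rewrite dE; apply: HX => //.
- by rewrite d'E expR_ge0.
- by rewrite d'E ler_expR; clear - k2; lra.
- exact: le_trans A1.
Qed.

(** The limit [s -> max (1, sig)], [lam' -> lam] in the preceding bound; the
positive part of [1 - 1 / sig] is [1 - 1 / max (1, sig)]. *)
Lemma lambda_mean_le (p lam sig : R) : 1 <= p ->
  lambdaM f = lam%:E -> sigmaM f = sig%:E -> 0 <= lam -> lam < sig ->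
  (lambda_mean p f <= (lam * Num.max 0 (1 - sig^-1) + 1)%:E)%E.
Proof.
move=> p1 lamE sigE lam0 lamsig.
have sig0 : 0 < sig by lra.
pose m : R := Num.max 1 sig.
have m1 : 1 <= m by rewrite le_max lexx.
have mE : Num.max 0 (1 - sig^-1) = 1 - m^-1.
  rewrite /m; have [s1|s1] := leP sig 1.
    rewrite invr1 subrr max_l // subr_le0 -invr1 lef_pV2 ?posrE //.
  by rewrite max_r // subr_ge0 invf_le1 // ltW.
rewrite mE; apply/lee_addgt0Pr => e e0; rewrite -EFinD.
pose e' := e / (3 + lam).
have l3 : 0 < 3 + lam by lra.
have e'0 : 0 < e' by rewrite divr_gt0.
have eE : e = (3 + lam) * e' by rewrite /e' mulrC divfK // gt_eqF.
have sm : sig <= m by rewrite le_max lexx orbT.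
apply: (@lambda_mean_le_of_gt p (m + e') (lam + e')) => //.
- by clear - m1 e'0; lra.
- by clear - lam0 e'0; lra.
- by clear - lamsig sm; lra.
- by rewrite sigE lte_fin.
- by rewrite sigE lte_fin; clear - sm e'0; lra.
- by rewrite lamE lte_fin ltrDl.
have me0 : 0 < m + e' by lra.
have m0 : 0 < m by lra.
have h1 : 1 / (m + e') <= 1 by rewrite ler_pdivrMr // mul1r; lra.
have h0 : 0 <= 1 / (m + e') by rewrite divr_ge0 // ltW.
have h2 : m^-1 - 1 / (m + e') <= e'.
  have -> : m^-1 - 1 / (m + e') = e' / (m * (m + e')).
    by field; rewrite (gt_eqF m0) (gt_eqF me0).
  rewrite ler_pdivrMr ?mulr_gt0 // ler_peMr ?(ltW e'0) //.
  by rewrite -[leLHS]mulr1 ler_pM //; lra.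
have h3 := ler_wpM2l lam0 h2.
have h4 : e' * (1 - 1 / (m + e')) <= e' * 1 by rewrite ler_wpM2l ?(ltW e'0) //; lra.
rewrite eE; lra.
Qed.

End UpperBound.

Theorem corollary3 (R : realType) (f : R[i]%C -> R[i]%C) (lam : R -> R)
    (kappa eta p : R) :
  analytic_in_disc f ->
  generalized_proximate_order f kappa lam ->
  (1 < lambdaM f /\ lambdaM f < sigmaM f /\ sigmaM f < +oo)%E \/
  (0 <= lambdaM f /\ lambdaM f < sigmaM f /\ sigmaM f <= 1)%E ->
  (0 < eta)%R -> (eta%:E < sigmaM f - lambdaM f)%E ->
  (1 <= p)%R ->
  (lambda_mean p f <= lambdaM f * maxe 0 (1 - (sigmaM f)^-1) + 1)%E /\
  (lambdaM f <= lambda_mean p f + (1 / p)%:E)%E.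
Proof.
move=> fa _ H _ _ p1; split; last exact: lambdaM_le_lambda_mean.
have l0 := lambdaM_ge0 f.
have [ls sy] : (lambdaM f < sigmaM f)%E /\ (sigmaM f < +oo)%E.
  case: H => [[_ [ls sy]]|[_ [ls s1]]]; first by [].
  by split => //; apply: le_lt_trans s1 _; exact: ltry.
case sigE : (sigmaM f) ls sy => [sig| |] //; last by rewrite ltNge leNye.
case lamE : (lambdaM f) l0 => [l| |] //; rewrite lee_fin lte_fin => l0 ls _.
have sig0 : 0 < sig by exact: le_lt_trans ls.
apply: le_trans (lambda_mean_le fa p1 lamE sigE l0 ls) _.
by rewrite inver gt_eqF //= -EFinB -EFin_max -EFinM -EFinD.
Qed.
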